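(* Given a permutation $\pi\in\mathbb{S}_n$, its $5$-profile $\left(\#\tau(\pi)\right)_{\tau\in\mathbb{S}_5}$ can be computed in $\widetilde{\mathcal{O}}(n^{7/4})$ time.
   Context: For $\tau\in\mathbb{S}_k$ and $\pi\in\mathbb{S}_n$ (given as the vector $(\pi(1),\dots,\pi(n))$), $\#\tau(\pi)$ is the number of $k$-tuples $1\le i_1<\dots<i_k\le n$ with $\pi(i_j)<\pi(i_l)$ iff $\tau(j)<\tau(l)$ for all $j,l$. $\widetilde{\mathcal{O}}$ hides polylogarithmic factors in $n$. *)

(* Defs.v *)
From HB Require Import structures.
From mathcomp Require Import all_boot all_order all_fingroup all_algebra.
From mathcomp Require Import all_classical all_reals all_analysis.
Set Implicit Arguments.
Unset Strict Implicit.
Unset Printing Implicit Defensive.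
Import Order.TTheory GRing.Theory Num.Theory.
Import numFieldNormedType.Exports.

(* Positions and values are 0-based: 'I_n stands for {1, ..., n}. *)
Definition is_occurrence (k n : nat) (tau : 'S_k) (pi : 'S_n)
    (i : {ffun 'I_k -> 'I_n}) : bool :=
  [forall j : 'I_k, forall l : 'I_k, (j < l) ==> (i j < i l)] &&
  [forall j : 'I_k, forall l : 'I_k, (pi (i j) < pi (i l)) == (tau j < tau l)].

Definition pattern_count (k n : nat) (tau : 'S_k) (pi : 'S_n) : nat :=
  #|[pred i : {ffun 'I_k -> 'I_n} | is_occurrence tau pi i]|.

Definition profile (k n : nat) (pi : 'S_n) : {ffun 'S_k -> nat} :=
  [ffun tau => pattern_count tau pi].

(* Word RAM with w-bit words, stored as natural numbers below 2 ^ w.  Registers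
   are named statically by the program; memory cells are addressed by the
   contents of a register.  Each instruction takes one unit of time. *)
Inductive binop := OAdd | OSub | OMul | ODiv | OMod | OLt | OEq.

Inductive instr :=
| Const (r c : nat)               (* r := c *)
| Op (o : binop) (r a b : nat)    (* r := a o b *)
| Read (r a : nat)                (* r := memory[a] *)
| Write (a r : nat)               (* memory[a] := r *)
| Jz (r l : nat).                 (* if r = 0 then goto instruction l *)

Definition program := seq instr.

Record state := State { pc : nat; reg : nat -> nat; memory : nat -> nat }.

(* Arithmetic is modulo 2 ^ w.  For words a and b, [a + (2 ^ w - b)] is a - b
   modulo 2 ^ w, with no truncation.  As usual a %/ 0 = 0 and a %% 0 = a. *)
Definition eval_binop (w : nat) (o : binop) (a b : nat) : nat :=
  match o with
  | OAdd => a + b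
  | OSub => a + (2 ^ w - b)
  | OMul => a * b
  | ODiv => a %/ b
  | OMod => a %% b
  | OLt => nat_of_bool (a < b)
  | OEq => nat_of_bool (a == b)
  end %% 2 ^ w.

Definition set_reg (s : state) (r v : nat) : state :=
  State (pc s).+1 [eta reg s with r |-> v] (memory s).

Definition exec_instr (w : nat) (i : instr) (s : state) : state :=
  match i with
  | Const r c => set_reg s r (c %% 2 ^ w)
  | Op o r a b => set_reg s r (eval_binop w o (reg s a) (reg s b))
  | Read r a => set_reg s r (memory s (reg s a))
  | Write a r => State (pc s).+1 (reg s) [eta memory s with reg s a |-> reg s r]
  | Jz r l => State (if reg s r == 0 then l else (pc s).+1) (reg s) (memory s)
  end.

(* The machine halts when the program counter leaves the program, and the
   state no longer changes from then on. *)
Definition halted (P : program) (s : state) : bool := size P <= pc s.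

Definition step (w : nat) (P : program) (s : state) : state :=
  if onth P (pc s) is Some i then exec_instr w i s else s.

(* Cell 0 holds n, cells 1, ..., n hold the vector (pi(1), ..., pi(n)) with
   values in {1, ..., n}, and everything else is zero. *)
Definition input_mem (n : nat) (pi : 'S_n) (a : nat) : nat :=
  if a is a'.+1 then
    if insub a' is Some i then (pi i : 'I_n).+1 else 0
  else n.

Definition input_state (n : nat) (pi : 'S_n) : state :=
  State 0 (fun=> 0) (input_mem pi).

(* On every input of size n, the program P halts within T n instructions,
   leaving the entry of the k-profile at tau in the memory cell indexed by
   the rank of tau in the enumeration of 'S_k.  The constant d makes the word
   length Theta(log n); P has to work for every word length above that
   threshold, with a running time independent of it.  Note that
   (trunc_log 2 n).+1 is the bit length of n when 0 < n. *)
Definition computes_profile (k : nat) (P : program) (d : nat)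
    (T : nat -> nat) : Prop :=
  forall (n : nat) (pi : 'S_n) (w : nat), d * (trunc_log 2 n).+1 <= w ->
  let s := iter (T n) (step w P) (input_state pi) in
  halted P s /\
  forall tau : 'S_k, memory s (enum_rank tau) = profile k pi tau.

Local Open Scope classical_set_scope.
Local Open Scope ring_scope.

Definition softO (R : realType) (f g : nat -> R) : Prop :=
  exists k : nat, f =O_\oo (fun n : nat => g n * ln (n%:R : R) ^+ k).

(* Main.v *)
(** Let L be the bit length of n and N = 2^L, and extend pi by the identity to a
permutation Y of [0, N).  For a < b there is exactly one bit position at which a
has a 0, b has a 1, and above which a and b agree.  Choosing this position for
each of the four consecutive pairs of positions and of values of an occurrence
turns a pattern count into a sum of L^8 queries.  A query counts weighted
5-tuples of points such that points i and j lie in a common aligned block of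
LX i j positions and in a common aligned block of LY i j values; the matrices
LX and LY are ultrametric.

If q is nearest to p for both ultrametrics, then the constraints between p and
the other points follow from the one between p and q and from those on q, and p
can be summed into the weight of q by means of a table; a copy of another point
takes its place.  When no such pair is left, at most five points remain, and
their constraints are those along a 5-cycle p, q, s, r, t whose edges qs and tp
have the longest position blocks and whose edge sr has the longest value blocks.

Such a cycle is counted in about N^2/g steps, g = N^(1/4).  If the position
blocks of sr have at least g elements, then there are at most N/g of them, and
cutting the cycle there leaves a path, which is counted in N steps; the same
holds for the value blocks of tp.  Otherwise there are at most N g pairs (s, r)
and (t, p).  If the value blocks of qs have at least g^2 elements, then these
pairs are tabulated for each of the N/g^2 blocks; if not, then there are at most
N g^3 triples (r, s, q), and N g^3 <= N^2/g.

The algorithm is a program of a small language of loops that add to the cells of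
tables.  Its denotation [dn] gives the total added to each cell, and a compiler
maps it to the word RAM; tables are cleared again by replaying their loops. *)

Require Import Defs.
From mathcomp Require Import all_classical all_reals all_analysis.
From mathcomp Require Import all_boot all_order all_fingroup all_algebra zify.
Set Implicit Arguments.
Unset Strict Implicit.
Unset Printing Implicit Defensive.
Import Order.TTheory GRing.Theory Num.Theory.

(** * A loop language and its compiler *)

(** Which pairs can be merged depends on the eight levels, which are known only at run time. As
    there are five labels, the possible plans form a finite list that does not depend on n: the
    program tests them one after the other, and a combinatorial argument on two ultrametrics shows
    that some test succeeds. Any plan that passes its test is correct.

    A table has [N ^ 8] cells, far more than the running time allows to visit, so it can be emptied
    only where it was written. A loop that fills a table never reads that table; hence its replay
    takes the same branches and meets the same cells.

    Weights are sums of products that may exceed a word. They are only added and multiplied, never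
    compared or used as addresses, so congruences modulo [2 ^ w] suffice until the end, where a
    count is at most [n ^ 5 < 2 ^ w]. *)

Inductive exp :=
| EVar of nat
| ENum of nat
| EBin of binop & exp & exp
| ETab of nat & exp.

Inductive prog :=
| PSkip
| PAdd of exp & exp
| PSeq of prog & prog
| PFor of exp & prog
| PIte of exp & prog & prog
| PTab of prog & prog.

Definition upd (T : Type) (f : nat -> T) (i : nat) (v : T) : nat -> T :=
  fun j => if j == i then v else f j.

Section Language.
Variables w S : nat.
Notation W := (2 ^ w).

Fixpoint ev (env : nat -> nat) (tabs : nat -> nat -> nat) (e : exp) : nat :=
  match e with
  | EVar v => env v %% W
  | ENum c => c %% W
  | EBin o a b => eval_binop w o (ev env tabs a) (ev env tabs b)
  | ETab k a => tabs k (ev env tabs a %% S)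
  end.

(** With [add] this is the total added to cell [o] of the target table; without it, the number of
    times the cell is touched, which tells what a replay in clearing mode erases. A loop keeps its
    counter in register [d] and its bound in [d.+1], so [env] mirrors the machine registers. *)
Fixpoint dn (add : bool) (c : prog) (d t : nat) (env : nat -> nat)
    (tabs : nat -> nat -> nat) (o : nat) : nat :=
  match c with
  | PSkip => 0
  | PAdd a v => if ev env tabs a %% S == o then
      (if add then ev env tabs v else 1) else 0
  | PSeq c1 c2 => dn add c1 d t env tabs o + dn add c2 d t env tabs o
  | PFor b c => let m := ev env tabs b %% W in
      \sum_(j < m) dn add c d.+2 t (upd (upd env d.+1 m) d j) tabs o
  | PIte e c1 c2 => if ev env tabs e != 0 then dn add c1 d t env tabs o
      else dn add c2 d t env tabs o
  | PTab c1 c2 => dn add c2 d t.+1 env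
      (upd tabs t (fun o => dn true c1 d t.+1 env tabs o %% W)) o
  end.

(** The result goes to register [d], and only registers from [d] on change. Register 0 holds the
    table size [S]: cell [o] of table [k] has address [k * S + o], and reducing an index modulo [S]
    keeps every access inside its table. *)
Fixpoint ce (d : nat) (e : exp) : seq instr :=
  match e with
  | EVar v => [:: Const d 0; Op OAdd d v d]
  | ENum c => [:: Const d c]
  | EBin o a b => ce d a ++ ce d.+1 b ++ [:: Op o d d d.+1]
  | ETab k a => ce d a ++
      [:: Op OMod d d 0; Const d.+1 k; Op OMul d.+1 d.+1 0; Op OAdd d d d.+1;
          Read d d]
  end.

Definition esize (e : exp) : nat := size (ce 0 e).

(** [g] is the target table, [d] and [t] are the first free register and table, and [pc] is the
    address of the code, as jumps are absolute. Without [add] the code writes 0 where it would have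
    added. Adding 0 to a loop bound reduces it modulo [2 ^ w], since a table cell is not known to
    hold a word. [Const d 0] followed by [Jz] is an unconditional jump. *)
Fixpoint cp (add : bool) (g d t pc : nat) (c : prog) : seq instr :=
  match c with
  | PSkip => [::]
  | PAdd a v =>
      ce d a ++ (if add then ce d.+1 v else [:: Const d.+1 0]) ++
      [:: Op OMod d d 0; Const d.+2 g; Op OMul d.+2 d.+2 0; Op OAdd d d d.+2;
          Read d.+2 d] ++
      (if add then [:: Op OAdd d.+1 d.+1 d.+2] else [::]) ++ [:: Write d d.+1]
  | PSeq c1 c2 => let k1 := cp add g d t pc c1 in
      k1 ++ cp add g d t (pc + size k1) c2
  | PFor b c =>
      let k0 := ce d.+1 (EBin OAdd b (ENum 0)) ++ [:: Const d 0] in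
      let lh := pc + size k0 in
      let k1 := cp add g d.+2 t lh.+2 c in
      let le := lh.+2 + size k1 + 4 in
      k0 ++ [:: Op OLt d.+2 d d.+1; Jz d.+2 le] ++ k1 ++
      [:: Const d.+2 1; Op OAdd d d d.+2; Const d.+2 0; Jz d.+2 lh]
  | PIte e c1 c2 =>
      let k0 := ce d e in
      let p1 := pc + size k0 + 1 in
      let k1 := cp add g d t p1 c1 in
      let p2 := p1 + size k1 + 2 in
      let k2 := cp add g d t p2 c2 in
      k0 ++ [:: Jz d p2] ++ k1 ++ [:: Const d 0; Jz d (p2 + size k2)] ++ k2
  | PTab c1 c2 =>
      let k1 := cp true t d t.+1 pc c1 in
      let k2 := cp add g d t.+1 (pc + size k1) c2 in
      let k3 := cp false t d t.+1 (pc + size k1 + size k2) c1 in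
      k1 ++ k2 ++ k3
  end.

(** One bound serves both modes; the factor 2 in the case of a table pays for the replay. *)
Fixpoint cost (c : prog) (d t : nat) (env : nat -> nat)
    (tabs : nat -> nat -> nat) : nat :=
  match c with
  | PSkip => 0
  | PAdd a v => esize a + esize v + 8
  | PSeq c1 c2 => cost c1 d t env tabs + cost c2 d t env tabs
  | PFor b c => let m := ev env tabs b %% W in
      esize b + 5 +
      \sum_(j < m) (cost c d.+2 t (upd (upd env d.+1 m) d j) tabs + 6)
  | PIte e c1 c2 => esize e + 3 + (if ev env tabs e != 0 then
      cost c1 d t env tabs else cost c2 d t env tabs)
  | PTab c1 c2 => 2 * cost c1 d t.+1 env tabs + cost c2 d t.+1 env
      (upd tabs t (fun o => dn true c1 d t.+1 env tabs o %% W))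
  end.

Fixpoint ewf (d : nat) (rd : pred nat) (e : exp) : bool :=
  match e with
  | EVar v => v < d
  | ENum _ => true
  | EBin _ a b => ewf d rd a && ewf d rd b
  | ETab k a => rd k && ewf d rd a
  end.

(** [rd] collects the tables that may be read. Table [t] joins it only for the second program of a
    [PTab], so the first cannot read what it fills, and its replay sees the same data. *)
Fixpoint wf (K d t : nat) (rd : pred nat) (c : prog) : bool :=
  match c with
  | PSkip => true
  | PAdd a v => ewf d rd a && ewf d rd v
  | PSeq c1 c2 => wf K d t rd c1 && wf K d t rd c2
  | PFor b c => ewf d rd b && wf K d.+2 t rd c
  | PIte e c1 c2 => [&& ewf d rd e, wf K d t rd c1 & wf K d t rd c2]
  | PTab c1 c2 => [&& t < K, wf K d t.+1 rd c1 &
                      wf K d t.+1 (fun k => (k == t) || rd k) c2]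
  end.

Lemma size_ce d e : size (ce d e) = esize e.
Proof.
suff h d' : size (ce d e) = size (ce d' e) by exact: h.
elim: e d d' => //= [op a IHa b IHb|k a IHa] d d'; rewrite !size_cat /=.
  by rewrite (IHa d d') (IHb d.+1 d'.+1).
by rewrite (IHa d d').
Qed.

Lemma ev_eq d (rd : pred nat) env env' tabs tabs' e :
  (forall i, i < d -> env i = env' i) ->
  (forall k o, rd k -> tabs k o = tabs' k o) ->
  ewf d rd e -> ev env tabs e = ev env' tabs' e.
Proof.
move=> he ht; elim: e => //= [v /he ->|op a IHa b IHb|k a IHa] //.
  by case/andP=> /IHa -> /IHb ->.
by case/andP=> rk /IHa ->; rewrite ht.
Qed.

Lemma ewf_mono d d' (rd rd' : pred nat) e : d <= d' -> {subset rd <= rd'} ->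
  ewf d rd e -> ewf d' rd' e.
Proof.
move=> dd rr; elim: e => //= [v vd|_ a IHa b IHb|k a IHa].
- exact: leq_trans dd.
- by case/andP=> /IHa -> /IHb ->.
- by case/andP=> /rr rk /IHa ->; rewrite andbT.
Qed.

(** * Correctness of the compiler *)

Definition code_at (P : program) (pc : nat) (k : seq instr) : Prop :=
  forall i, i < size k -> onth P (pc + i) = onth k i.

Lemma code_at_cat P pc k1 k2 :
  code_at P pc (k1 ++ k2) -> code_at P pc k1 /\ code_at P (pc + size k1) k2.
Proof.
move=> h; split=> i hi.
  by rewrite h ?size_cat ?ltn_addr // onth_cat hi.
rewrite -addnA h ?size_cat ?ltn_add2l // onth_cat.
by rewrite ltnNge leq_addr /= addKn.
Qed.

Lemma code_at_cons P pc i k : code_at P pc (i :: k) ->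
  onth P pc = Some i /\ code_at P pc.+1 k.
Proof.
move=> h; split; first by have := h 0 isT; rewrite addn0.
by move=> j hj; have := h j.+1 hj; rewrite addnS.
Qed.

Definition runs (P : program) (k : nat) (s s' : state) : Prop :=
  iter k (step w P) s = s'.

Lemma runs_trans P k1 k2 s1 s2 s3 :
  runs P k1 s1 s2 -> runs P k2 s2 s3 -> runs P (k1 + k2) s1 s3.
Proof. by rewrite /runs addnC iterD => -> ->. Qed.

Lemma runs_step P i s : onth P (pc s) = Some i -> runs P 1 s (exec_instr w i s).
Proof. by rewrite /runs /= /step => ->. Qed.

Definition mem_ok (rd : pred nat) (tabs : nat -> nat -> nat) (m : nat -> nat) :=
  forall k o, rd k -> o < S -> m (k * S + o) = tabs k o.

Lemma runs_cons P k pc r m i c s :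
  code_at P pc (i :: c) -> runs P k (exec_instr w i (State pc r m)) s ->
  runs P k.+1 (State pc r m) s.
Proof.
case/code_at_cons=> h _ run; rewrite -add1n.
by apply: runs_trans run; apply: runs_step.
Qed.

Lemma runs_nil P s pc' : pc s = pc' ->
  runs P 0 s (State pc' (reg s) (memory s)).
Proof. by case: s => ? ? ? /= ->. Qed.

Lemma ce_correct K P (rd : pred nat) tabs m : K * S <= W -> 0 < S < W ->
  (forall k, rd k -> k < K) -> mem_ok rd tabs m ->
  forall e d pc r, 0 < d -> ewf d rd e -> code_at P pc (ce d e) -> r 0 = S ->
  exists r', [/\ runs P (esize e) (State pc r m) (State (pc + esize e) r' m),
    r' d = ev r tabs e & forall i, i < d -> r' i = r i].
Proof.
move=> KS /andP[S_gt0 SW] rdK mok; elim=> [v|c|op a IHa b IHb|k a IHa] d pc r d0.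
- move=> /= vd h hS.
  eexists; split.
  + apply: (runs_cons h) => /=; have [_ h'] := code_at_cons h.
    apply: (runs_cons h'); apply: runs_nil; rewrite /= addn2 //. 
  + by rewrite /= eqxx (ltn_eqF vd) mod0n /eval_binop addn0.
  + by move=> i id; rewrite /= !(ltn_eqF id).
- move=> /= _ h hS.
  eexists; split; first by apply: (runs_cons h); apply: runs_nil; rewrite /= addn1.
  + by rewrite /= eqxx.
  + by move=> i id; rewrite /= (ltn_eqF id).
- move=> /= /andP[wa wb] h hS.
  have [h1 h2] := code_at_cat h; rewrite size_ce in h2.
  have [h3 h4] := code_at_cat h2; rewrite size_ce in h4.
  have [r1 [run1 v1 f1]] := IHa _ _ _ d0 wa h1 hS.
  have wb' : ewf d.+1 rd b by apply: ewf_mono wb.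
  have hS1 : r1 0 = S by rewrite f1.
  have [r2 [run2 v2 f2]] := IHb _ _ _ (ltn0Sn d) wb' h3 hS1.
  eexists; split.
  + rewrite /esize /= !size_cat !size_ce /= addnA; apply: runs_trans.
      exact: runs_trans run1 run2.
    by apply: (runs_cons h4); apply: runs_nil; rewrite /= !addnA addn1.
  + rewrite /= eqxx v2 f2 // v1; congr eval_binop.
    by apply: ev_eq wb => // i id; rewrite f1.
  + by move=> i id; rewrite /= (ltn_eqF id) f2 ?f1 // ltnW.
- move=> /= /andP[rk wa] h hS.
  have [h1 h2] := code_at_cat h; rewrite size_ce in h2.
  have [r1 [run1 v1 f1]] := IHa _ _ _ d0 wa h1 hS.
  have hS1 : r1 0 = S by rewrite f1.
  have kK := rdK _ rk.
  have kS : k * S + ev r tabs a %% S < W.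
    apply: leq_trans KS; apply: leq_trans (leq_mul kK (leqnn S)).
    by rewrite mulSn addnC ltn_add2r ltn_mod.
  have k1 : k < W.
    apply: leq_ltn_trans kS; apply: leq_trans (leq_addr _ _).
    by rewrite leq_pmulr.
  eexists; split.
  + rewrite /esize /= !size_cat !size_ce /=; apply: runs_trans run1 _.
    apply: (runs_cons h2) => /=; case/code_at_cons: h2 => _ h2.
    apply: (runs_cons h2) => /=; case/code_at_cons: h2 => _ h2.
    apply: (runs_cons h2) => /=; case/code_at_cons: h2 => _ h2.
    apply: (runs_cons h2) => /=; case/code_at_cons: h2 => _ h2.
    by apply: (runs_cons h2); apply: runs_nil; rewrite /= !addnS addn0.
  + have d1 : (d == d.+1) = false by rewrite ltn_eqF.
    rewrite /= !(eqxx, d1, ltn_eqF d0) /= hS1 v1 /eval_binop.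
    rewrite (modn_small k1) (modn_small (leq_ltn_trans (leq_addr _ _) kS)).
    have oS : ev r tabs a %% S < S by rewrite ltn_mod.
    by rewrite (modn_small (ltn_trans oS SW)) addnC (modn_small kS) mok.
  + by move=> i id; rewrite /= !(ltn_eqF id) (ltn_eqF (leqW id)) f1.
Qed.

Lemma dn_eq K add c : forall d t (rd : pred nat) env env' tabs tabs' o,
  (forall i, i < d -> env i = env' i) ->
  (forall k o, rd k -> tabs k o = tabs' k o) -> (forall k, rd k -> k < t) ->
  wf K d t rd c ->
  dn add c d t env tabs o = dn add c d t env' tabs' o.
Proof.
elim: c add => [|a v|c1 IH1 c2 IH2|b c IH|e c1 IH1 c2 IH2|c1 IH1 c2 IH2] add
  d t rd env env' tabs tabs' o he ht hrd //=.
- by case/andP=> wa wv; rewrite (ev_eq he ht wa) (ev_eq he ht wv).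
- by case/andP=> w1 w2; rewrite (IH1 _ _ _ _ _ env' _ tabs' _ he ht hrd w1)
    (IH2 _ _ _ _ _ env' _ tabs' _ he ht hrd w2).
- case/andP=> wb wc; rewrite (ev_eq he ht wb); apply: eq_bigr => j _.
  apply: (IH _ _ _ _ _ _ _ _ _ _ ht hrd wc) => i.
  rewrite /upd ltnS leq_eqVlt => /predU1P[->|]; first by rewrite eqxx.
  by rewrite ltnS leq_eqVlt => /predU1P[->|id]; rewrite ?eqxx // he.
- case/and3P=> we w1 w2; rewrite (ev_eq he ht we).
  by rewrite (IH1 _ _ _ _ _ env' _ tabs' _ he ht hrd w1)
    (IH2 _ _ _ _ _ env' _ tabs' _ he ht hrd w2).
- case/and3P=> _ w1 w2; apply: (IH2 _ _ _ _ _ _ _ _ _ he _ _ w2).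
  + move=> k x; rewrite /upd; case: eqP => //= _; last exact: ht.
    by rewrite (IH1 _ _ _ _ _ env' _ tabs' _ he ht _ w1) // => i /hrd /ltnW.
  + by move=> k /predU1P[->|/hrd /ltnW].
Qed.

Lemma cost_eq K c : forall d t (rd : pred nat) env env' tabs tabs',
  (forall i, i < d -> env i = env' i) ->
  (forall k o, rd k -> tabs k o = tabs' k o) -> (forall k, rd k -> k < t) ->
  wf K d t rd c -> cost c d t env tabs = cost c d t env' tabs'.
Proof.
elim: c => [|a v|c1 IH1 c2 IH2|b c IH|e c1 IH1 c2 IH2|c1 IH1 c2 IH2]
  d t rd env env' tabs tabs' he ht hrd //=.
- by case/andP=> w1 w2; rewrite (IH1 _ _ _ _ env' _ tabs' he ht hrd w1)
    (IH2 _ _ _ _ env' _ tabs' he ht hrd w2).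
- case/andP=> wb wc; rewrite (ev_eq he ht wb); congr addn.
  apply: eq_bigr => j _; congr addn.
  apply: (IH _ _ _ _ _ _ _ _ ht hrd wc) => i.
  rewrite /upd ltnS leq_eqVlt => /predU1P[->|]; first by rewrite eqxx.
  by rewrite ltnS leq_eqVlt => /predU1P[->|id]; rewrite ?eqxx // he.
- case/and3P=> we w1 w2; rewrite (ev_eq he ht we).
  by rewrite (IH1 _ _ _ _ env' _ tabs' he ht hrd w1)
    (IH2 _ _ _ _ env' _ tabs' he ht hrd w2).
- case/and3P=> _ w1 w2.
  have hrd' k : rd k -> k < t.+1 by move/hrd/ltnW.
  rewrite (IH1 _ _ _ _ env' _ tabs' he ht hrd' w1); congr addn.
  apply: (IH2 _ _ _ _ _ _ _ he _ _ w2).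
  + move=> k x; rewrite /upd; case: eqP => //= _; last exact: ht.
    by rewrite (dn_eq _ _ he ht hrd' w1).
  + by move=> k /predU1P[->|/hrd /ltnW].
Qed.

(** A cell that the replay does not touch has received nothing in the first run, so a table is empty
    after its replay. *)
Lemma dn0 c d t env tabs o :
  dn false c d t env tabs o = 0 -> dn true c d t env tabs o = 0.
Proof.
elim: c d t env tabs o => [|a v|c1 IH1 c2 IH2|b c IH|e c1 IH1 c2 IH2|c1 _ c2 IH2]
  d t env tabs o //=.
- by case: ifP.
- by move/eqP; rewrite addn_eq0 => /andP[/eqP/IH1 -> /eqP/IH2 ->].
- move/eqP; rewrite sum_nat_eq0 => /forallP h; apply/eqP.
  by rewrite sum_nat_eq0; apply/forallP => j; apply/eqP/IH/eqP/h.
- by case: ifP => _; [apply: IH1|apply: IH2].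
- exact: IH2.
Qed.

(* The new content of a target cell that held [x]: in adding mode its total
   contribution [a] is added, in clearing mode it is erased if it was touched
   ([b] counts the touches). *)
Definition res (add : bool) (x a b : nat) : nat :=
  if add then (x + a) %% W else if b == 0 then x else 0.

Lemma res_lt add x a b : x < W -> res add x a b < W.
Proof.
rewrite /res; case: add => [_|xW]; first by rewrite ltn_mod expn_gt0.
by case: ifP => // _; rewrite expn_gt0.
Qed.

Lemma res0 add x : x < W -> res add x 0 0 = x.
Proof. by rewrite /res; case: add => // xW; rewrite addn0 modn_small. Qed.

(** The law that lets consecutive runs on one target be chained, in sequences and in loops. *)
Lemma resD add x a a' b b' :
  res add (res add x a b) a' b' = res add x (a + a') (b + b').
Proof.
rewrite /res; case: add; first by rewrite modnDml addnA.
by rewrite addn_eq0; case: (b == 0); case: (b' == 0).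
Qed.

Lemma region_ne k k' o : k != k' -> o < S -> (k * S + o) %/ S != k'.
Proof.
by move=> kk oS; rewrite divnMDl ?divn_small ?addn0 //; apply: leq_ltn_trans oS.
Qed.

Lemma region_lt K g x : K * S <= W -> 0 < S -> g < K -> g * S + x %% S < W.
Proof.
move=> KS S0 gK; apply: leq_trans KS; apply: leq_trans (leq_mul gK (leqnn S)).
by rewrite mulSn addnC ltn_add2r ltn_mod.
Qed.

(** The last clause restores everything outside the target; for the scratch tables this means that
    they are empty again. *)
Definition cp_spec P c g add d t pc r tabs m (k : nat) r' m' :=
  [/\ k <= cost c d t r tabs,
   runs P k (State pc r m) (State (pc + size (cp add g d t pc c)) r' m'),
   forall i, i < d -> r' i = r i,
   forall o, o < S -> m' (g * S + o) =
     res add (m (g * S + o)) (dn true c d t r tabs o) (dn false c d t r tabs o) &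
   forall a, a %/ S != g -> m' a = m a].

Section Correct.
Variables (K : nat) (P : program).
Hypotheses (KS : K * S <= W) (S_bnd : 0 < S < W).

Lemma cp_add_correct a v add g d t pc (rd : pred nat) r tabs m :
  0 < d -> wf K d t rd (PAdd a v) -> code_at P pc (cp add g d t pc (PAdd a v)) ->
  r 0 = S -> (forall k, rd k -> k < K) -> g < K -> ~~ rd g ->
  mem_ok rd tabs m -> (forall o, o < S -> m (g * S + o) < W) ->
  exists k r' m', cp_spec P (PAdd a v) g add d t pc r tabs m k r' m'.
Proof.
move=> d0 /= /andP[wa wv] h rS rdK gK ndg mok mW.
have [S0 SW] := andP S_bnd.
have [h1 h2] := code_at_cat h; rewrite size_ce in h2.
have [r1 [run1 v1 f1]] := ce_correct KS S_bnd rdK mok d0 wa h1 rS.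
have wv' : ewf d.+1 rd v by apply: ewf_mono wv.
have hS1 : r1 0 = S by rewrite f1.
have [h3 h4] := code_at_cat h2.
pose k2 := if add then ce d.+1 v else [:: Const d.+1 0].
have [r2 [run2 v2 f2]] : exists r2,
    [/\ runs P (size k2) (State (pc + esize a) r1 m)
          (State (pc + esize a + size k2) r2 m),
    (r2 d.+1 = if add then ev r tabs v else 0) &
    forall i, i < d.+1 -> r2 i = r1 i].
  rewrite /k2; case: (add) h3 => h3.
    have [r2 [? v2 ?]] := ce_correct KS S_bnd rdK mok (ltn0Sn d) wv' h3 hS1.
    exists r2; split; rewrite ?size_ce // v2.
    by apply: ev_eq wv => // i id; rewrite f1.
  eexists; split.
  + by apply: (runs_cons h3); apply: runs_nil; rewrite /= addn1.
  + by rewrite /= eqxx mod0n.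
  + by move=> i id; rewrite /= (ltn_eqF id).
have v2' : r2 d = ev r tabs a by rewrite f2.
have {}f2 i : i < d -> r2 i = r i by move=> id; rewrite f2 ?f1 // ltnW.
have AW := region_lt (ev r tabs a) KS S0 gK.
set A := _ + _ in AW.
have A_S o : o < S -> (g * S + o == A) = (o == ev r tabs a %% S).
  by rewrite /A eqn_add2l.
have gW : g < W.
  apply: leq_ltn_trans AW; apply: leq_trans (leq_addr _ _).
  by rewrite leq_pmulr.
have {}rS2 : r2 0 = S by rewrite f2.
have d1 : (d == d.+1) = false by rewrite ltn_eqF.
have d2 : (d == d.+2) = false by rewrite ltn_eqF.
have d3 : (d.+1 == d.+2) = false by rewrite ltn_eqF.
have d4 : (d.+1 == d) = false by rewrite gtn_eqF.
have d5 : (d.+2 == d) = false by rewrite gtn_eqF.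
have gSW : g * S < W by apply: leq_ltn_trans AW; rewrite leq_addr.
have eS : ev r tabs a %% S < W by apply: ltn_trans SW; rewrite ltn_mod.
rewrite -/k2 in h4.
have h5 := h4; have h6 := h4.
do 5![case/code_at_cons: h6 => _ h6].
have [r3 [run3 v3 f3]] : exists r3,
    [/\ runs P 5 (State (pc + esize a + size k2) r2 m)
          (State (pc + esize a + size k2).+4.+1 r3 m),
    [/\ r3 d = A, r3 d.+1 = r2 d.+1 & r3 d.+2 = m A] &
    forall i, i < d -> r3 i = r i].
  eexists; split.
  + apply: (runs_cons h5) => /=; case/code_at_cons: h5 => _ h5.
    apply: (runs_cons h5) => /=; case/code_at_cons: h5 => _ h5.
    apply: (runs_cons h5) => /=; case/code_at_cons: h5 => _ h5.
    apply: (runs_cons h5) => /=; case/code_at_cons: h5 => _ h5.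
    by apply: (runs_cons h5); apply: runs_nil.
  + rewrite /= !(eqxx, d1, d2, d3, d4, d5, ltn_eqF d0) /= rS2 v2' /eval_binop.
    rewrite (modn_small gW) (modn_small gSW) (modn_small eS) addnC -/A.
    by rewrite (modn_small AW).
  + by move=> i id; rewrite /= !(ltn_eqF (leqW (leqW id)), ltn_eqF (leqW id), ltn_eqF id) f2.
have {h6} [k4 [r4 [m4 [le4 run4 f4 m4E]]]] : exists k4 r4 m4, [/\ k4 <= 2,
    runs P k4 (State (pc + esize a + size k2).+4.+1 r3 m)
      (State (pc + size (cp add g d t pc (PAdd a v))) r4 m4),
    forall i, i < d -> r4 i = r i &
    forall x, m4 x = if x == A then res add (m A) (ev r tabs v) 1 else m x].
  case: v3 => vd vd1 vd2; rewrite /= !size_cat -/k2 /= size_ce.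
  case: (add) v2 h6 => v2 h6; do 3?eexists; split.
  + exact: leqnn.
  + apply: (runs_cons h6) => /=; case/code_at_cons: h6 => _ h6.
    apply: (runs_cons h6); apply: runs_nil => /=; lia.
  + by move=> i id; rewrite /= !(ltn_eqF (leqW id)) f3.
  + by move=> x; rewrite /= !(eqxx, d1) vd vd1 vd2 v2 /eval_binop addnC.
  + exact: (leq_trans (leqnn 1)).
  + apply: (runs_cons h6); apply: runs_nil => /=; lia.
  + by move=> i id; rewrite /= f3.
  + by move=> x; rewrite /= vd vd1 v2.
exists (esize a + size k2 + 5 + k4), r4, m4.
split => //.
- rewrite /= -!addnA leq_add2l; rewrite /k2; case: (add); rewrite ?size_ce /=; lia.
- apply: runs_trans (run4); apply: runs_trans (run3).
  exact: runs_trans run1 run2.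
- move=> o oS; rewrite m4E A_S //= [_ %% S == o]eq_sym; case: eqP => [->|_] //=.
  by rewrite res0 // mW.
- move=> x xg; rewrite m4E ifN //; apply: contraNneq xg => ->.
  by rewrite /A divnMDl // divn_small ?addn0 // ltn_mod.
Qed.

(** Induction on [c], with the free tables from [t] to [K] empty and the target not readable. As
    each run restores all memory outside its target, these conditions carry over from one part of
    the program to the next. *)
Lemma cp_correct c add g d t pc (rd : pred nat) r tabs m :
  0 < d -> wf K d t rd c -> code_at P pc (cp add g d t pc c) ->
  r 0 = S -> (forall k, rd k -> k < t) -> t <= K -> g < t -> ~~ rd g ->
  mem_ok rd tabs m -> (forall k o, t <= k < K -> o < S -> m (k * S + o) = 0) ->
  (forall o, o < S -> m (g * S + o) < W) ->
  exists k r' m', cp_spec P c g add d t pc r tabs m k r' m'.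
Proof.
have [S0 SW] := andP S_bnd.
elim: c add g d t pc rd r tabs m => [|a v|c1 IH1 c2 IH2|b c IH|e c1 IH1 c2 IH2|
  c1 IH1 c2 IH2] add g d t pc rd r tabs m d0.
- move=> _ _ rS rdt tK gt ndg mok mz mW; exists 0, r, m; split=> //=.
    by rewrite addn0.
  by move=> o oS; rewrite res0 // mW.
- move=> wc h rS rdt tK gt ndg mok mz mW.
  apply: cp_add_correct wc h _ _ _ ndg _ _ => //.
    by move=> k /rdt kt; apply: leq_trans tK.
  exact: leq_trans tK.
- move=> /= /andP[w1 w2] h rS rdt tK gt ndg mok mz mW.
  have [h1 h2] := code_at_cat h.
  have [k1 [r1 [m1 [l1 run1 f1 M1 F1]]]] :=
    IH1 _ _ _ _ _ _ _ _ _ d0 w1 h1 rS rdt tK gt ndg mok mz mW.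
  have {}rS1 : r1 0 = S by rewrite f1.
  have mok1 : mem_ok rd tabs m1.
    move=> k o rk oS; rewrite F1 ?mok // region_ne //.
    by apply: contraTneq rk => ->.
  have mz1 k o : t <= k < K -> o < S -> m1 (k * S + o) = 0.
    move=> tkK oS; rewrite F1 ?mz // region_ne //; apply: contraTneq gt => <-.
    by rewrite -leqNgt; case/andP: tkK.
  have mW1 o : o < S -> m1 (g * S + o) < W.
    by move=> oS; rewrite M1 // res_lt // mW.
  have [k2 [r2 [m2 [l2 run2 f2 M2 F2]]]] :=
    IH2 _ _ _ _ _ _ _ _ _ d0 w2 h2 rS1 rdt tK gt ndg mok1 mz1 mW1.
  exists (k1 + k2), r2, m2; split.
  + rewrite /= leq_add //.
    by rewrite -(cost_eq f1 (fun _ _ _ => erefl) rdt w2).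
  + by rewrite /= size_cat addnA; apply: runs_trans run1 run2.
  + by move=> i id; rewrite f2 ?f1.
  + move=> o oS; rewrite M2 // M1 // resD.
    by rewrite !(dn_eq _ _ f1 (fun _ _ _ => erefl) rdt w2).
  + by move=> x xg; rewrite F2 ?F1.
- move=> /andP[wb wc] h rS rdt tK gt ndg mok mz mW.
  have rdK k : rd k -> k < K by move=> /rdt kt; apply: leq_trans tK.
  have gK : g < K by apply: leq_trans tK.
  pose k0 := ce d.+1 (EBin OAdd b (ENum 0)) ++ [:: Const d 0].
  pose lh := pc + size k0; pose k1 := cp add g d.+2 t lh.+2 c.
  pose le := lh.+2 + size k1 + 4.
  pose k2 := [:: Const d.+2 1; Op OAdd d d d.+2; Const d.+2 0; Jz d.+2 lh].
  pose k3 := [:: Op OLt d.+2 d d.+1; Jz d.+2 le] ++ k1 ++ k2.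
  have cpE : cp add g d t pc (PFor b c) = k0 ++ k3 by [].
  have szE : pc + size (cp add g d t pc (PFor b c)) = le.
    by rewrite cpE /le /lh !size_cat /=; lia.
  rewrite /cp_spec szE; rewrite {}cpE in h.
  set M := ev r tabs b %% W.
  have MW : M < W by rewrite ltn_mod expn_gt0.
  have sk0 : size k0 = esize b + 3.
    by rewrite /k0 !size_cat !size_ce /=; lia.
  have [h0 h1] := code_at_cat h; rewrite -/lh in h1.
  have [h2 h3] := code_at_cat h0; rewrite size_ce in h3.
  have wb' : ewf d.+1 rd (EBin OAdd b (ENum 0)).
    by rewrite /= andbT; apply: ewf_mono wb.
  have [r1 [run1 v1 f1]] := ce_correct KS S_bnd rdK mok (ltn0Sn d) wb' h2 rS.
  have {}v1 : r1 d.+1 = M by rewrite v1 /= /eval_binop mod0n addn0.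
  have [r2 [run2 v2 v2' f2]] : exists r2,
      [/\ runs P (esize b + 3) (State pc r m) (State lh r2 m), r2 d = 0,
       r2 d.+1 = M & forall i, i < d -> r2 i = r i].
    eexists; split.
    + rewrite -sk0 /lh /k0 size_cat size_ce; apply: runs_trans run1 _.
      by apply: (runs_cons h3); apply: runs_nil; rewrite /= addnA addn1.
    + by rewrite /= eqxx mod0n.
    + by rewrite /= gtn_eqF.
    + by move=> i id; rewrite /= (ltn_eqF id) f1 // ltnW.
  have [h4 h5] := code_at_cat h1; have [h6 h7] := code_at_cat h5.
  rewrite /= addn2 in h6 h7.
  pose en j := upd (upd r d.+1 M) d j.
  have envE r' j : r' d = j -> r' d.+1 = M -> (forall i, i < d -> r' i = r i) ->
      forall i, i < d.+2 -> r' i = en j i.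
    move=> e1 e2 e3 i; rewrite ltnS leq_eqVlt /en /upd => /predU1P[->|].
      by rewrite gtn_eqF // eqxx.
    by rewrite ltnS leq_eqVlt => /predU1P[->|id]; rewrite ?eqxx // !ltn_eqF // ?e3 // ltnW.
  have loop j : j <= M -> exists k r' m', [/\
      k <= \sum_(0 <= i < j) (cost c d.+2 t (en i) tabs + 6),
      runs P k (State lh r2 m) (State lh r' m'),
      [/\ r' d = j, r' d.+1 = M & forall i, i < d -> r' i = r i],
      forall o, o < S -> m' (g * S + o) = res add (m (g * S + o))
        (\sum_(0 <= i < j) dn true c d.+2 t (en i) tabs o)
        (\sum_(0 <= i < j) dn false c d.+2 t (en i) tabs o) &
      forall a, a %/ S != g -> m' a = m a].
    elim: j => [_|j IHj jM].
      exists 0, r2, m; split=> //.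
      by move=> o oS; rewrite !big_geq // res0 // mW.
    have [k [r3 [m3 [l3 run3 [v3 v3' f3] M3 F3]]]] := IHj (ltnW jM).
    have d1 : (d == d.+1) = false by rewrite ltn_eqF.
    have d2 : (d == d.+2) = false by rewrite ltn_eqF.
    have d3 : (d.+1 == d.+2) = false by rewrite ltn_eqF.
    have d4 : (d.+1 == d) = false by rewrite gtn_eqF.
    have d5 : (d.+2 == d) = false by rewrite gtn_eqF.
    (* A round takes place only if [j < M], which forces [1 < W]: the constant 1 of the increment is
       not reduced to 0. *)
    have M1 : 1 < W by apply: leq_ltn_trans MW; apply: leq_ltn_trans jM.
    have [r4 [run4 v4 v4' f4]] : exists r4, [/\
        runs P 2 (State lh r3 m3) (State lh.+2 r4 m3), r4 d = j, r4 d.+1 = M &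
        forall i, i < d -> r4 i = r i].
      eexists; split.
      + apply: (runs_cons h4) => /=; case/code_at_cons: h4 => _ h4.
        apply: (runs_cons h4); rewrite /= eqxx v3 v3' /eval_binop jM modn_small //=.
      + by rewrite /= d2.
      + by rewrite /= d3.
      + by move=> i id; rewrite /= (ltn_eqF (leqW (leqW id))) f3.
    have env4 := envE _ _ v4 v4' f4.
    have rS4 : r4 0 = S by rewrite f4.
    have mok3 : mem_ok rd tabs m3.
      move=> x o rk oS; rewrite F3 ?mok // region_ne //.
      by apply: contraTneq rk => ->.
    have mz3 x o : t <= x < K -> o < S -> m3 (x * S + o) = 0.
      move=> tkK oS; rewrite F3 ?mz // region_ne //; apply: contraTneq gt => <-.
      by rewrite -leqNgt; case/andP: tkK.
    have mW3 o : o < S -> m3 (g * S + o) < W.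
      by move=> oS; rewrite M3 // res_lt // mW.
    have [k5 [r5 [m5 [l5 run5 f5 M5 F5]]]] :=
      IH _ _ _ _ _ _ _ _ _ (ltn0Sn _) wc h6 rS4 rdt tK gt ndg mok3 mz3 mW3.
    have v5 : r5 d = j by rewrite f5.
    have v5' : r5 d.+1 = M by rewrite f5.
    have [r6 [run6 v6 v6' f6]] : exists r6, [/\
        runs P 4 (State (lh.+2 + size k1) r5 m5) (State lh r6 m5), r6 d = j.+1,
        r6 d.+1 = M & forall i, i < d -> r6 i = r i].
      eexists; split.
      + apply: (runs_cons h7) => /=; case/code_at_cons: h7 => _ h7.
        apply: (runs_cons h7) => /=; case/code_at_cons: h7 => _ h7.
        apply: (runs_cons h7) => /=; case/code_at_cons: h7 => _ h7.
        apply: (runs_cons h7); rewrite /= eqxx mod0n eqxx.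
        exact: runs_nil.
      + rewrite /= !(eqxx, d2) v5 /eval_binop (modn_small M1) addn1 modn_small //.
        exact: leq_ltn_trans jM _.
      + by rewrite /= d3 d4 v5'.
      + move=> i id; rewrite /= (ltn_eqF (leqW (leqW id))) (ltn_eqF id).
        by rewrite f5 ?f4 // ltnW // ltnW.
    exists (k + (2 + k5 + 4)), r6, m5; split=> //.
    + rewrite big_nat_recr //= leq_add //.
      rewrite -(cost_eq env4 (fun _ _ _ => erefl) rdt wc); lia.
    + by apply: runs_trans run3 _; apply: runs_trans run6; apply: runs_trans run4 _.
    + move=> o oS; rewrite M5 // M3 // resD !big_nat_recr //=.
      by rewrite !(dn_eq _ _ env4 (fun _ _ _ => erefl) rdt wc).
    + by move=> x xg; rewrite F5 ?F3.
  have [k [r3 [m3 [l3 run3 [v3 v3' f3] M3 F3]]]] := loop M (leqnn M).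
  exists (esize b + 3 + k + 2), [eta r3 with d.+2 |-> 0], m3; split=> //.
  + by rewrite /= -/M -(big_mkord xpredT (fun i => cost c d.+2 t (en i) tabs + 6)); lia.
  + apply: runs_trans; first by apply: runs_trans run2 run3.
    apply: (runs_cons h4) => /=; case/code_at_cons: h4 => _ h4.
    apply: (runs_cons h4); rewrite /= eqxx v3 v3' /eval_binop ltnn mod0n /=.
    exact: runs_nil.
  + by move=> i id; rewrite /= (ltn_eqF (leqW (leqW id))) f3.
  + move=> o oS; rewrite /= M3 // -/M.
    by rewrite -2!(big_mkord xpredT (fun i => dn _ c d.+2 t (en i) tabs o)).
- move=> /and3P[we w1 w2] h rS rdt tK gt ndg mok mz mW.
  have rdK k : rd k -> k < K by move=> /rdt kt; apply: leq_trans tK.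
  pose k0 := ce d e; pose p1 := pc + size k0 + 1.
  pose k1 := cp add g d t p1 c1; pose p2 := p1 + size k1 + 2.
  pose k2 := cp add g d t p2 c2.
  have cpE : cp add g d t pc (PIte e c1 c2) =
    k0 ++ [:: Jz d p2] ++ k1 ++ [:: Const d 0; Jz d (p2 + size k2)] ++ k2 by [].
  have szE : pc + size (cp add g d t pc (PIte e c1 c2)) = p2 + size k2.
    by rewrite cpE /p2 /p1 !size_cat /=; lia.
  rewrite /cp_spec szE; rewrite {}cpE in h.
  have [h0 h1] := code_at_cat h; have [h2 h3] := code_at_cat h1.
  have [h4 h5] := code_at_cat h3; have [h6 h7] := code_at_cat h5.
  rewrite /= addn1 in h3 h4 h5 h6 h7.
  have p1E : p1 = (pc + size k0).+1 by rewrite /p1 addn1.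
  rewrite -p1E in h4 h5 h6 h7.
  rewrite -/p2 in h7.
  have [r1 [run1 v1 f1]] := ce_correct KS S_bnd rdK mok d0 we h0 rS.
  have {}rS1 : r1 0 = S by rewrite f1.
  have eqr (c : prog) : wf K d t rd c -> cost c d t r1 tabs = cost c d t r tabs.
    exact: (cost_eq f1 (fun _ _ _ => erefl) rdt).
  have eqd ad (c : prog) x : wf K d t rd c ->
      dn ad c d t r1 tabs x = dn ad c d t r tabs x.
    exact: (dn_eq _ _ f1 (fun _ _ _ => erefl) rdt).
  have skE : size k0 = esize e by rewrite /k0 size_ce.
  rewrite /= -v1; case: eqP => [r1d|/eqP r1d] /=.
    have [k [r2 [m2 [l2 run2 f2 M2 F2]]]] :=
      IH2 _ _ _ _ _ _ _ _ _ d0 w2 h7 rS1 rdt tK gt ndg mok mz mW.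
    exists (esize e + 1 + k), r2, m2; split=> //.
    + by rewrite eqr // in l2; lia.
    + apply: runs_trans run2; apply: runs_trans run1 _.
      rewrite -skE; apply: (runs_cons h2).
      by rewrite /= r1d eqxx; apply: runs_nil.
    + by move=> i id; rewrite f2 ?f1.
    + by move=> o oS; rewrite M2 // !eqd.
  have [k [r2 [m2 [l2 run2 f2 M2 F2]]]] :=
    IH1 _ _ _ _ _ _ _ _ _ d0 w1 h4 rS1 rdt tK gt ndg mok mz mW.
  exists (esize e + 1 + k + 2), [eta r2 with d |-> 0], m2; split=> //.
  + by rewrite eqr // in l2; lia.
  + apply: runs_trans; last first.
      apply: (runs_cons h6); case/code_at_cons: h6 => _ h6.
      by apply: (runs_cons h6); rewrite /= eqxx mod0n; apply: runs_nil.
    apply: runs_trans run2; apply: runs_trans run1 _.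
    rewrite -skE; apply: (runs_cons h2).
    by rewrite /= (negbTE r1d) p1E; apply: runs_nil.
  + by move=> i id; rewrite /= (ltn_eqF id) f2 ?f1.
  + by move=> o oS; rewrite M2 // !eqd.
- move=> /and3P[tK w1 w2] h rS rdt _ gt ndg mok mz mW.
  have rdt' k : rd k -> k < t.+1 by move/rdt/ltnW.
  have ndt : ~~ rd t by apply/negP => /rdt; rewrite ltnn.
  pose rd' k := (k == t) || rd k.
  pose tabs' := upd tabs t (fun o => dn true c1 d t.+1 r tabs o %% W).
  have gtF : g != t by rewrite ltn_eqF.
  have [h1 h23] := code_at_cat h; have [h2 h3] := code_at_cat h23.
  have mzt o : o < S -> m (t * S + o) = 0 by move=> oS; rewrite mz // leqnn.
  have [||k1 [r1 [m1 [l1 run1 f1 M1 F1]]]] :=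
    IH1 _ _ _ _ _ _ _ _ _ d0 w1 h1 rS rdt' tK (ltnSn t) ndt mok.
  - by move=> k o /andP[tk kK] oS; rewrite mz // ltnW.
  - by move=> o oS; rewrite mzt // expn_gt0.
  have rS1 : r1 0 = S by rewrite f1.
  have mok1 : mem_ok rd' tabs' m1.
    move=> k o rk oS; rewrite /tabs' /upd; case/predU1P: rk => [->|rk].
      by rewrite eqxx M1 // /res mzt.
    by rewrite (ltn_eqF (rdt _ rk)) F1 ?mok // region_ne // ltn_eqF // rdt.
  have [|||||k2 [r2 [m2 [l2 run2 f2 M2 F2]]]] :=
    IH2 _ g _ _ _ rd' _ _ _ d0 w2 h2 rS1 _ tK _ _ mok1.
  - by move=> k /predU1P[->|/rdt'].
  - exact: ltnW.
  - by rewrite /rd' negb_or gtF.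
  - move=> k o /andP[tk kK] oS; rewrite F1 ?mz ?kK ?(ltnW tk) //.
    by rewrite region_ne // gtn_eqF.
  - by move=> o oS; rewrite F1 ?region_ne // mW.
  have rS2 : r2 0 = S by rewrite f2.
  (* The second program wrote to [g] only, so the replay finds in memory the tables that the first
     run of [c1] has read. *)
  have mok2 : mem_ok rd tabs m2.
    move=> k o rk oS; have kt : k != t by rewrite ltn_eqF // rdt.
    have kg : k != g by apply: contraTneq rk => ->.
    by rewrite F2 ?region_ne // F1 ?region_ne // mok.
  have [||k3 [r3 [m3 [l3 run3 f3 M3 F3]]]] :=
    IH1 _ _ _ _ _ _ _ _ _ d0 w1 h3 rS2 rdt' tK (ltnSn t) ndt mok2.
  - move=> k o /andP[tk kK] oS.
    rewrite F2 ?F1 ?mz ?kK ?(ltnW tk) // region_ne // gtn_eqF //.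
    exact: ltn_trans tk.
  - move=> o oS; rewrite F2 ?region_ne // 1?eq_sym // M1 //.
    by rewrite res_lt // mzt // expn_gt0.
  have fr i : i < d -> r2 i = r i by move=> id; rewrite f2 ?f1.
  exists (k1 + k2 + k3), r3, m3; split.
  + rewrite /= -/tabs'; have eqT := fun (_ _ : nat) (_ : rd _) => erefl.
    have rdt2 k : rd' k -> k < t.+1 by move=> /predU1P[->|/rdt'].
    rewrite -(cost_eq f1 (fun _ _ _ => erefl) rdt2 w2).
    rewrite (cost_eq fr (fun _ _ _ => erefl) rdt' w1) in l3.
    lia.
  + rewrite /= size_cat size_cat !addnA.
    by apply: runs_trans run3; apply: runs_trans run1 run2.
  + by move=> i id; rewrite f3 ?fr.
  + have rdt2 k : rd' k -> k < t.+1 by move=> /predU1P[->|/rdt'].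
    move=> o oS; rewrite F3 ?region_ne // M2 // F1 ?region_ne //=.
    by rewrite !(dn_eq _ _ f1 (fun _ _ _ => erefl) rdt2 w2).
  (* Only table [t] needs an argument: it was filled starting from zero, each touched cell was
     erased, and an untouched cell had received 0. *)
  + move=> x xg; have [xt|xt] := eqVneq (x %/ S) t; last by rewrite F3 ?F2 ?F1.
    have xS : x %% S < S by rewrite ltn_mod.
    rewrite (divn_eq x S) xt M3 // F2 ?region_ne // 1?eq_sym // M1 // /res.
    rewrite !(dn_eq _ _ fr (fun _ _ _ => erefl) rdt' w1) mzt //.
    by case: eqP => // /dn0 ->; rewrite mod0n.
Qed.

End Correct.
End Language.

(** * Input, word size and output on the machine *)

Definition bitlen (n : nat) : nat := (trunc_log 2 n).+1.

Lemma ltn_bitlen n : n < 2 ^ bitlen n.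
Proof. by case: n => // n; apply: trunc_log_ltn. Qed.

Lemma bitlen_leq n j : 0 < j < bitlen n -> 2 ^ j <= n.
Proof.
case/andP=> j0; rewrite ltnS => jl.
have n0 : 0 < n by case: n jl => //; rewrite trunc_log0; case: j j0.
by apply: leq_trans (trunc_logP (ltnSn 1) n0); rewrite leq_exp2l.
Qed.

(** This makes the input and the powers of 2 behind it fit into table 0. *)
Lemma input_lt n : n + bitlen n < (2 ^ bitlen n) ^ 8.
Proof.
have nN := ltn_bitlen n; have LN : bitlen n < 2 ^ bitlen n by apply: ltn_expl.
have N1 : 1 < 2 ^ bitlen n by rewrite -(expn0 2) ltn_exp2l.
have : 2 ^ bitlen n * 2 <= (2 ^ bitlen n) ^ 8.
  by rewrite [leqRHS]expnS leq_mul // (leq_trans N1) // -[leqLHS]expn1 leq_exp2l.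
lia.
Qed.

(** Instructions 4 to 9 are the loop that writes the powers of 2 until the next one exceeds [n];
    this finds [L] and [N] by doubling alone. Three squarings then put [N ^ 8] into register 0,
    while registers 1, 2 and 3 hold [n], [N] and [L]. *)
Definition prologue : program :=
  [:: Read 1 1; Const 4 1; Const 2 1; Op OAdd 5 1 4;
      Write 5 2; Op OAdd 5 5 4; Op OAdd 2 2 2; Op OAdd 3 3 4;
      Op OLt 6 1 2; Jz 6 4;
      Op OMul 0 2 2; Op OMul 0 0 0; Op OMul 0 0 0].

Definition fetch_output (i : nat) : program :=
  [:: Const 4 i; Op OAdd 5 4 0; Read 5 5; Write 4 5].

Definition epilogue (q : nat) : program := flatten [seq fetch_output i | i <- iota 0 q].

Definition wrap (q : nat) (c : prog) : program :=
  prologue ++ cp true 1 4 2 13 c ++ epilogue q.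

(* The input, followed by the powers of 2 that the prologue writes behind it. *)
Definition raw (n L : nat) (pi : 'S_n) (a : nat) : nat :=
  if n < a <= n + L then 2 ^ (a - n.+1) else input_mem pi a.

Lemma input_mem_gt n (pi : 'S_n) a : n < a -> input_mem pi a = 0.
Proof. by case: a => // a na; rewrite /= insubN // -leqNgt. Qed.

Section Wrap.
Variables (w q K : nat) (c : prog) (n : nat) (pi : 'S_n).
Notation W := (2 ^ w).
Let L := bitlen n.
Let N := 2 ^ L.
Let S := N ^ 8.
Hypotheses (KS : K * S <= W) (K2 : 1 < K) (qS : q <= S).
Let P := wrap q c.

Lemma code_at_prefix P' k k' : P' = k ++ k' -> code_at P' 0 k.
Proof. by move=> -> i ik; rewrite add0n onth_cat ik. Qed.

Lemma table_lt : S < W.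
Proof.
apply: leq_trans KS; rewrite -[X in X < _]mul1n ltn_pmul2r //.
by rewrite !expn_gt0.
Qed.

Let N_gt1 : 1 < N. Proof. by rewrite -(expn0 2) ltn_exp2l. Qed.

Lemma prologue_correct : exists r m,
  [/\ runs w P (4 + 6 * L + 3) (input_state pi) (State 13 r m),
   m =1 raw L pi & [/\ r 0 = S, r 1 = n, r 2 = N & r 3 = L]].
Proof.
have h : code_at P 0 prologue by apply: code_at_prefix erefl.
have sw := table_lt; have nls : n + L < S := input_lt n; have nN := ltn_bitlen n.
have N1 := N_gt1.
have W1 : 1 < W by apply: leq_ltn_trans sw; apply: leq_ltn_trans nls.
have op k : k < size prologue -> onth P k = onth prologue k by move/h.
have st k r m i : pc (State k r m) < size prologue ->
    onth prologue k = Some i -> forall j s,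
    runs w P j (exec_instr w i (State k r m)) s -> runs w P j.+1 (State k r m) s.
  move=> hk hi j s run; rewrite -add1n; apply: runs_trans run.
  by apply: runs_step; rewrite op.
have [r0 [run0 [v1 v2 v3 v4 v5]]] : exists r,
    runs w P 4 (input_state pi) (State 4 r (input_mem pi)) /\
    [/\ r 1 = n, r 2 = 1, r 3 = 0, r 4 = 1 & r 5 = n.+1].
  eexists; split.
    do 4![apply: (st) => //=]; exact: runs_nil.
  split; rewrite /= ?(modn_small W1) //.
  rewrite /eval_binop addn1 modn_small //.
  apply: ltn_trans sw; apply: leq_ltn_trans nls.
  by rewrite /L /bitlen addnS ltnS leq_addr.
pose inv j (r : nat -> nat) :=
  [/\ r 1 = n, r 2 = 2 ^ j, r 3 = j, r 4 = 1 & r 5 = n.+1 + j].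
have iter1 j r m : j < L -> inv j r -> m =1 raw j pi -> exists r' m',
    [/\ runs w P 5 (State 4 r m) (State 9 r' m'), m' =1 raw j.+1 pi,
        inv j.+1 r' & r' 6 = (n < 2 ^ j.+1)].
  move=> jL [u1 u2 u3 u4 u5] mE; do 2!eexists; split.
  - do 5![apply: (st) => //=]; exact: runs_nil.
  - move=> a; rewrite /= u5 u2 /raw mE /raw.
    case: eqP => [->|/eqP ne].
      have -> : n < n.+1 + j <= n + j.+1 by lia.
      by rewrite addKn.
    congr (if _ then _ else _); lia.
  - have jW : 2 ^ j.+1 < W.
      by apply: leq_ltn_trans sw; rewrite /S /N -expnM leq_exp2l //; lia.
    have aW : n.+1 + j.+1 < W by lia.
    split; rewrite /= ?u1 ?u4 // /eval_binop.
    + by rewrite u2 addnn -mul2n -expnS modn_small.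
    + by rewrite u3 addn1 modn_small //; lia.
    + by rewrite u5 addn1 -addnS modn_small.
  - have jW : 2 ^ j.+1 < W.
      by apply: leq_ltn_trans sw; rewrite /S /N -expnM leq_exp2l //; lia.
    rewrite /= /eval_binop u1 u2 addnn -mul2n -expnS (modn_small jW).
    by rewrite modn_small //; apply: leq_ltn_trans W1; case: (n < _).
have loop j : j < L -> exists r m,
    [/\ runs w P (6 * j) (State 4 r0 (input_mem pi)) (State 4 r m),
    m =1 raw j pi & inv j r].
  elim: j => [_|j IHj jL].
    exists r0, (input_mem pi); split=> //.
      by move=> a; rewrite /raw addn0 ltnNge andNb.
    by rewrite /inv addn0.
  have [r [m [run m_j inv_j]]] := IHj (ltnW jL).
  have [r' [m' [run' m_j' inv_j' v6]]] := iter1 _ _ _ (ltnW jL) inv_j m_j.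
  exists r', m'; split=> //; rewrite mulnS addnC.
  apply: runs_trans run _; rewrite -[6]/(5 + 1); apply: runs_trans run' _.
  (* The jump back is taken, since [2 ^ j.+1 <= n] as long as [j.+1] is below the bit length. *)
  apply: (st) => //=; rewrite v6 ltnNge bitlen_leq //=.
(* The last round is run apart, because its jump falls through. *)
have [r [m [run m_j inv_j]]] := loop _ (ltnSn (trunc_log 2 n)).
have [r' [m' [run' m_j' inv_j' v6]]] := iter1 _ _ _ (ltnSn _) inv_j m_j.
case: inv_j' => u1 u2 u3 u4 u5; rewrite -/(bitlen n) -/L -/N in u2 u3 u5 m_j'.
do 2!eexists; split.
- have -> : 4 + 6 * L + 3 = 4 + (6 * trunc_log 2 n + (5 + 4)).
    by rewrite /L /bitlen; lia.
  apply: runs_trans run0 _; apply: runs_trans run _; apply: runs_trans run' _.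
  apply: (st) => //=; rewrite v6 nN.
  do 3![apply: (st) => //=]; exact: runs_nil.
- exact: m_j'.
- have leS k : k <= 8 -> N ^ k < W.
    by move=> k8; apply: leq_ltn_trans sw; rewrite leq_exp2l.
  split=> //=; rewrite /eval_binop u2 mulnn (modn_small (leS 2 isT)).
  by rewrite -expnD (modn_small (leS 4 isT)) -expnM modn_small // leS.
Qed.

(** The copies never destroy a cell that is still to be read: the targets lie below [q <= S], the
    sources from [S] on. *)
Lemma epilogue_correct pc0 r m : code_at P pc0 (epilogue q) -> r 0 = S ->
  exists r' m', runs w P (4 * q) (State pc0 r m) (State (pc0 + 4 * q) r' m') /\
    forall i, i < q -> m' i = m (S + i).
Proof.
have sw := table_lt; move: qS; rewrite /epilogue => qS0 h r0.
suff [r' [m' [run _ h']]] : exists r' m',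
    [/\ runs w P (4 * q) (State pc0 r m) (State (pc0 + 4 * q) r' m'), r' 0 = S &
    forall a, m' a = if a < q then m (S + a) else m a].
  by exists r', m'; split=> // i iq; rewrite h' iq.
elim: (q) qS0 h => [|j IHj] jS h.
  by exists r, m; split=> //; rewrite muln0 addn0.
have sz i : size (flatten [seq fetch_output i | i <- iota 0 i]) = 4 * i.
  elim: i => // i; rewrite -[i.+1]addn1 iotaD map_cat flatten_cat size_cat => -> /=.
  by rewrite mulnDr.
rewrite -[j.+1]addn1 iotaD map_cat flatten_cat in h.
have [h1 h2] := code_at_cat h; rewrite sz in h2.
have [r1 [m1 [run1 r10 m1E]]] := IHj (ltnW jS) h1.
have jW : j < W by apply: ltn_trans sw.
have SjW : j + S < W.
  apply: leq_trans KS; apply: leq_trans (leq_mul K2 (leqnn S)).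
  by rewrite mul2n -addnn ltn_add2r.
do 2!eexists; split.
- rewrite mulnS addnC; apply: runs_trans run1 _.
  apply: (runs_cons h2) => /=; case/code_at_cons: h2 => _ h2.
  apply: (runs_cons h2) => /=; case/code_at_cons: h2 => _ h2.
  apply: (runs_cons h2) => /=; case/code_at_cons: h2 => _ h2.
  apply: (runs_cons h2); apply: runs_nil => /=; lia.
- by rewrite /= r10.
- move=> a; rewrite /= r10 /eval_binop add0n (modn_small jW) (modn_small SjW) !m1E.
  case: eqP => [->|/eqP aj].
    by rewrite ltnNge leq_addr /= ltnSn addnC.
  by rewrite ltnS (leq_eqVlt a j) (negbTE aj).
Qed.

Definition env0 (i : nat) : nat := nth 0 [:: S; n; N; L] i.
Definition tabs0 (k o : nat) : nat := if k == 0 then raw L pi o else 0.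

Lemma wrap_correct : wf K 4 2 (pred1 0) c -> exists k s,
  [/\ k <= 7 + 6 * L + 4 * q + cost w S c 4 2 env0 tabs0,
      runs w P k (input_state pi) s, halted P s &
      forall i, i < q -> memory s i = dn w S true c 4 2 env0 tabs0 i %% W].
Proof.
move=> wfc; have sw := table_lt; have nls : n + L < S := input_lt n.
have [r [m [run mE [e0 e1 e2 e3]]]] := prologue_correct.
have [h1 h2] : code_at P 13 (cp true 1 4 2 13 c) /\
    code_at P (13 + size (cp true 1 4 2 13 c)) (epilogue q).
  have h : code_at P 0 P by move=> i _; rewrite add0n.
  by have [_ /code_at_cat[]] := code_at_cat h.
have Sb : 0 < S < W by rewrite sw (leq_ltn_trans _ nls).
have mok : mem_ok S (pred1 0) tabs0 m.
  by move=> k o /eqP -> oS; rewrite mul0n mE.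
(* Everything from table 1 on is empty at the start, as the input and the powers end below [S]. *)
have mz k o : 0 < k -> o < S -> m (k * S + o) = 0.
  move=> k0 oS; have nLk : n + L < k * S + o.
    by apply: leq_trans nls _; apply: leq_trans (leq_addr _ _); rewrite leq_pmull.
  rewrite mE /raw [_ <= n + L]leqNgt nLk andbF.
  by apply: input_mem_gt; apply: leq_ltn_trans (leq_addr L n) nLk.
have m1 o : o < S -> m (1 * S + o) < W.
  by move=> oS; rewrite mz // expn_gt0.
have [|||k [r1 [m' [l1 run1 f1 M1 _]]]] :=
    cp_correct KS Sb (isT : 0 < 4) wfc h1 e0 _ K2 (ltnSn 1) _ mok _ m1.
- by move=> k /eqP ->.
- by [].
- by move=> k o /andP[k2 _]; apply: mz; apply: leq_trans k2.
have e0' : r1 0 = S by rewrite f1.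
have [r2 [m2 [run2 M2]]] := epilogue_correct m' h2 e0'.
have envE i : i < 4 -> r i = env0 i.
  by case: i => [|[|[|[|]]]].
have rd2 k0 : pred1 0 k0 -> k0 < 2 by move/eqP->.
exists (4 + 6 * L + 3 + k + 4 * q); eexists; split.
- rewrite (cost_eq w S envE (fun _ _ _ => erefl) rd2 wfc) in l1; lia.
- exact: runs_trans (runs_trans run run1) run2.
- rewrite /halted /= /P /wrap !size_cat /=.
  have -> : size (epilogue q) = 4 * q; last lia.
  rewrite /epilogue; elim: (q) => // i IH.
  by rewrite -[i.+1]addn1 iotaD map_cat flatten_cat size_cat IH /= mulnDr.
- move=> i iq; have iS : i < S by apply: leq_trans qS.
  have mSi := mz 1 i isT iS; rewrite mul1n in mSi.
  rewrite /= M2 //; have := M1 i iS; rewrite mul1n => ->; rewrite /res mSi add0n.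
  by rewrite (dn_eq w S _ _ envE (fun _ _ _ => erefl) rd2 wfc).
Qed.

End Wrap.

(** * Weighted 5-cycles *)

Section FiveSums.
Variable N : nat.

Definition sum5 (F : nat -> nat -> nat -> nat -> nat -> nat) : nat :=
  \sum_(a < N) \sum_(b < N) \sum_(c < N) \sum_(d < N) \sum_(e < N) F a b c d e.

Lemma eq_sum5 F G : (forall a b c d e, a < N -> b < N -> c < N -> d < N -> e < N ->
  F a b c d e = G a b c d e) -> sum5 F = sum5 G.
Proof. by move=> h; do 5!apply: eq_bigr => ? _; apply: h. Qed.

Lemma exchange_sum5 (M : nat) (F : nat -> nat -> nat -> nat -> nat -> nat -> nat) :
  \sum_(k < M) sum5 (F k) = sum5 (fun a b c d e => \sum_(k < M) F k a b c d e).
Proof.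
by do 5!(rewrite /sum5 exchange_big /=; apply: eq_bigr => ? _).
Qed.

Lemma sum5_12 F : sum5 F = sum5 (fun b a c d e => F a b c d e).
Proof. by rewrite /sum5 exchange_big. Qed.

Lemma sum5_23 F : sum5 F = sum5 (fun a c b d e => F a b c d e).
Proof. by apply: eq_bigr => ? _; rewrite exchange_big. Qed.

Lemma sum5_34 F : sum5 F = sum5 (fun a b d c e => F a b c d e).
Proof. by do 2!apply: eq_bigr => ? _; rewrite exchange_big. Qed.

Lemma sum5_45 F : sum5 F = sum5 (fun a b c e d => F a b c d e).
Proof. by do 3!apply: eq_bigr => ? _; rewrite exchange_big. Qed.

End FiveSums.

Section Cycle.
Variables (L : nat) (Y X : nat -> nat).
Let N := 2 ^ L.
Hypotheses (YN : forall i, i < N -> Y i < N) (XN : forall i, i < N -> X i < N).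
Hypothesis XY : forall i, i < N -> X (Y i) = i.

(** The position block and the value block of a point, packed in base [N] so that the pair can index
    a table. *)
Definition key (dx dy i : nat) : nat := i %/ dx * N + Y i %/ dy.

Lemma key_lt dx dy i : i < N -> key dx dy i < N ^ 2.
Proof.
move=> iN; have := leq_ltn_trans (leq_div i dx) iN.
have := leq_ltn_trans (leq_div (Y i) dy) (YN iN).
rewrite /key expnS expn1; nia.
Qed.

Lemma key_eq dx dy i j : i < N -> j < N ->
  (key dx dy i == key dx dy j) =
  (i %/ dx == j %/ dx) && (Y i %/ dy == Y j %/ dy).
Proof.
move=> iN jN.
have hi := leq_ltn_trans (leq_div (Y i) dy) (YN iN).
have hj := leq_ltn_trans (leq_div (Y j) dy) (YN jN).
have N0 : 0 < N by rewrite expn_gt0.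
rewrite /key; apply/eqP/andP => [h|[/eqP-> /eqP->//]].
have h1 := congr1 (divn^~ N) h; have h2 := congr1 (modn^~ N) h.
rewrite /= !divnMDl // (divn_small hi) (divn_small hj) !addn0 in h1.
by rewrite /= !modnMDl (modn_small hi) (modn_small hj) in h2; rewrite h1 h2.
Qed.

Lemma sum_blockX D r (F : nat -> nat) : D %| N -> r < N ->
  \sum_(j < D) F (r %/ D * D + j) = \sum_(i < N) (i %/ D == r %/ D) * F i.
Proof.
move=> /dvdnP[q NE] rN; have D0 : 0 < D.
  by case: D NE => // NE; rewrite NE muln0 in rN.
set b := r %/ D; have bq : b < q by rewrite ltn_divLR // -NE.
have bD : b * D + D <= N by rewrite NE -mulSnr leq_mul2r bq orbT.
rewrite -(big_mkord xpredT (fun i => (i %/ D == b) * F i)).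
rewrite (@big_cat_nat _ _ _ (b * D)) //=; last by apply: leq_trans bD; rewrite leq_addr.
have -> : \sum_(0 <= i < b * D) (i %/ D == b) * F i = 0.
  rewrite big_nat big1 // => i /= ib.
  by rewrite ltn_eqF // ltn_divLR.
rewrite add0n (@big_cat_nat _ _ _ (b * D + D)) ?leq_addr //=.
have -> : \sum_(b * D + D <= i < N) (i %/ D == b) * F i = 0.
  rewrite big_nat big1 // => i /andP[ib _].
  by rewrite gtn_eqF // leq_divRL // mulSnr.
rewrite addn0.
rewrite -[X in _ = \sum_(X <= _ < _) _]add0n big_addn addKn big_mkord; apply: eq_bigr => j _.
by rewrite [_ j + _]addnC divnMDl // divn_small // addn0 eqxx mul1n.
Qed.

(** A value block is an interval of values, so its points are listed through the inverse [X] of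
    [Y]. *)
Lemma sum_blockY D r (F : nat -> nat) : D %| N -> r < N ->
  \sum_(j < D) F (X (Y r %/ D * D + j)) =
  \sum_(i < N) (Y i %/ D == Y r %/ D) * F i.
Proof.
move=> DN rN; rewrite (sum_blockX (fun y => F (X y)) DN (YN rN)).
pose h (i : 'I_N) := Ordinal (YN (ltn_ord i)).
have h_inj : injective h.
  by move=> i j /(congr1 val) /= e; apply: val_inj; rewrite /= -(XY (ltn_ord i)) e XY.
rewrite (reindex_inj h_inj); apply: eq_bigr => i _ /=.
by rewrite XY.
Qed.

(** Cuts an equality constraint: both sides are compared with a loop index [k] instead of with each
    other. *)
Lemma sum_fiber M (a b : nat) : a < M ->
  \sum_(k < M) (a == k) * (b == k) = (a == b) :> nat.
Proof.
move=> aM; rewrite (bigD1 (Ordinal aM)) //= eqxx mul1n eq_sym big1 ?addn0 // => i ia.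
by rewrite [a == i]eq_sym (negbTE (_ : i != a :> nat)).
Qed.

Lemma div_coarsen d D i j : d %| D -> i %/ d = j %/ d -> i %/ D = j %/ D.
Proof. by case/dvdnP=> e ->; rewrite mulnC !divnMA => ->. Qed.

(** The nested form is the one that four tables evaluate, innermost first. For fixed [k] the
    constraint between the two ends of the path has become a condition on each end. *)
Lemma path_sum5 M (f k1 k2 k3 k4 w1 w2 w3 w4 w5 : nat -> nat) :
  (forall i, i < N -> f i < M) ->
  \sum_(k < M) \sum_(a < N) ((f a == k) * w1 a * \sum_(b < N) (k1 b == k1 a) *
    (w2 b * \sum_(c < N) (k2 c == k2 b) * (w3 c * \sum_(d < N) (k3 d == k3 c) *
    (w4 d * \sum_(e < N) (k4 e == k4 d) * ((f e == k) * w5 e))))) =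
  sum5 N (fun a b c d e => (f a == f e) * (k1 b == k1 a) * (k2 c == k2 b) *
    (k3 d == k3 c) * (k4 e == k4 d) * (w1 a * w2 b * w3 c * w4 d * w5 e)).
Proof.
move=> fM; pose F k a b c d e :=
    (f a == k) * (f e == k) * ((k1 b == k1 a) * (k2 c == k2 b) *
    (k3 d == k3 c) * (k4 e == k4 d) * (w1 a * w2 b * w3 c * w4 d * w5 e)).
transitivity (\sum_(k < M) sum5 N (F k)).
  rewrite /F.
  apply: eq_bigr => k _; apply: eq_bigr => a _.
  rewrite big_distrr; apply: eq_bigr => b _ /=.
  rewrite !mulnA big_distrr; apply: eq_bigr => c _ /=.
  rewrite !mulnA big_distrr; apply: eq_bigr => d _ /=.
  rewrite !mulnA big_distrr; apply: eq_bigr => e _ /=.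
  lia.
rewrite exchange_sum5 /F; apply: eq_sum5 => a b c d e aN _ _ _ _.
by rewrite -big_distrl /= sum_fiber ?fM // !mulnA.
Qed.

Section CycleCases.
Variables (dx dy : nat -> nat) (wp wq ws wr wt : nat -> nat).
Let k e i := key (dx e) (dy e) i.

(* The vertices of the 5-cycle are p, q, s, r, t; edge number e joins
   consecutive vertices, starting with p, q. *)
Definition cycle5 : nat := sum5 N (fun p q s r t =>
  (k 1 p == k 1 q) * (k 2 q == k 2 s) * (k 3 s == k 3 r) * (k 4 r == k 4 t) *
  (k 5 t == k 5 p) * (wp p * wq q * ws s * wr r * wt t)).

Hypotheses (dx2 : forall e, 0 < e <= 5 -> dx e %| dx 2)
  (dx5 : forall e, 0 < e <= 5 -> dx e %| dx 5)
  (dy3 : forall e, 0 < e <= 5 -> dy e %| dy 3).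
Hypotheses (dxN : forall e, 0 < e <= 5 -> dx e %| N)
  (dyN : forall e, 0 < e <= 5 -> dy e %| N).

Let edge_x e i j : i < N -> j < N -> k e i = k e j ->
  i %/ dx e = j %/ dx e.
Proof. by move=> iN jN /eqP; rewrite key_eq // => /andP[/eqP]. Qed.

Let edge_y e i j : i < N -> j < N -> k e i = k e j ->
  Y i %/ dy e = Y j %/ dy e.
Proof. by move=> iN jN /eqP; rewrite key_eq // => /andP[_ /eqP]. Qed.

Let coarse_x e e' i j : (e' == 2) || (e' == 5) -> 0 < e <= 5 -> i < N -> j < N ->
  k e i = k e j -> i %/ dx e' = j %/ dx e'.
Proof.
move=> he' he iN jN /(edge_x iN jN); apply: div_coarsen.
by case/orP: he' => /eqP ->; [apply: dx2|apply: dx5].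
Qed.

Let coarse_y e i j : 0 < e <= 5 -> i < N -> j < N ->
  k e i = k e j -> Y i %/ dy 3 = Y j %/ dy 3.
Proof. by move=> he iN jN /(edge_y iN jN); apply: div_coarsen; apply: dy3. Qed.

Lemma ltn_div_dvd D i : D %| N -> i < N -> i %/ D < N %/ D.
Proof.
move=> DN iN; rewrite ltn_divLR ?divnK //.
by case: D DN => //; rewrite dvd0n /N expn_eq0.
Qed.

(** The loop index [c] is the common position block of [s] and [r]. The value half of edge 3 follows
    along the path r, t, p, q, s, all of whose value blocks refine those of [dy 3]. *)
Lemma cycle5_xloop :
  \sum_(c < N %/ dx 3) \sum_(r < N) ((r %/ dx 3 == c) * wr r *
    \sum_(t < N) (k 4 t == k 4 r) * (wt t *
    \sum_(p < N) (k 5 p == k 5 t) * (wp p *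
    \sum_(q < N) (k 1 q == k 1 p) * (wq q *
    \sum_(s < N) (k 2 s == k 2 q) * ((s %/ dx 3 == c) * ws s))))) = cycle5.
Proof.
have fM i : i < N -> i %/ dx 3 < N %/ dx 3 by apply: ltn_div_dvd; apply: dxN.
rewrite (path_sum5 _ _ _ _ _ _ _ _ _ fM).
rewrite /cycle5 [RHS]sum5_34 [RHS]sum5_23 [RHS]sum5_12 [RHS]sum5_45.
rewrite [RHS]sum5_34 [RHS]sum5_23.
apply: eq_sum5 => r t p q s rN tN pN qN sN.
rewrite [k 3 s == _]key_eq // [s %/ _ == _]eq_sym.
rewrite [k 1 p == _]eq_sym [k 2 q == _]eq_sym [k 4 r == _]eq_sym [k 5 t == _]eq_sym.
case: (k 4 t =P k 4 r) => [e4|]; rewrite ?(muln0, mul0n) //.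
case: (k 5 p =P k 5 t) => [e5|]; rewrite ?(muln0, mul0n) //.
case: (k 1 q =P k 1 p) => [e1|]; rewrite ?(muln0, mul0n) //.
case: (k 2 s =P k 2 q) => [e2|]; rewrite ?(muln0, mul0n) //.
have -> : Y s %/ dy 3 = Y r %/ dy 3.
  rewrite (coarse_y _ _ _ e2) // (coarse_y _ _ _ e1) // (coarse_y _ _ _ e5) //.
  exact: coarse_y e4.
by rewrite eqxx andbT; lia.
Qed.

(** The dual cut, at edge 5: [c] is the common value block of [t] and [p], and the position half
    follows along p, q, s, r, t because [dx 5] is coarsest. *)
Lemma cycle5_yloop :
  \sum_(c < N %/ dy 5) \sum_(p < N) ((Y p %/ dy 5 == c) * wp p *
    \sum_(q < N) (k 1 q == k 1 p) * (wq q *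
    \sum_(s < N) (k 2 s == k 2 q) * (ws s *
    \sum_(r < N) (k 3 r == k 3 s) * (wr r *
    \sum_(t < N) (k 4 t == k 4 r) * ((Y t %/ dy 5 == c) * wt t))))) = cycle5.
Proof.
have fM i : i < N -> Y i %/ dy 5 < N %/ dy 5.
  by move=> iN; apply: ltn_div_dvd; [apply: dyN|apply: YN].
rewrite (path_sum5 _ _ _ _ _ _ _ _ _ fM).
apply: eq_sum5 => p q s r t pN qN sN rN tN.
rewrite [k 5 t == _]key_eq // [Y p %/ _ == _]eq_sym.
rewrite [k 1 p == _]eq_sym [k 2 q == _]eq_sym [k 4 r == _]eq_sym [k 3 s == _]eq_sym.
case: (k 1 q =P k 1 p) => [e1|]; rewrite ?(muln0, mul0n) //.
case: (k 2 s =P k 2 q) => [e2|]; rewrite ?(muln0, mul0n) //.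
case: (k 3 r =P k 3 s) => [e3|]; rewrite ?(muln0, mul0n) //.
case: (k 4 t =P k 4 r) => [e4|]; rewrite ?(muln0, mul0n) //.
have -> : t %/ dx 5 = p %/ dx 5.
  rewrite (coarse_x _ _ _ _ e4) // (coarse_x _ _ _ _ e3) // (coarse_x _ _ _ _ e2) //.
  exact: coarse_x e1.
by rewrite eqxx; lia.
Qed.

(** Fixing the value block [c] of edge 2 decouples [q] from [s]: given (t, p), the choices of (r, s)
    depend only on the key of [t] and those of [q] only on the key of [p], so both inner sums are
    table entries. The position half of edge 2 follows along q, p, t, r, s. *)
Lemma cycle5_pairs_loop :
  \sum_(c < N %/ dy 2) \sum_(t < N) \sum_(p < N) (Y p %/ dy 5 == Y t %/ dy 5) *
    ((t %/ dx 5 == p %/ dx 5) * wt t * wp p *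
     (\sum_(r < N) \sum_(s < N) (s %/ dx 3 == r %/ dx 3) * ((k 4 r == k 4 t) *
        ((Y s %/ dy 2 == c) * (Y r %/ dy 3 == Y s %/ dy 3) * wr r * ws s))) *
     (\sum_(q < N) (k 1 q == k 1 p) * ((Y q %/ dy 2 == c) * wq q))) = cycle5.
Proof.
pose F c t p q r s :=
    (Y s %/ dy 2 == c) * (Y q %/ dy 2 == c) *
    ((Y p %/ dy 5 == Y t %/ dy 5) * (t %/ dx 5 == p %/ dx 5) * (k 4 r == k 4 t) *
     (s %/ dx 3 == r %/ dx 3) * (Y r %/ dy 3 == Y s %/ dy 3) * (k 1 q == k 1 p) *
     (wp p * wq q * ws s * wr r * wt t)).
transitivity (\sum_(c < N %/ dy 2) sum5 N (F c)).
  rewrite /F.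
  apply: eq_bigr => c _; do 2!apply: eq_bigr => ? _.
  rewrite big_distrr /= big_distrr; apply: eq_bigr => q _ /=.
  rewrite big_distrr /= big_distrl /= big_distrr; apply: eq_bigr => r _ /=.
  rewrite big_distrr /= big_distrl /= big_distrr; apply: eq_bigr => s _ /=.
  lia.
rewrite exchange_sum5 /F.
rewrite /cycle5 [RHS]sum5_45 [RHS]sum5_34 [RHS]sum5_23 [RHS]sum5_12.
rewrite [RHS]sum5_45.
apply: eq_sum5 => t p q r s tN pN qN rN sN.
have sM : Y s %/ dy 2 < N %/ dy 2 by apply: ltn_div_dvd; [apply: dyN|apply: YN].
rewrite -big_distrl /= sum_fiber //.
rewrite [k 1 p == _]eq_sym [k 4 r == _]eq_sym.
rewrite [k 2 q == _]key_eq // [k 3 s == _]key_eq // [k 5 t == _]key_eq //.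
rewrite [Y p %/ _ == _]eq_sym [Y r %/ _ == _]eq_sym [Y s %/ dy 2 == _]eq_sym [k 4 t == _]eq_sym.
case: (k 1 q =P k 1 p) => [e1|]; rewrite ?(muln0, mul0n) //.
case: (k 4 r =P k 4 t) => [e4|]; rewrite ?(muln0, mul0n) //.
case: (t %/ dx 5 =P p %/ dx 5) => [e5|]; rewrite ?(muln0, mul0n) //.
case: (s %/ dx 3 =P r %/ dx 3) => [e3|]; rewrite ?(muln0, mul0n) //.
have -> : q %/ dx 2 = s %/ dx 2.
  rewrite (coarse_x _ _ _ _ e1) // (div_coarsen _ e3) ?dx2 //.
  by rewrite (coarse_x _ _ _ _ e4) // (div_coarsen _ e5) ?dx2.
by rewrite eqxx /= !mul1n; lia.
Qed.

(** The pair (t, p) meets the triple (r, s, q) only in edges 4 and 1, so one table indexed by both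
    keys connects them. *)
Lemma cycle5_triples :
  \sum_(r < N) \sum_(s < N) (s %/ dx 3 == r %/ dx 3) *
    \sum_(q < N) (Y q %/ dy 2 == Y s %/ dy 2) *
    ((Y r %/ dy 3 == Y s %/ dy 3) * (s %/ dx 2 == q %/ dx 2) * wr r * ws s * wq q *
     \sum_(t < N) \sum_(p < N) (Y p %/ dy 5 == Y t %/ dy 5) *
       ((k 4 t * N ^ 2 + k 1 p == k 4 r * N ^ 2 + k 1 q) *
        ((t %/ dx 5 == p %/ dx 5) * wt t * wp p))) = cycle5.
Proof.
rewrite /cycle5 [RHS]sum5_34 [RHS]sum5_23 [RHS]sum5_12 [RHS]sum5_23.
rewrite [RHS]sum5_34 [RHS]sum5_23 [RHS]sum5_45.
apply: eq_bigr => r _; apply: eq_bigr => s _.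
rewrite big_distrr; apply: eq_bigr => q _ /=.
do 3!(rewrite big_distrr /=); apply: eq_bigr => t _ /=.
do 3!(rewrite big_distrr /=); apply: eq_bigr => p _ /=.
(* Keys are below [N ^ 2], so these are numbers with two digits in base [N ^ 2]. *)
have -> : (k 4 t * N ^ 2 + k 1 p == k 4 r * N ^ 2 + k 1 q) =
    (k 4 t == k 4 r) && (k 1 p == k 1 q).
  have hp := key_lt (dx 1) (dy 1) (ltn_ord p).
  have hq := key_lt (dx 1) (dy 1) (ltn_ord q).
  apply/eqP/andP => [h|[/eqP-> /eqP->//]].
  have h1 := congr1 (divn^~ (N ^ 2)) h; have h2 := congr1 (modn^~ (N ^ 2)) h.
  rewrite /= !divnMDl ?expn_gt0 // (divn_small hp) (divn_small hq) !addn0 in h1.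
  rewrite /= !modnMDl (modn_small hp) (modn_small hq) in h2.
  by split; apply/eqP; [exact: h1|exact: h2].
rewrite [k 2 q == _]key_eq // [k 3 s == _]key_eq // [k 5 t == _]key_eq //.
rewrite -!mulnb [k 4 t == _]eq_sym [q %/ _ == _]eq_sym.
rewrite [Y r %/ _ == _]eq_sym [Y p %/ _ == _]eq_sym; lia.
Qed.

End CycleCases.
End Cycle.

(** * Programs for 5-cycles *)

Definition eadd := EBin OAdd.
Definition emul := EBin OMul.
Definition ediv := EBin ODiv.
Definition eeq := EBin OEq.

Definition ekey (dx dy e : exp) : exp :=
  eadd (emul (ediv e dx) (EVar 2)) (ediv (ETab 2 e) dy).

Definition tabulate (d : nat) (ke we : exp -> exp) (body : prog) : prog :=
  PTab (PFor (EVar 2) (PAdd (ke (EVar d)) (we (EVar d)))) body.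

Definition lookup (we : exp -> exp) (t : nat) (ke : exp -> exp) (e : exp) : exp :=
  emul (we e) (ETab t (ke e)).

Definition restrict (fe we : exp -> exp) (c e : exp) : exp :=
  emul (eeq (fe e) c) (we e).

Definition path_prog (d t : nat) (out m : exp) (fe : exp -> exp)
    (k1 k2 k3 k4 w1 w2 w3 w4 w5 : exp -> exp) : prog :=
  PFor m
    (tabulate d.+2 k4 (restrict fe w5 (EVar d))
    (tabulate d.+2 k3 (lookup w4 t k4)
    (tabulate d.+2 k2 (lookup w3 t.+1 k3)
    (tabulate d.+2 k1 (lookup w2 t.+2 k2)
    (PFor (EVar 2) (PAdd out
       (lookup (restrict fe w1 (EVar d)) t.+3 k1 (EVar d.+2)))))))).

(* The j-th element of the block of e, among the positions or the values. *)
Definition block_x (dx e j : exp) : exp := eadd (emul (ediv e dx) dx) j.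
Definition block_y (dy e j : exp) : exp := ETab 3 (block_x dy (ETab 2 e) j).

Definition pair_key (a b : exp) : exp :=
  eadd (emul a (emul (EVar 2) (EVar 2))) b.

Definition same (fe : exp -> exp) (a b : exp) : exp := eeq (fe a) (fe b).
Definition shift_x (dx e : exp) : exp := ediv e dx.
Definition shift_y (dy e : exp) : exp := ediv (ETab 2 e) dy.

Section CycleProgram.
Variables (d t : nat) (out : exp) (dx dy : nat -> exp).
Variables (wp wq ws wr wt : exp -> exp).
Let k e := ekey (dx e) (dy e).

Definition xloop_prog : prog :=
  path_prog d t out (ediv (EVar 2) (dx 3)) (shift_x (dx 3))
    (k 4) (k 5) (k 1) (k 2) wr wt wp wq ws.

Definition yloop_prog : prog :=
  path_prog d t out (ediv (EVar 2) (dy 5)) (shift_y (dy 5))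
    (k 1) (k 2) (k 3) (k 4) wp wq ws wr wt.

Definition pairs_loop_prog : prog :=
  PFor (ediv (EVar 2) (dy 2))
    (tabulate d.+2 (k 1) (restrict (shift_y (dy 2)) wq (EVar d))
    (PTab
      (let r := EVar d.+2 in let s := block_x (dx 3) r (EVar d.+4) in
       PFor (EVar 2) (PFor (dx 3) (PAdd (k 4 r)
         (emul (emul (emul (eeq (shift_y (dy 2) s) (EVar d))
           (same (shift_y (dy 3)) r s)) (wr r)) (ws s)))))
      (let t1 := EVar d.+2 in let p := block_y (dy 5) t1 (EVar d.+4) in
       PFor (EVar 2) (PFor (dy 5) (PAdd out
         (emul (emul (emul (emul (same (shift_x (dx 5)) t1 p) (wt t1)) (wp p))
           (ETab t.+1 (k 4 t1))) (ETab t (k 1 p)))))))).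

Definition triples_prog : prog :=
  PTab
    (let t1 := EVar d in let p := block_y (dy 5) t1 (EVar d.+2) in
     PFor (EVar 2) (PFor (dy 5) (PAdd (pair_key (k 4 t1) (k 1 p))
       (emul (emul (same (shift_x (dx 5)) t1 p) (wt t1)) (wp p)))))
    (let r := EVar d in let s := block_x (dx 3) r (EVar d.+2) in
     let q := block_y (dy 2) s (EVar d.+4) in
     PFor (EVar 2) (PFor (dx 3) (PFor (dy 2) (PAdd out
       (emul (emul (emul (emul (emul (same (shift_y (dy 3)) r s)
         (same (shift_x (dx 2)) s q)) (wr r)) (ws s)) (wq q))
         (ETab t (pair_key (k 4 r) (k 1 q)))))))).

(* [g] and [g2] are the thresholds for short and long blocks, of about
   [N^(1/4)] and [N^(1/2)] elements. *)
Definition cycle_prog (g g2 : exp) : prog :=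
  PIte (EBin OLt (dx 3) g)
    (PIte (EBin OLt (dy 5) g)
      (PIte (EBin OLt (dy 2) g2) triples_prog pairs_loop_prog)
      yloop_prog)
    xloop_prog.

End CycleProgram.

(** * Denotation of the cycle programs *)

Section Semantics.
Variables (w L : nat) (Y X : nat -> nat).
Notation W := (2 ^ w).
Let N := 2 ^ L.
Let S := N ^ 8.
Hypotheses (YN : forall i, i < N -> Y i < N) (XN : forall i, i < N -> X i < N).
Hypothesis XY : forall i, i < N -> X (Y i) = i.
Hypotheses (L0 : 0 < L) (SW : S < W).

Local Notation ev := (ev w S).
Local Notation dn := (dn w S true).

(** Code inside a scope may set registers from [d] on and tables from [t] on; what lies below is
    fixed. *)
Definition ext (d t : nat) (env : nat -> nat) (tabs : nat -> nat -> nat)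
    (env' : nat -> nat) (tabs' : nat -> nat -> nat) :=
  (forall i, i < d -> env' i = env i) /\
  (forall k o, k < t -> tabs' k o = tabs k o).

Definition base d t (env : nat -> nat) (tabs : nat -> nat -> nat) :=
  [/\ 3 < d, 3 < t, env 2 = N, forall i, i < N -> tabs 2 i = Y i &
      forall i, i < N -> tabs 3 i = X i].

(** Quantifying over all extensions makes a specification survive the loops and tables opened later.
    Values and keys are exact, as they serve as bounds and addresses; for weights [wspec] asks only
    for a congruence. *)
Definition vspec d t env tabs e (v : nat) := forall env' tabs',
  ext d t env tabs env' tabs' -> ev env' tabs' e = v.

Definition kspec d t env tabs (ke : exp -> exp) (k : nat -> nat) :=
  forall env' tabs' e, ext d t env tabs env' tabs' -> ev env' tabs' e < N ->
  ev env' tabs' (ke e) = k (ev env' tabs' e).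

Definition wspec d t env tabs (we : exp -> exp) (f : nat -> nat) :=
  forall env' tabs' e, ext d t env tabs env' tabs' -> ev env' tabs' e < N ->
  ev env' tabs' (we e) = f (ev env' tabs' e) %[mod W].

Lemma ext_refl d t env tabs : ext d t env tabs env tabs. Proof. by []. Qed.

Lemma ext_trans d t d' t' env tabs env1 tabs1 env2 tabs2 :
  d <= d' -> t <= t' -> ext d t env tabs env1 tabs1 ->
  ext d' t' env1 tabs1 env2 tabs2 -> ext d t env tabs env2 tabs2.
Proof.
move=> dd tt [h1 h2] [h3 h4]; split=> [i id|k o kt].
  by rewrite h3 ?h1 // (leq_trans id).
by rewrite h4 ?h2 // (leq_trans kt).
Qed.

Lemma ext_for d t env tabs m j : ext d t env tabs (upd (upd env d.+1 m) d j) tabs.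
Proof. by split=> // i id; rewrite /upd !ltn_eqF // ltnW. Qed.

Lemma ext_tab d t env tabs T : ext d t env tabs env (upd tabs t T).
Proof. by split=> // k o kt; rewrite /upd ltn_eqF. Qed.

Section Stability.
Variables (d t d' t' : nat) (env env1 : nat -> nat) (tabs tabs1 : nat -> nat -> nat).
Hypotheses (dd : d <= d') (tt : t <= t') (E : ext d t env tabs env1 tabs1).

Lemma vspec_ext e v : vspec d t env tabs e v -> vspec d' t' env1 tabs1 e v.
Proof. by move=> h env2 tabs2 /(ext_trans dd tt E); apply: h. Qed.

Lemma kspec_ext e v : kspec d t env tabs e v -> kspec d' t' env1 tabs1 e v.
Proof. by move=> h env2 tabs2 x /(ext_trans dd tt E); apply: h. Qed.

Lemma wspec_ext e v : wspec d t env tabs e v -> wspec d' t' env1 tabs1 e v.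
Proof. by move=> h env2 tabs2 x /(ext_trans dd tt E); apply: h. Qed.

Lemma base_ext : base d t env tabs -> base d' t' env1 tabs1.
Proof.
case: E => h1 h2 [d3 t3 e2 t2 t3']; split.
- exact: leq_trans dd.
- exact: leq_trans tt.
- by rewrite h1 // ltnW // ltnW.
- by move=> i iN; rewrite h2 ?t2 // ltnW.
- by move=> i iN; rewrite h2 ?t3'.
Qed.

End Stability.

Lemma N_gt1 : 1 < N. Proof. by rewrite -(expn0 2) ltn_exp2l. Qed.

Lemma N_gt0 : 0 < N. Proof. exact: ltnW N_gt1. Qed.

Lemma expN_ltW k : k <= 8 -> N ^ k < W.
Proof. by move=> k8; apply: leq_ltn_trans SW; rewrite leq_exp2l ?N_gt1. Qed.

Lemma expN_leS k : k <= 8 -> N ^ k <= S.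
Proof. by move=> k8; rewrite leq_exp2l ?N_gt1. Qed.

Lemma N_ltW : N < W. Proof. exact: (@expN_ltW 1). Qed.

Lemma N_leS : N <= S. Proof. exact: (@expN_leS 1). Qed.

Lemma W_gt1 : 1 < W. Proof. exact: ltn_trans N_gt1 N_ltW. Qed.

Lemma ev_add env tabs a b : ev env tabs a + ev env tabs b < W ->
  ev env tabs (eadd a b) = ev env tabs a + ev env tabs b.
Proof. by move=> h; rewrite /= /eval_binop modn_small. Qed.

Lemma ev_mul env tabs a b : ev env tabs a * ev env tabs b < W ->
  ev env tabs (emul a b) = ev env tabs a * ev env tabs b.
Proof. by move=> h; rewrite /= /eval_binop modn_small. Qed.

Lemma ev_div env tabs a b : ev env tabs a < W ->
  ev env tabs (ediv a b) = ev env tabs a %/ ev env tabs b.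
Proof.
by move=> h; rewrite /= /eval_binop modn_small //; apply: leq_ltn_trans h; apply: leq_div.
Qed.

Lemma ev_eqb env tabs a b :
  ev env tabs (eeq a b) = (ev env tabs a == ev env tabs b).
Proof.
by rewrite /= /eval_binop modn_small // (leq_ltn_trans _ W_gt1) //; case: (_ == _).
Qed.

Lemma ev_ltb env tabs a b :
  ev env tabs (EBin OLt a b) = (ev env tabs a < ev env tabs b).
Proof.
rewrite /= /eval_binop modn_small // (leq_ltn_trans _ W_gt1) //.
by case: (_ < ev _ _ b).
Qed.

Lemma eqmM a b x y : a = x %[mod W] -> b = y %[mod W] -> a * b = x * y %[mod W].
Proof. by move=> ax b_y; rewrite -modnMm ax b_y modnMm. Qed.

Lemma ev_mulm env tabs a b x y : ev env tabs a = x %[mod W] ->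
  ev env tabs b = y %[mod W] -> ev env tabs (emul a b) = x * y %[mod W].
Proof. by move=> ax b_y; rewrite /= /eval_binop modn_mod; apply: eqmM. Qed.

Lemma eqm_sum m (F G : nat -> nat) : (forall j, j < m -> F j = G j %[mod W]) ->
  \sum_(j < m) F j = \sum_(j < m) G j %[mod W].
Proof.
elim: m => [_|m IH h]; first by rewrite !big_ord0.
by rewrite !big_ord_recr /= -modnDm IH ?h ?modnDm // => j jm; apply: h; apply: ltnW.
Qed.

Lemma dn_tab c1 c2 d t env tabs o : dn (PTab c1 c2) d t env tabs o =
  dn c2 d t.+1 env (upd tabs t (fun x => dn c1 d t.+1 env tabs x %% W)) o.
Proof. by []. Qed.

Lemma dn_for d t env tabs b m c o F : ev env tabs b = m -> m < W ->
  (forall j, j < m ->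
    dn c d.+2 t (upd (upd env d.+1 m) d j) tabs o = F j %[mod W]) ->
  dn (PFor b c) d t env tabs o = \sum_(j < m) F j %[mod W].
Proof.
by move=> bm mW h; rewrite /= bm (modn_small mW); exact: (eqm_sum h).
Qed.

(** The factor [A] is going to be the indicator of the output cell, which is carried out of all
    loops. *)
Lemma dn_for_out d t env tabs b m c o A F : ev env tabs b = m -> m < W ->
  (forall j, j < m ->
    dn c d.+2 t (upd (upd env d.+1 m) d j) tabs o = A * F j %[mod W]) ->
  dn (PFor b c) d t env tabs o = A * \sum_(j < m) F j %[mod W].
Proof. by move=> bm mW h; rewrite big_distrr; apply: dn_for h. Qed.

Lemma dn_add d t env tabs a v o x y : ev env tabs a = x -> x < S ->
  ev env tabs v = y %[mod W] ->
  dn (PAdd a v) d t env tabs o = (x == o) * y %[mod W].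
Proof.
move=> ax xS vy; rewrite /= ax (modn_small xS).
by case: eqP => _; rewrite ?mul1n // mul0n.
Qed.

Lemma ev_loop_var d env tabs m j : m < W -> j < m ->
  ev (upd (upd env d.+1 m) d j) tabs (EVar d) = j.
Proof.
by move=> mW jm; rewrite /= /upd eqxx modn_small // (ltn_trans jm).
Qed.

Lemma ev_outer_var d t env tabs env' tabs' i j : i < d -> env i = j -> j < W ->
  ext d t env tabs env' tabs' -> ev env' tabs' (EVar i) = j.
Proof. by move=> id ij jW [h _]; rewrite /= h // ij modn_small. Qed.

Section InBase.
Variables (d t : nat) (env : nat -> nat) (tabs : nat -> nat -> nat).
Hypothesis B : base d t env tabs.

Lemma base_N env' tabs' : ext d t env tabs env' tabs' -> ev env' tabs' (EVar 2) = N.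
Proof.
case: B => d3 _ e2 _ _; apply: ev_outer_var => //; last exact: N_ltW.
by apply: leq_trans d3.
Qed.

Lemma base_Y env' tabs' e : ext d t env tabs env' tabs' -> ev env' tabs' e < N ->
  ev env' tabs' (ETab 2 e) = Y (ev env' tabs' e).
Proof.
case: B => _ t3 _ hY _ [_ h] eN.
by rewrite /= modn_small ?(leq_trans eN) ?N_leS // h ?hY // ltnW.
Qed.

Lemma base_X env' tabs' e : ext d t env tabs env' tabs' -> ev env' tabs' e < N ->
  ev env' tabs' (ETab 3 e) = X (ev env' tabs' e).
Proof.
case: B => _ t3 _ _ hX [_ h] eN.
by rewrite /= modn_small ?(leq_trans eN) ?N_leS // h ?hX.
Qed.

Lemma kspec_shift_x dx v : vspec d t env tabs dx v ->
  kspec d t env tabs (shift_x dx) (fun i => i %/ v).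
Proof.
move=> hv env' tabs' e E eN; rewrite ev_div ?(hv _ _ E) //.
exact: ltn_trans N_ltW.
Qed.

Lemma kspec_shift_y dy v : vspec d t env tabs dy v ->
  kspec d t env tabs (shift_y dy) (fun i => Y i %/ v).
Proof.
move=> hv env' tabs' e E eN; have YeN := YN eN.
by rewrite ev_div base_Y // ?(hv _ _ E) // (ltn_trans YeN) // N_ltW.
Qed.

Lemma kspec_key dx dy u v : vspec d t env tabs dx u -> vspec d t env tabs dy v ->
  kspec d t env tabs (ekey dx dy) (key L Y u v).
Proof.
move=> hu hv env' tabs' e E eN; have kN := key_lt YN u v eN.
have kW := ltn_trans kN (@expN_ltW 2 isT); rewrite -/N in kN kW.
have e1 := kspec_shift_x hu E eN; have e2 := kspec_shift_y hv E eN.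
have eM : ev env' tabs' (emul (ediv e dx) (EVar 2)) = ev env' tabs' e %/ u * N.
  rewrite ev_mul base_N // e1 //; apply: leq_ltn_trans kW.
  exact: leq_addr.
by rewrite /ekey ev_add eM ?e2.
Qed.

Lemma wspec_restrict fe we f g c v : kspec d t env tabs fe f ->
  wspec d t env tabs we g -> vspec d t env tabs c v ->
  wspec d t env tabs (restrict fe we c) (fun i => (f i == v) * g i).
Proof.
move=> hf hg hc env' tabs' e E eN; apply: ev_mulm; last exact: hg E eN.
by rewrite ev_eqb (hf _ _ _ E eN) (hc _ _ E).
Qed.

Lemma wspec_lookup we ke f k T (g : nat -> nat) : wspec d t env tabs we f ->
  kspec d t env tabs ke k -> (forall i, i < N -> k i < S) ->
  (forall x, x < S -> T x = g x %[mod W]) ->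
  wspec d t.+1 env (upd tabs t T) (lookup we t ke) (fun i => f i * g (k i)).
Proof.
move=> hf hk kS hT env' tabs' e E eN.
have E' : ext d t env tabs env' tabs'.
  exact: ext_trans (leqnn _) (leqnSn _) (ext_tab _ _ _ _ _) E.
apply: ev_mulm; first exact: hf E' eN.
case: E => _ E; rewrite [ev _ _ (ETab _ _)]/= (hk _ _ _ E' eN) (modn_small (kS _ eN)).
by rewrite E // /upd eqxx hT // kS.
Qed.

Lemma dn_tabulate ke we k f body o : kspec d t env tabs ke k ->
  (forall i, i < N -> k i < S) -> wspec d t env tabs we f ->
  exists T, (forall x, x < S -> T x = \sum_(i < N) (k i == x) * f i %[mod W]) /\
    dn (tabulate d ke we body) d t env tabs o =
    dn body d t.+1 env (upd tabs t T) o.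
Proof.
move=> hk kS hf; eexists; split; last by [].
move=> x xS /=; rewrite modn_mod.
have h := @dn_for d t.+1 env tabs (EVar 2) N
  (PAdd (ke (EVar d)) (we (EVar d))) x (fun i => (k i == x) * f i).
apply: h; [exact: base_N|exact: N_ltW|].
move=> j jN; have Ej : ext d t env tabs (upd (upd env d.+1 N) d j) tabs.
  exact: ext_for.
have vj := ev_loop_var d env tabs N_ltW jN.
apply: dn_add; rewrite ?(hk _ _ _ Ej) ?(hf _ _ _ Ej) ?vj //.
exact: kS.
Qed.

End InBase.
(** Continuation form: the rest of the program is verified knowing the new table only through the
    weights that [lookup] builds from it. This is what allows tables to be chained. *)
Lemma dn_tabulate_then d t env tabs ke we k f body o R :
  base d t env tabs -> kspec d t env tabs ke k ->
  (forall i, i < N -> k i < S) -> wspec d t env tabs we f ->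
  (forall tabs', ext d t env tabs env tabs' ->
    (forall we' f', wspec d t env tabs we' f' ->
      wspec d t.+1 env tabs' (lookup we' t ke)
        (fun i => f' i * \sum_(j < N) (k j == k i) * f j)) ->
    dn body d t.+1 env tabs' o = R %[mod W]) ->
  dn (tabulate d ke we body) d t env tabs o = R %[mod W].
Proof.
move=> B hk kS hf h; have [T [hT ->]] := dn_tabulate B body o hk kS hf.
apply: h; first exact: ext_tab.
move=> we' f' hf'.
exact: (wspec_lookup hf' hk kS (g := fun x => \sum_(i < N) (k i == x) * f i)).
Qed.

Lemma dn_path d t env tabs out oc m M fe f k1 k2 k3 k4 h1 h2 h3 h4
    w1 w2 w3 w4 w5 g1 g2 g3 g4 g5 o :
  base d t env tabs -> vspec d t env tabs out oc -> oc < S ->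
  vspec d t env tabs m M -> M < W -> kspec d t env tabs fe f ->
  kspec d t env tabs k1 h1 -> kspec d t env tabs k2 h2 ->
  kspec d t env tabs k3 h3 -> kspec d t env tabs k4 h4 ->
  (forall i, i < N -> [/\ h1 i < S, h2 i < S, h3 i < S & h4 i < S]) ->
  wspec d t env tabs w1 g1 -> wspec d t env tabs w2 g2 ->
  wspec d t env tabs w3 g3 -> wspec d t env tabs w4 g4 ->
  wspec d t env tabs w5 g5 ->
  dn (path_prog d t out m fe k1 k2 k3 k4 w1 w2 w3 w4 w5) d t env tabs o =
  (oc == o) * \sum_(c < M) \sum_(a < N) ((f a == c) * g1 a *
    \sum_(b < N) (h1 b == h1 a) * (g2 b * \sum_(c0 < N) (h2 c0 == h2 b) *
    (g3 c0 * \sum_(d0 < N) (h3 d0 == h3 c0) * (g4 d0 *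
    \sum_(e < N) (h4 e == h4 d0) * ((f e == c) * g5 e))))) %[mod W].
Proof.
move=> B Hout ocS Hm MW Hf K1 K2 K3 K4 KS W1 W2 W3 W4 W5.
have S1 i : i < N -> h1 i < S by case/KS.
have S2 i : i < N -> h2 i < S by case/KS.
have S3 i : i < N -> h3 i < S by case/KS.
have S4 i : i < N -> h4 i < S by case/KS.
have dd : d <= d.+2 by rewrite ltnW.
(* [F4] to [F1] are the entries read through the keys [h4] to [h1], in the order in which the tables
   are filled. *)
pose F4 c d0 := \sum_(e < N) (h4 e == h4 d0) * ((f e == c) * g5 e).
pose F3 c c0 := \sum_(d0 < N) (h3 d0 == h3 c0) * (g4 d0 * F4 c d0).
pose F2 c b := \sum_(c0 < N) (h2 c0 == h2 b) * (g3 c0 * F3 c c0).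
pose F1 c a := \sum_(b < N) (h1 b == h1 a) * (g2 b * F2 c b).
pose F0 c a := (f a == c) * g1 a * F1 c a.
apply: (@dn_for_out d t env tabs m M _ o (oc == o)
  (fun c => \sum_(a < N) F0 c a)); [exact: Hm|exact: MW|move=> c cM].
set en := upd _ d c.
have E0 : ext d t env tabs en tabs by apply: ext_for.
have vc T tb : vspec d.+2 T en tb (EVar d) c.
  move=> env' tabs' E; apply: ev_outer_var E => //.
    by rewrite /en /upd eqxx.
  exact: ltn_trans MW.
apply: (dn_tabulate_then (base_ext dd (leqnn t) E0 B) (kspec_ext dd (leqnn t) E0 K4) S4
  (wspec_restrict (kspec_ext dd (leqnn t) E0 Hf) (wspec_ext dd (leqnn t) E0 W5) (vc t tabs))).
move=> tb1 /(ext_trans dd (leqnn t) E0) E1 /(_ _ _ (wspec_ext dd (leqnn t) E0 W4)) V4.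
have t1 := leqnSn t.
apply: (dn_tabulate_then (base_ext dd t1 E1 B) (kspec_ext dd t1 E1 K3) S3 V4).
move=> tb2 /(ext_trans dd t1 E1) E2 /(_ _ _ (wspec_ext dd t1 E1 W3)) V3.
have t2 := leq_trans t1 (leqnSn _).
apply: (dn_tabulate_then (base_ext dd t2 E2 B) (kspec_ext dd t2 E2 K2) S2 V3).
move=> tb3 /(ext_trans dd t2 E2) E3 /(_ _ _ (wspec_ext dd t2 E2 W2)) V2.
have t3 := leq_trans t2 (leqnSn _).
apply: (dn_tabulate_then (base_ext dd t3 E3 B) (kspec_ext dd t3 E3 K1) S1 V2).
move=> tb4 /(ext_trans dd t3 E3) E4.
move=> /(_ _ _ (wspec_restrict (kspec_ext dd t3 E3 Hf) (wspec_ext dd t3 E3 W1) (vc _ _))) V1.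
have t4 := leq_trans t3 (leqnSn _).
have B4 := base_ext dd t4 E4 B.
apply: (@dn_for_out d.+2 t.+4 en tb4 (EVar 2) N _ o (oc == o) (F0 c)).
- exact: (base_N B4 (ext_refl _ _ _ _)).
- exact: N_ltW.
move=> j jN; have E5 := ext_for d.+2 t.+4 en tb4 N j.
have vj := ev_loop_var d.+2 en tb4 N_ltW jN.
apply: dn_add => //.
  by apply: Hout; apply: ext_trans dd t4 E4 E5.
by rewrite (V1 _ _ _ E5) vj.
Qed.

Lemma block_lt D i j : D %| N -> i < N -> j < D -> i %/ D * D + j < N.
Proof.
move=> DN iN jD; have h := ltn_div_dvd DN iN.
rewrite -(divnK DN); apply: leq_trans (leq_mul h (leqnn D)).
by rewrite mulSnr ltn_add2l.
Qed.

Section CycleSemantics.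
Variables (d t : nat) (env : nat -> nat) (tabs : nat -> nat -> nat).
Hypothesis B : base d t env tabs.
Variables (out : exp) (oc : nat) (dx dy : nat -> exp) (u v : nat -> nat).
Hypotheses (Hout : vspec d t env tabs out oc) (ocS : oc < S).
Hypotheses (Hx : forall e, 0 < e <= 5 -> vspec d t env tabs (dx e) (u e))
  (Hy : forall e, 0 < e <= 5 -> vspec d t env tabs (dy e) (v e))
  (uN : forall e, 0 < e <= 5 -> u e %| N)
  (vN : forall e, 0 < e <= 5 -> v e %| N).
Variables (wp wq ws wr wt : exp -> exp) (gp gq gs gr gt : nat -> nat).
Hypotheses (Hp : wspec d t env tabs wp gp) (Hq : wspec d t env tabs wq gq)
  (Hs : wspec d t env tabs ws gs) (Hr : wspec d t env tabs wr gr)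
  (Ht : wspec d t env tabs wt gt).
Hypotheses (u2 : forall e, 0 < e <= 5 -> u e %| u 2)
  (u5 : forall e, 0 < e <= 5 -> u e %| u 5)
  (v3 : forall e, 0 < e <= 5 -> v e %| v 3).

Local Notation C5 := (cycle5 L Y u v gp gq gs gr gt).

Let Hk e : 0 < e <= 5 ->
  kspec d t env tabs (ekey (dx e) (dy e)) (key L Y (u e) (v e)).
Proof. by move=> he; apply: (kspec_key B); [apply: Hx|apply: Hy]. Qed.

Let kS e i : i < N -> key L Y (u e) (v e) i < S.
Proof.
by move=> iN; apply: leq_trans (key_lt YN _ _ iN) (@expN_leS 2 isT).
Qed.

Let vspec_quot e m : vspec d t env tabs e m ->
  vspec d t env tabs (ediv (EVar 2) e) (N %/ m).
Proof.
move=> he env' tabs' E; rewrite ev_div (base_N B E) ?(he _ _ E) //.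
exact: N_ltW.
Qed.

Let quot_ltW m : N %/ m < W.
Proof. exact: leq_ltn_trans (leq_div _ _) N_ltW. Qed.

Lemma dn_xloop o :
  dn (xloop_prog d t out dx dy wp wq ws wr wt) d t env tabs o =
  (oc == o) * C5 %[mod W].
Proof.
rewrite -(cycle5_xloop YN gp gq gs gr gt v3 uN).
have h e : 0 < e <= 5 -> 0 < e <= 5 by [].
exact: (dn_path o B Hout ocS (vspec_quot (Hx (h 3 isT))) (quot_ltW (u 3))
  (kspec_shift_x (Hx (h 3 isT))) (Hk (h 4 isT)) (Hk (h 5 isT)) (Hk (h 1 isT))
  (Hk (h 2 isT)) (fun i iN => And4 (kS 4 iN) (kS 5 iN) (kS 1 iN) (kS 2 iN))
  Hr Ht Hp Hq Hs).
Qed.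

Lemma dn_yloop o :
  dn (yloop_prog d t out dx dy wp wq ws wr wt) d t env tabs o =
  (oc == o) * C5 %[mod W].
Proof.
rewrite -(cycle5_yloop YN gp gq gs gr gt u2 u5 vN).
have h e : 0 < e <= 5 -> 0 < e <= 5 by [].
exact: (dn_path o B Hout ocS (vspec_quot (Hy (h 5 isT))) (quot_ltW (v 5))
  (kspec_shift_y B (Hy (h 5 isT))) (Hk (h 1 isT)) (Hk (h 2 isT)) (Hk (h 3 isT))
  (Hk (h 4 isT)) (fun i iN => And4 (kS 1 iN) (kS 2 iN) (kS 3 iN) (kS 4 iN))
  Hp Hq Hs Hr Ht).
Qed.

Section Eval.
Variables (env' : nat -> nat) (tabs' : nat -> nat -> nat).
Hypothesis E : ext d t env tabs env' tabs'.
Local Notation evE := (ev env' tabs').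

Lemma ev_block_x e r j : 0 < e <= 5 -> evE r < N -> evE j < u e ->
  evE (block_x (dx e) r j) = evE r %/ u e * u e + evE j.
Proof.
move=> he rN ju; have bN := block_lt (uN he) rN ju.
have rW := ltn_trans rN N_ltW; have bW := ltn_trans bN N_ltW.
have e1 : evE (emul (ediv r (dx e)) (dx e)) = evE r %/ u e * u e.
  rewrite ev_mul ev_div ?(Hx he E) //.
  by apply: leq_ltn_trans rW; apply: leq_divM.
by rewrite /block_x ev_add e1.
Qed.

Lemma ev_block_y e r j : 0 < e <= 5 -> evE r < N -> evE j < v e ->
  evE (block_y (dy e) r j) = X (Y (evE r) %/ v e * v e + evE j).
Proof.
move=> he rN jv; have bN := block_lt (vN he) (YN rN) jv.
have YrW := ltn_trans (YN rN) N_ltW; have bW := ltn_trans bN N_ltW.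
have e1 : evE (emul (ediv (ETab 2 r) (dy e)) (dy e)) = Y (evE r) %/ v e * v e.
  rewrite ev_mul ev_div (base_Y B) ?(Hy he E) //.
  by apply: leq_ltn_trans YrW; apply: leq_divM.
have e2 : evE (block_x (dy e) (ETab 2 r) j) = Y (evE r) %/ v e * v e + evE j.
  by rewrite /block_x ev_add e1.
by rewrite /block_y (base_X B) // e2.
Qed.

Lemma ev_same fe f a b : kspec d t env tabs fe f -> evE a < N -> evE b < N ->
  evE (same fe a b) = (f (evE a) == f (evE b)).
Proof. by move=> hf aN bN; rewrite ev_eqb !(hf _ _ _ E). Qed.

Lemma ev_pair_key a b : evE a < N ^ 2 -> evE b < N ^ 2 ->
  evE (pair_key a b) = evE a * N ^ 2 + evE b /\ evE (pair_key a b) < S.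
Proof.
move=> aN bN; have h : evE a * N ^ 2 + evE b < N ^ 4.
  by rewrite (_ : 4 = 2 + 2) // expnD; nia.
have hW : evE a * N ^ 2 + evE b < W by apply: ltn_trans h (@expN_ltW 4 isT).
have e1 : evE (emul (EVar 2) (EVar 2)) = N ^ 2.
  by rewrite ev_mul (base_N B E) mulnn // expN_ltW.
have e2 : evE (emul a (emul (EVar 2) (EVar 2))) = evE a * N ^ 2.
  by rewrite ev_mul e1 //; apply: leq_ltn_trans hW; apply: leq_addr.
have e3 : evE (pair_key a b) = evE a * N ^ 2 + evE b.
  by rewrite /pair_key ev_add e2.
by rewrite e3; split=> //; apply: leq_trans h (@expN_leS 4 isT).
Qed.

End Eval.

Let u_ltW e : 0 < e <= 5 -> u e < W.
Proof. by move=> he; apply: leq_ltn_trans N_ltW; rewrite dvdn_leq ?N_gt0 ?uN. Qed.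

Let v_ltW e : 0 < e <= 5 -> v e < W.
Proof. by move=> he; apply: leq_ltn_trans N_ltW; rewrite dvdn_leq ?N_gt0 ?vN. Qed.

Lemma dn_triples o :
  dn (triples_prog d t out dx dy wp wq ws wr wt) d t env tabs o =
  (oc == o) * C5 %[mod W].
Proof.
pose G x t0 p := (key L Y (u 4) (v 4) t0 * N ^ 2 + key L Y (u 1) (v 1) p == x) *
  ((t0 %/ u 5 == p %/ u 5) * gt t0 * gp p).
have t1 := leqnSn t; have d0 := leqnn d.
have [d3 t3 _ _ _] := B.
rewrite /triples_prog.
set c1 := PFor _ _; set c2 := PFor _ _.
rewrite dn_tab; set T := fun x => _.
have hT x : T x = \sum_(t0 < N) \sum_(p < N)
    (Y p %/ v 5 == Y t0 %/ v 5) * G x t0 p %[mod W].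
  rewrite /T modn_mod.
  apply: (@dn_for d t.+1 env tabs (EVar 2) N _ x (fun t0 => \sum_(p < N)
    (Y p %/ v 5 == Y t0 %/ v 5) * G x t0 p)); [exact: (base_N B)|exact: N_ltW|].
  move=> t0 t0N; rewrite -(sum_blockY YN XY (G x t0) (vN _)) //.
  set en1 := upd _ d t0.
  have E1 : ext d t env tabs en1 tabs by apply: ext_for.
  apply: (@dn_for _ _ _ _ _ (v 5) _ _ (fun j => G x t0 (X (Y t0 %/ v 5 * v 5 + j)))).
  - exact: (Hy _ E1).
  - exact: v_ltW.
  move=> j jv; set en2 := upd _ d.+2 j.
  have E2 : ext d t env tabs en2 tabs.
    apply: (ext_trans (leqW (leqW (leqnn d))) (leqnn t) E1).
    exact: ext_for.
  have vt : ev en2 tabs (EVar d) = t0.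
    apply: (@ev_outer_var d.+2 t.+1 en1 tabs) => //; last 1 first.
    - exact: ext_for.
    - by rewrite /en1 /upd eqxx.
    - exact: ltn_trans N_ltW.
  have vj : ev en2 tabs (EVar d.+2) = j by apply: ev_loop_var (v_ltW _) jv.
  have ep := @ev_block_y _ _ E2 5 (EVar d) (EVar d.+2) isT.
  rewrite vt vj in ep; move: (ep t0N jv) => {}ep.
  have pN : X (Y t0 %/ v 5 * v 5 + j) < N.
    by apply: XN; apply: block_lt (vN _) (YN t0N) jv.
  have e4 := Hk (isT : 0 < 4 <= 5) E2; have e1 := Hk (isT : 0 < 1 <= 5) E2.
  have tN : ev en2 tabs (EVar d) < N by rewrite vt.
  have pN' : ev en2 tabs (block_y (dy 5) (EVar d) (EVar d.+2)) < N by rewrite ep.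
  have := @ev_pair_key _ _ E2 (ekey (dx 4) (dy 4) (EVar d))
    (ekey (dx 1) (dy 1) (block_y (dy 5) (EVar d) (EVar d.+2))).
  rewrite (e4 _ tN) (e1 _ pN') vt ep => /(_ (key_lt YN _ _ t0N) (key_lt YN _ _ pN)) [pkE pkS].
  apply: dn_add; [exact: pkE|by rewrite -pkE|].
  apply: ev_mulm; last by rewrite (Hp E2 pN') ep.
  apply: ev_mulm; last by rewrite (Ht E2 tN) vt.
  by rewrite (ev_same E2 (kspec_shift_x (Hx _)) tN pN') ?vt ?ep.
set tb := upd tabs t T; have Et : ext d t env tabs env tb by apply: ext_tab.
have hTb env' tabs' e x : ext d t.+1 env tb env' tabs' -> ev env' tabs' e = x ->
    x < S -> ev env' tabs' (ETab t e) = T x.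
  by case=> _ h ex xS; rewrite /= ex modn_small // h // /tb /upd eqxx.
rewrite -(cycle5_triples YN u v gp gq gs gr gt).
pose K r s q := (Y r %/ v 3 == Y s %/ v 3) * (s %/ u 2 == q %/ u 2) *
  gr r * gs s * gq q * \sum_(t0 < N) \sum_(p < N)
    (Y p %/ v 5 == Y t0 %/ v 5) *
    G (key L Y (u 4) (v 4) r * N ^ 2 + key L Y (u 1) (v 1) q) t0 p.
pose H r s := \sum_(q < N) (Y q %/ v 2 == Y s %/ v 2) * K r s q.
apply: (@dn_for_out d t.+1 env tb (EVar 2) N _ o (oc == o)
  (fun r => \sum_(s < N) (s %/ u 3 == r %/ u 3) * H r s)).
- exact: (base_N B Et).
- exact: N_ltW.
move=> r rN; rewrite -(sum_blockX (H r) (uN _)) //.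
set en1 := upd _ d r.
have E1' : ext d t.+1 env tb en1 tb by apply: ext_for.
have E1 := ext_trans d0 t1 Et E1'.
apply: (@dn_for_out _ _ _ _ _ (u 3) _ _ (oc == o)
  (fun j => H r (r %/ u 3 * u 3 + j))).
- exact: (Hx _ E1).
- exact: u_ltW.
move=> j ju; set s := r %/ u 3 * u 3 + j.
have sN : s < N by apply: block_lt (uN _) rN ju.
rewrite /H -(sum_blockY YN XY (K r s) (vN _)) //.
set en2 := upd _ d.+2 j.
have d2 : d <= d.+2 by rewrite ltnW.
have E2' : ext d t.+1 env tb en2 tb.
  by apply: (ext_trans d2 (leqnn _) E1'); apply: ext_for.
have E2 := ext_trans d0 t1 Et E2'.
have vr : ev en2 tb (EVar d) = r.
  apply: (@ev_outer_var d.+2 t.+1 en1 tb) => //; last 1 first.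
  - exact: ext_for.
  - by rewrite /en1 /upd eqxx.
  - exact: ltn_trans N_ltW.
have vj : ev en2 tb (EVar d.+2) = j by apply: ev_loop_var (u_ltW _) ju.
have vs : ev en2 tb (block_x (dx 3) (EVar d) (EVar d.+2)) = s.
  by rewrite (ev_block_x E2) ?vr ?vj.
apply: (@dn_for_out _ _ _ _ _ (v 2) _ _ (oc == o)
  (fun j2 => K r s (X (Y s %/ v 2 * v 2 + j2)))).
- exact: (Hy _ E2).
- exact: v_ltW.
move=> j2 jv; set q := X _.
have qN : q < N by apply: XN; apply: block_lt (vN _) (YN sN) jv.
set en3 := upd _ d.+4 j2.
have E3'' : ext d.+4 t.+1 en2 tb en3 tb by apply: ext_for.
have d4 : d <= d.+4 by rewrite ltnW // ltnW // ltnW.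
have E3' : ext d t.+1 env tb en3 tb by apply: (ext_trans d4 (leqnn _) E2' E3'').
have E3 := ext_trans d0 t1 Et E3'.
have vr3 : ev en3 tb (EVar d) = r.
  by rewrite -vr /=; case: E3'' => h _; rewrite h //; lia.
have vj3 : ev en3 tb (EVar d.+2) = j.
  by rewrite -vj /=; case: E3'' => h _; rewrite h //; lia.
have vj4 : ev en3 tb (EVar d.+4) = j2 by apply: ev_loop_var (v_ltW _) jv.
have vs3 : ev en3 tb (block_x (dx 3) (EVar d) (EVar d.+2)) = s.
  by rewrite (ev_block_x E3) ?vr3 ?vj3.
have vq3 : ev en3 tb (block_y (dy 2) (block_x (dx 3) (EVar d) (EVar d.+2))
    (EVar d.+4)) = q.
  by rewrite (ev_block_y E3) ?vs3 ?vj4.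
have rN3 : ev en3 tb (EVar d) < N by rewrite vr3.
have sN3 : ev en3 tb (block_x (dx 3) (EVar d) (EVar d.+2)) < N by rewrite vs3.
have qN3 : ev en3 tb (block_y (dy 2) (block_x (dx 3) (EVar d) (EVar d.+2))
    (EVar d.+4)) < N by rewrite vq3.
have e4 := Hk (isT : 0 < 4 <= 5) E3 rN3; have e1 := Hk (isT : 0 < 1 <= 5) E3 qN3.
rewrite vr3 in e4; rewrite vq3 in e1.
have [|| pkE pkS] := @ev_pair_key _ _ E3 (ekey (dx 4) (dy 4) (EVar d))
  (ekey (dx 1) (dy 1) (block_y (dy 2) (block_x (dx 3) (EVar d) (EVar d.+2)) (EVar d.+4))).
- by rewrite e4; apply: key_lt.
- by rewrite e1; apply: key_lt.
apply: dn_add => //; first exact: Hout E3.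
apply: ev_mulm; last first.
  by rewrite (hTb _ _ _ _ E3' erefl pkS) pkE e4 e1 hT.
apply: ev_mulm; last by rewrite (Hq E3 qN3) vq3.
apply: ev_mulm; last by rewrite (Hs E3 sN3) vs3.
apply: ev_mulm; last by rewrite (Hr E3 rN3) vr3.
apply: ev_mulm.
  by rewrite (ev_same E3 (kspec_shift_y B (Hy _)) rN3 sN3) ?vr3 ?vs3.
by rewrite (ev_same E3 (kspec_shift_x (Hx _)) sN3 qN3) ?vs3 ?vq3.
Qed.

Lemma dn_pairs_loop o :
  dn (pairs_loop_prog d t out dx dy wp wq ws wr wt) d t env tabs o =
  (oc == o) * C5 %[mod W].
Proof.
have t1 := leqnSn t; have t2 := leqW t1.
have [d3 t3 _ _ _] := B.
rewrite /pairs_loop_prog -(cycle5_pairs_loop YN gp gq gs gr gt u2 u5 vN).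
pose k4 := key L Y (u 4) (v 4); pose k1 := key L Y (u 1) (v 1).
pose G c x r s := (k4 r == x) *
  ((Y s %/ v 2 == c) * (Y r %/ v 3 == Y s %/ v 3) * gr r * gs s).
pose A c t0 p := (t0 %/ u 5 == p %/ u 5) * gt t0 * gp p *
  (\sum_(r < N) \sum_(s < N) (s %/ u 3 == r %/ u 3) * G c (k4 t0) r s) *
  (\sum_(q < N) (k1 q == k1 p) * ((Y q %/ v 2 == c) * gq q)).
apply: (@dn_for_out d t env tabs _ (N %/ v 2) _ o (oc == o)
  (fun c => \sum_(t0 < N) \sum_(p < N) (Y p %/ v 5 == Y t0 %/ v 5) * A c t0 p)).
- by apply: (vspec_quot (Hy _)).
- exact: quot_ltW.
move=> c cN; set en0 := upd _ d c.
have d0 : d <= d.+2 by rewrite ltnW.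
have E0 : ext d t env tabs en0 tabs by apply: ext_for.
have vc0 T tb : vspec d.+2 T en0 tb (EVar d) c.
  move=> env' tabs' E; apply: ev_outer_var E => //.
    by rewrite /en0 /upd eqxx.
  by apply: ltn_trans cN (quot_ltW _).
set body := PTab _ _.
have [TH [hTH ->]] := dn_tabulate (base_ext d0 (leqnn t) E0 B) body o
  (kspec_ext d0 (leqnn t) E0 (Hk (isT : 0 < 1 <= 5))) (kS 1)
  (wspec_restrict (kspec_ext d0 (leqnn t) E0 (kspec_shift_y B (Hy (isT : 0 < 2 <= 5))))
     (wspec_ext d0 (leqnn t) E0 Hq) (vc0 t tabs)).
rewrite /body; set c1 := PFor _ _; set c2 := PFor _ _.
set tb1 := upd tabs t TH.
have E1 : ext d t env tabs en0 tb1.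
  by apply: (ext_trans d0 (leqnn t) E0); apply: ext_tab.
rewrite dn_tab; set TF := fun x => _.
have hTF x : TF x = \sum_(r < N) \sum_(s < N) (s %/ u 3 == r %/ u 3) * G c x r s %[mod W].
  rewrite /TF modn_mod.
  apply: (@dn_for d.+2 t.+2 en0 tb1 (EVar 2) N _ x (fun r => \sum_(s < N)
    (s %/ u 3 == r %/ u 3) * G c x r s)); [exact: (base_N B E1)|exact: N_ltW|].
  move=> r rN; rewrite -(sum_blockX (G c x r) (uN _)) //.
  set en1 := upd _ d.+2 r.
  have E2' : ext d.+2 t.+2 en0 tb1 en1 tb1 by apply: ext_for.
  have E2 := ext_trans d0 t2 E1 E2'.
  apply: (@dn_for _ _ _ _ _ (u 3) _ _ (fun j => G c x r (r %/ u 3 * u 3 + j))).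
  - exact: (Hx _ E2).
  - exact: u_ltW.
  move=> j ju; set s := r %/ u 3 * u 3 + j; set en2 := upd _ d.+4 j.
  have sN : s < N by apply: block_lt (uN _) rN ju.
  have E3'' : ext d.+4 t.+2 en1 tb1 en2 tb1 by apply: ext_for.
  have d2 : d.+2 <= d.+4 by rewrite ltnW.
  have E3' : ext d.+2 t.+2 en0 tb1 en2 tb1.
    exact: (ext_trans d2 (leqnn _) E2' E3'').
  have E3 := ext_trans d0 t2 E1 E3'.
  have vr : ev en2 tb1 (EVar d.+2) = r.
    apply: (@ev_outer_var d.+4 t.+2 en1 tb1) E3'' => //.
    - by rewrite /en1 /upd eqxx.
    - exact: ltn_trans N_ltW.
  have vc : ev en2 tb1 (EVar d) = c by apply: (vc0 t.+2 tb1) E3'.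
  have vj : ev en2 tb1 (EVar d.+4) = j by apply: ev_loop_var (u_ltW _) ju.
  have vs : ev en2 tb1 (block_x (dx 3) (EVar d.+2) (EVar d.+4)) = s.
    by rewrite (ev_block_x E3) ?vr ?vj.
  have rN' : ev en2 tb1 (EVar d.+2) < N by rewrite vr.
  have sN' : ev en2 tb1 (block_x (dx 3) (EVar d.+2) (EVar d.+4)) < N by rewrite vs.
  have e4 := Hk (isT : 0 < 4 <= 5) E3 rN'; rewrite vr in e4.
  apply: dn_add; [exact: e4|exact: kS|].
  apply: ev_mulm; last by rewrite (Hs E3 sN') vs.
  apply: ev_mulm; last by rewrite (Hr E3 rN') vr.
  apply: ev_mulm.
    by rewrite ev_eqb vc (kspec_shift_y B (Hy _) E3 sN') // vs.
  by rewrite (ev_same E3 (kspec_shift_y B (Hy _)) rN' sN') // vr vs.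
set tb2 := upd tb1 t.+1 TF.
have E2' : ext d.+2 t.+1 en0 tb1 en0 tb2 by apply: ext_tab.
have E2 := ext_trans d0 t1 E1 E2'.
have hTFb env' tabs' e x : ext d.+2 t.+2 en0 tb2 env' tabs' -> ev env' tabs' e = x ->
    x < S -> ev env' tabs' (ETab t.+1 e) = TF x.
  by case=> _ h ex xS; rewrite /= ex modn_small // h // /tb2 /upd eqxx.
have hTHb env' tabs' e x : ext d.+2 t.+2 en0 tb2 env' tabs' -> ev env' tabs' e = x ->
    x < S -> ev env' tabs' (ETab t e) = TH x.
  case=> _ h ex xS; rewrite /= ex modn_small // h // /tb2 /upd ltn_eqF //.
  by rewrite /tb1 /upd eqxx.
apply: (@dn_for_out d.+2 t.+2 en0 tb2 (EVar 2) N _ o (oc == o) (fun t0 =>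
  \sum_(p < N) (Y p %/ v 5 == Y t0 %/ v 5) * A c t0 p)).
- exact: (base_N B E2).
- exact: N_ltW.
move=> t0 t0N; rewrite -(sum_blockY YN XY (A c t0) (vN _)) //.
set en1 := upd _ d.+2 t0.
have E3' : ext d.+2 t.+2 en0 tb2 en1 tb2 by apply: ext_for.
have E3 := ext_trans d0 t2 E2 E3'.
apply: (@dn_for_out _ _ _ _ _ (v 5) _ _ (oc == o)
  (fun j => A c t0 (X (Y t0 %/ v 5 * v 5 + j)))).
- exact: (Hy _ E3).
- exact: v_ltW.
move=> j jv; set p := X _; set en2 := upd _ d.+4 j.
have pN : p < N by apply: XN; apply: block_lt (vN _) (YN t0N) jv.
have E4'' : ext d.+4 t.+2 en1 tb2 en2 tb2 by apply: ext_for.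
have d2 : d.+2 <= d.+4 by rewrite ltnW.
have E4' : ext d.+2 t.+2 en0 tb2 en2 tb2.
  exact: (ext_trans d2 (leqnn _) E3' E4'').
have E4 := ext_trans d0 t2 E2 E4'.
have vt : ev en2 tb2 (EVar d.+2) = t0.
  apply: (@ev_outer_var d.+4 t.+2 en1 tb2) E4'' => //.
  - by rewrite /en1 /upd eqxx.
  - exact: ltn_trans N_ltW.
have vj : ev en2 tb2 (EVar d.+4) = j by apply: ev_loop_var (v_ltW _) jv.
have vp : ev en2 tb2 (block_y (dy 5) (EVar d.+2) (EVar d.+4)) = p.
  by rewrite (ev_block_y E4) ?vt ?vj.
have tN' : ev en2 tb2 (EVar d.+2) < N by rewrite vt.
have pN' : ev en2 tb2 (block_y (dy 5) (EVar d.+2) (EVar d.+4)) < N by rewrite vp.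
have e4 := Hk (isT : 0 < 4 <= 5) E4 tN'; rewrite vt in e4.
have e1 := Hk (isT : 0 < 1 <= 5) E4 pN'; rewrite vp in e1.
apply: dn_add => //; first exact: Hout E4.
apply: ev_mulm; last first.
  by rewrite (hTHb _ _ _ _ E4' e1) ?hTH ?kS.
apply: ev_mulm; last first.
  by rewrite (hTFb _ _ _ _ E4' e4) ?hTF ?kS.
apply: ev_mulm; last by rewrite (Hp E4 pN') vp.
apply: ev_mulm; last by rewrite (Ht E4 tN') vt.
by rewrite (ev_same E4 (kspec_shift_x (Hx _)) tN' pN') // vt vp.
Qed.

(** All four methods yield the same number, so the thresholds affect the running time only. *)
Lemma dn_cycle g g2 o :
  dn (cycle_prog d t out dx dy wp wq ws wr wt g g2) d t env tabs o =
  (oc == o) * C5 %[mod W].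
Proof.
have pIte e (x y : prog) : dn x d t env tabs o = (oc == o) * C5 %[mod W] ->
    dn y d t env tabs o = (oc == o) * C5 %[mod W] ->
    dn (PIte e x y) d t env tabs o = (oc == o) * C5 %[mod W].
  by move=> hx hy /=; case: ifP.
apply: (pIte); last exact: dn_xloop.
apply: (pIte); last exact: dn_yloop.
by apply: (pIte); [exact: dn_triples|exact: dn_pairs_loop].
Qed.

End CycleSemantics.
End Semantics.

(** * Reduction of pairs of ultrametrics *)

Notation label := 'I_5.

Section Ultrametric.
Variable d : label -> label -> nat.

(** Distinct labels may be as close as a label is to itself; this happens to the copies created by a
    merge. *)
Definition ultrametric : Prop :=
  [/\ forall i j, d i j = d j i, forall i j, d i i <= d i j &
      forall i j k, d i k <= maxn (d i j) (d j k)].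

Hypothesis U : ultrametric.

Lemma ultra_sym i j : d i j = d j i. Proof. by case: U. Qed.

Definition nearest (A : {set label}) (p q : label) : bool :=
  [forall z in A, (z != p) ==> (d p q <= d p z)].

Lemma nearestP (A : {set label}) p q :
  reflect (forall z, z \in A -> z != p -> d p q <= d p z) (nearest A p q).
Proof.
apply: (iffP forall_inP) => h z zA; first by move=> zp; exact: (implyP (h z zA)).
by apply/implyP; apply: h.
Qed.

(** For such a [p] this ultrametric leaves the choice of the partner entirely to the other one. *)
Definition isolated (A : {set label}) (p : label) : bool :=
  [forall q in A, (q != p) ==> nearest A p q].

Lemma not_isolated (A : {set label}) p : p \in A -> ~~ isolated A p ->
  exists2 q, (q \in A) && (q != p) & exists2 z, z \in A & d p q < d p z.
Proof.
move=> pA; rewrite negb_forall => /existsP[z].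
rewrite negb_imply => /andP[zA]; rewrite negb_imply => /andP[zp].
rewrite negb_forall => /existsP[q]; rewrite negb_imply => /andP[qA].
rewrite negb_imply -ltnNge => /andP[qp qz].
by exists q; [rewrite qA|exists z].
Qed.

(** Let [m] be the diameter of [A] and [C] the open ball of radius [m] around an end of a diameter.
    A point that is not isolated has a neighbour closer than some other point, hence closer than
    [m]. Points on different sides of the ball are at distance exactly [m], so that neighbour lies
    on the same side. *)
Lemma split_set (A : {set label}) (a0 : label) : a0 \in A ->
  (forall p, p \in A -> ~~ isolated A p) ->
  exists (m : nat) (C : {set label}),
  [/\ C \subset A, C != set0, A :\: C != set0,
      forall x y, x \in C -> y \in A :\: C -> d x y = m &
      (forall x, x \in C -> exists2 x', (x' \in C) && (x' != x) & d x x' < m) /\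
      (forall y, y \in A :\: C ->
         exists2 y', (y' \in A :\: C) && (y' != y) & d y y' < m)].
Proof.
move=> a0A noiso.
have aA : (a0, a0).1 \in A /\ (a0, a0).2 \in A by [].
pose P (xy : label * label) := (xy.1 \in A) && (xy.2 \in A).
have P0 : P (a0, a0) by rewrite /P a0A.
case: (@arg_maxnP _ (a0, a0) P (fun xy => d xy.1 xy.2) P0) => -[p0 y0].
case/andP=> /= p0A y0A max; pose m := d p0 y0.
have le_m x y : x \in A -> y \in A -> d x y <= m.
  by move=> xA yA; apply: (max (x, y)); rewrite /P xA.
have close x : x \in A -> exists2 q, (q \in A) && (q != x) & d x q < m.
  move=> xA; have [q qA [z zA qz]] := not_isolated xA (noiso x xA).
  by exists q => //; apply: leq_trans qz (le_m _ _ xA zA).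
have p0m : d p0 p0 < m.
  have [q /andP[qA _] h] := close p0 p0A.
  by apply: leq_ltn_trans h; case: U => _ + _; apply.
pose C := [set z in A | d p0 z < m].
have CA : C \subset A by apply/subsetP => z; rewrite inE => /andP[].
have inC z : (z \in C) = (z \in A) && (d p0 z < m) by rewrite inE.
have cross x y : x \in C -> y \in A :\: C -> d x y = m.
  rewrite !inE => /andP[xA xm] /andP[+ yA]; rewrite yA /= -leqNgt => ym.
  apply/eqP; rewrite eqn_leq le_m //=; case: U => _ _ h.
  have := leq_trans ym (h p0 x y); rewrite leq_max leqNgt xm /=.
  by rewrite -/m.
exists m, C; split=> //.
- by apply/set0Pn; exists p0; rewrite inC p0A.
- by apply/set0Pn; exists y0; rewrite in_setD inC y0A ltnn.
split=> [x xC|y yD].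
  have xA := subsetP CA _ xC; have [q /andP[qA qx] xq] := close x xA.
  exists q => //; rewrite qx inC qA /= andbT.
  rewrite inC xA /= in xC; case: U => _ _ h.
  by apply: leq_ltn_trans (h p0 x q) _; rewrite gtn_max xC.
have yA : y \in A by move: yD; rewrite inE => /andP[].
have [q /andP[qA qy] yq] := close y yA.
exists q => //; rewrite qy in_setD qA !andbT; apply/negP => qC.
by move: yq; rewrite ultra_sym (cross _ _ qC yD) ltnn.
Qed.

End Ultrametric.

(** * Four or five points, none of them isolated *)

Section NormalForms.
Variable d : label -> label -> nat.
Hypothesis U : ultrametric d.

(** The tree of two pairs that join at height [m]. *)
Definition form22 (m : nat) (a b c e : label) : Prop :=
  [/\ d a b < m, d c e < m, d a c = m, d a e = m & d b c = m /\ d b e = m].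

(** The tree of a pair and a triple that join at height [m]; inside the triple, [f] joins not before
    [c] and [e] do. *)
Definition form23 (m : nat) (a b c e f : label) : Prop :=
  [/\ form22 m a b c e, d a f = m, d b f = m, d c e <= d c f &
      d c f = d e f /\ d c f < m].

Lemma card2_partner (D : {set label}) m : #|D| = 2 ->
  (forall x, x \in D -> exists2 x', (x' \in D) && (x' != x) & d x x' < m) ->
  exists a b, [/\ D = [set a; b], a != b & d a b < m].
Proof.
move=> /eqP/cards2P[a [b [ab ->]]] h; exists a, b; split=> //.
have [|x' + +] := h a; first by rewrite !inE eqxx.
by rewrite !inE => /andP[/orP[/eqP->|/eqP->]]; rewrite ?eqxx.
Qed.

(** In an ultrametric triangle the two largest distances agree. With [a], [b] a closest pair, the
    partner of [c] puts the common distance below [m]. *)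
Lemma card3_partner (D : {set label}) m : #|D| = 3 ->
  (forall x, x \in D -> exists2 x', (x' \in D) && (x' != x) & d x x' < m) ->
  exists a b c, [/\ D = [set a; b; c], uniq [:: a; b; c], d a b <= d a c &
    d a c = d b c /\ d a c < m].
Proof.
move=> D3 h; have [x xD] : exists x, x \in D by apply/set0Pn; rewrite -card_gt0 D3.
have /cards2P[y [z [yz Dyz]]] : #|D :\ x| == 2.
  by apply/eqP; move: D3; rewrite (cardsD1 x) xD add1n => -[].
have DE : D = [set x; y; z] by rewrite -setUA -Dyz setD1K.
have [yx zx] : y != x /\ z != x.
  have /subsetP s : [set y; z] \subset D :\ x by rewrite Dyz.
  by split; [have := s y|have := s z]; rewrite !inE eqxx ?orbT => /(_ isT)/andP[].
have sym := ultra_sym U; case: (U) => _ _ ul.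
have main a b c : D = [set a; b; c] -> uniq [:: a; b; c] ->
    d a b <= d a c -> d a b <= d b c ->
    d a b <= d a c /\ d a c = d b c /\ d a c < m.
  move=> Dabc u ab_ac ab_bc.
  have e : d a c = d b c.
    have := ul a b c; have := ul b a c; rewrite (sym b a); lia.
  split=> //; split=> //; have [|c' + +] := h c; first by rewrite Dabc !inE eqxx orbT.
  rewrite Dabc !inE => /andP[/orP[/orP[]|] /eqP -> ne]; rewrite ?eqxx // in ne *.
    by rewrite sym.
  by rewrite e sym.
have Dxzy : D = [set x; z; y] by rewrite DE setUAC.
have Dyzx : D = [set y; z; x] by rewrite DE -setUA setUC.
have u1 : uniq [:: x; y; z] by rewrite /= !inE negb_or yz ![x == _]eq_sym yx zx.
have u2 : uniq [:: x; z; y].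
  by rewrite /= !inE negb_or [z == _]eq_sym yz ![x == _]eq_sym yx zx.
have u3 : uniq [:: y; z; x] by rewrite /= !inE negb_or yz yx zx.
have [m1|m1] := leqP (d x y) (d x z); have [m2|m2] := leqP (d x y) (d y z);
  have [m3|m3] := leqP (d x z) (d y z).
- by have [? [? ?]] := main _ _ _ DE u1 m1 m2; exists x, y, z.
- by have [? [? ?]] := main _ _ _ DE u1 m1 m2; exists x, y, z.
- by have := leq_trans m1 m3; rewrite leqNgt m2.
- have [||? [? ?]] := main _ _ _ Dyzx u3; last by exists y, z, x.
    by rewrite (sym y x) ltnW.
  by rewrite (sym z x) ltnW.
- have [||? [? ?]] := main _ _ _ Dxzy u2; last by exists x, z, y.
    by rewrite ltnW.
  by rewrite (sym z y).
- by have := leq_trans m2 (ltnW m3); rewrite leqNgt m1.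
- have [||? [? ?]] := main _ _ _ Dxzy u2; last by exists x, z, y.
    by rewrite ltnW.
  by rewrite (sym z y).
- have [||? [? ?]] := main _ _ _ Dyzx u3; last by exists y, z, x.
    by rewrite (sym y x) ltnW.
  by rewrite (sym z x) ltnW.
Qed.

Lemma card_partner (D : {set label}) m : D != set0 ->
  (forall x, x \in D -> exists2 x', (x' \in D) && (x' != x) & d x x' < m) ->
  1 < #|D|.
Proof.
case/set0Pn=> x xD /(_ x xD)[y /andP[yD yx] _].
by apply/card_gt1P; exists x, y; split=> //; rewrite eq_sym.
Qed.

Lemma set4_form (A : {set label}) : #|A| = 4 ->
  (forall p, p \in A -> ~~ isolated d A p) ->
  exists m a b c e, [/\ A = [set a; b; c; e], uniq [:: a; b; c; e] & form22 m a b c e].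
Proof.
move=> A4 noiso; have [a0 a0A] : exists a0, a0 \in A.
  by apply/set0Pn; rewrite -card_gt0 A4.
have [m [C [CA C0 D0 cross [hC hD]]]] := split_set U a0A noiso.
have C2 := card_partner C0 hC; have D2 := card_partner D0 hD.
have CD : #|C| + #|A :\: C| = 4 by rewrite cardsD (setIidPr CA) subnKC ?subset_leq_card.
have C2' : #|C| = 2 by lia.
have D2' : #|A :\: C| = 2 by lia.
have [a [b [Cab ab abm]]] := card2_partner C2' hC.
have [c [e [Dce ce cem]]] := card2_partner D2' hD.
have cr x y : x \in [set a; b] -> y \in [set c; e] -> d x y = m.
  by rewrite -Cab -Dce; apply: cross.
have dis x y : x \in [set a; b] -> y \in [set c; e] -> x != y.
  by rewrite -Cab -Dce => xC; apply: contraTneq => <-; rewrite inE xC.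
exists m, a, b, c, e; split.
- by rewrite -setUA -Cab -Dce -{1}(setID A C) (setIidPr CA).
- by rewrite /= !inE !negb_or ab ce !dis ?inE ?eqxx ?orbT.
- by split=> //; rewrite ?cr ?inE ?eqxx ?orbT.
Qed.

(** Each point has a partner on its own side of the split, so both sides have at least two points
    and the split is 2 + 3. *)
Lemma set5_form :
  (forall p, ~~ isolated d setT p) ->
  exists m a b c e f, uniq [:: a; b; c; e; f] /\ form23 m a b c e f.
Proof.
move=> noiso.
have [m [C [CA C0 D0 cross [hC hD]]]] := split_set U (in_setT ord0) (fun p _ => noiso p).
have C2 := card_partner C0 hC; have D2 := card_partner D0 hD.
have CD : #|C| + #|[set: label] :\: C| = 5.
  by rewrite setTD cardsC card_ord.
have main (P Q : {set label}) : #|P| = 2 -> #|Q| = 3 ->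
    (forall x, x \in P -> x \notin Q) ->
    (forall x y, x \in P -> y \in Q -> d x y = m) ->
    (forall x, x \in P -> exists2 x', (x' \in P) && (x' != x) & d x x' < m) ->
    (forall x, x \in Q -> exists2 x', (x' \in Q) && (x' != x) & d x x' < m) ->
    exists m a b c e f, uniq [:: a; b; c; e; f] /\ form23 m a b c e f.
  move=> P2 Q3 dis cr hP hQ.
  have [a [b [Pab ab abm]]] := card2_partner P2 hP.
  have [c [e [f [Qcef u ce_cf [cf_ef cfm]]]]] := card3_partner Q3 hQ.
  have dis' x y : x \in [set a; b] -> y \in [set c; e; f] -> x != y.
    by rewrite -Pab -Qcef => xC; apply: contraTneq => <-; apply: dis.
  have cr' x y : x \in [set a; b] -> y \in [set c; e; f] -> d x y = m.
    by rewrite -Pab -Qcef; apply: cr.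
  exists m, a, b, c, e, f; split.
    move: u; rewrite /= !inE !negb_or ab => /and3P[/andP[-> ->] -> _].
    by rewrite !dis' ?inE ?eqxx ?orbT.
  have cem : d c e < m by apply: leq_ltn_trans cfm.
  by split=> //; [split=> //|..]; rewrite ?cr' ?inE ?eqxx ?orbT.
have sC x : x \in C -> x \notin [set: label] :\: C by rewrite inE => ->.
have sD x : x \in [set: label] :\: C -> x \notin C by rewrite inE => /andP[].
have [C3|C3] := leqP #|C| 2.
  have e2 : #|C| = 2 by lia.
  have e3 : #|[set: label] :\: C| = 3 by lia.
  exact: (main _ _ e2 e3 sC cross hC hD).
have D2' : 1 < #|[set: label] :\: C| by exact: D2.
have e3 : #|C| = 3 by lia.
have e2 : #|[set: label] :\: C| = 2 by lia.
apply: (main _ _ e2 e3 sD _ hD hC) => x y xD yC.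
by rewrite (ultra_sym U) cross.
Qed.

End NormalForms.

(** * Merge plans and the test of a cycle *)

Definition matrix5 := label -> label -> nat.

Definition repl (p u i : label) : label := if i == p then u else i.

Definition merge_mx (p u : label) (M : matrix5) : matrix5 :=
  fun i j => M (repl p u i) (repl p u j).

Definition short_arc (M : matrix5) (a b c : label) : bool :=
  (M a b <= M a c) && (M b c <= M a c).

Definition long_arc (M : matrix5) (a c e f : label) : bool :=
  [&& M c e <= M a c, M e f <= M a c & M f a <= M a c].

(** Here [a] and [c] are two steps apart on the cycle a, b, c, e, f. Since blocks are nested, the
    constraint of the chord follows once all edges of one of the two arcs have blocks no larger than
    its own. *)
Definition chord (M : matrix5) (a b c e f : label) : bool :=
  short_arc M a b c || long_arc M a c e f.

Definition max_edge (M : matrix5) (m : nat) (a b c e f : label) : bool :=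
  [&& M a b <= m, M b c <= m, M c e <= m, M e f <= m & M f a <= m].

Definition cyc := (label * label * label * label * label)%type.

Definition cycle_mx (M : matrix5) (g : cyc) : bool :=
  let: (p, q, s, r, t) := g in
  [&& chord M p q s r t, chord M q s r t p, chord M s r t p q,
      chord M r t p q s & chord M t p q s r].

(** Boolean, since the program evaluates this test at run time. The last three conditions are the
    coarseness assumptions of the counting methods for cycles. *)
Definition final_ok (LX LY : matrix5) (g : cyc) : bool :=
  let: (p, q, s, r, t) := g in
  [&& cycle_mx LX g, cycle_mx LY g, max_edge LX (LX q s) p q s r t,
      max_edge LX (LX t p) p q s r t & max_edge LY (LY s r) p q s r t].

Definition uniq_cyc (g : cyc) : bool :=
  let: (p, q, s, r, t) := g in uniq [:: p; q; s; r; t].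

(** A move (p, q, u) sums [p] into the weight of [q] and reuses the label [p] for a copy of [u].
    Keeping five labels gives all stages of a plan the same shape. *)
Definition move := (label * label * label)%type.

Fixpoint plan_ok (ms : seq move) (g : cyc) (LX LY : matrix5) : bool :=
  if ms is (p, q, u) :: ms' then
    [&& nearest LX setT p q, nearest LY setT p q &
        plan_ok ms' g (merge_mx p u LX) (merge_mx p u LY)]
  else final_ok LX LY g.

Definition wf_moves (ms : seq move) : bool :=
  all (fun m : move => (m.1.1 != m.1.2) && (m.1.1 != m.2)) ms.

Section Plan.
Variables LX LY : matrix5.
Hypotheses (UX : ultrametric LX) (UY : ultrametric LY).

Definition removable (A : {set label}) (p q : label) : bool :=
  [&& p \in A, q \in A, p != q, nearest LX A p q & nearest LY A p q].

Lemma isolated_nearest (d : matrix5) (A : {set label}) p : 1 < #|A| -> p \in A ->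
  exists2 q, (q \in A) && (p != q) & nearest d A p q.
Proof.
move=> A1 pA; have [q0 q0A] : exists q0, (q0 \in A) && (p != q0).
  have [x [y [xA yA xy]]] := card_gt1P A1.
  have [->|px] := eqVneq p x; first by exists y; rewrite yA xy.
  by exists x; rewrite xA px.
case: (@arg_minnP _ q0 (fun q => (q \in A) && (p != q)) (d p) q0A) => q qA min.
exists q => //; apply/nearestP => z zA zp.
by apply: min; rewrite zA eq_sym.
Qed.

(** A nearest point of [p] in the other ultrametric is nearest in both. *)
Lemma isolated_removable (A : {set label}) p : 1 < #|A| -> p \in A ->
  isolated LX A p || isolated LY A p -> exists p' q', removable A p' q'.
Proof.
move=> A1 pA /orP[] iso.
  have [q /andP[qA pq] h] := isolated_nearest LY A1 pA.
  exists p, q; rewrite /removable pA qA pq h andbT /=.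
  by have /forall_inP/(_ q qA) := iso; rewrite eq_sym pq.
have [q /andP[qA pq] h] := isolated_nearest LX A1 pA.
exists p, q; rewrite /removable pA qA pq h /=.
by have /forall_inP/(_ q qA) := iso; rewrite eq_sym pq.
Qed.

(** Without an isolated point, [LX] would split [A] into two sides of at least two points each. *)
Lemma removable_small (A : {set label}) : 1 < #|A| -> #|A| <= 3 ->
  exists p q, removable A p q.
Proof.
move=> A1 A3; have [/exists_inP[p pA iso]|] := boolP [exists p in A, isolated LX A p].
  by apply: (isolated_removable A1 pA); rewrite iso.
rewrite negb_exists_in => /forall_inP noiso.
have [x [y [xA _ _]]] := card_gt1P A1.
have [m [C [CA C0 D0 _ [hC hD]]]] := split_set UX xA noiso.
have C2 := card_partner C0 hC; have D2 := card_partner D0 hD.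
have := cardsID C A; rewrite (setIidPr CA); lia.
Qed.

Lemma stuck_not_isolated (A : {set label}) : 1 < #|A| ->
  (forall p q, ~~ removable A p q) ->
  (forall p, p \in A -> ~~ isolated LX A p) /\
  (forall p, p \in A -> ~~ isolated LY A p).
Proof.
by move=> A1 stuck; split=> p pA; apply/negP => iso;
  have [|p' [q' h]] := isolated_removable A1 pA;
  rewrite ?iso ?orbT //; have := stuck p' q'; rewrite h.
Qed.

Lemma uniq5_mem (l : seq label) z : uniq l -> size l = 5 -> z \in l.
Proof.
move=> u l5; apply: contraT => zl.
have : size (z :: l) <= size (enum label).
  by apply: uniq_leq_size => [|x _]; rewrite ?mem_enum //= zl.
by rewrite size_enum_ord /= l5.
Qed.

Lemma form23_12 (d : matrix5) m a b c e f : ultrametric d ->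
  form23 d m a b c e f -> form23 d m b a c e f.
Proof.
move=> U [[h1 h2 h3 h4 [h5 h6]] h7 h8 h9 h10]; split=> //; split=> //.
by rewrite (ultra_sym U).
Qed.

Lemma form23_34 (d : matrix5) m a b c e f : ultrametric d ->
  form23 d m a b c e f -> form23 d m a b e c f.
Proof.
move=> U [[h1 h2 h3 h4 [h5 h6]] h7 h8 h9 [h10 h11]]; split=> //.
- by split=> //; rewrite (ultra_sym U).
- by rewrite (ultra_sym U e c) -h10.
- by rewrite -h10.
Qed.

Lemma form23_nearest (d : matrix5) m a b c e f : ultrametric d ->
  uniq [:: a; b; c; e; f] -> form23 d m a b c e f ->
  [/\ nearest d setT a b, nearest d setT b a, nearest d setT c e,
      nearest d setT e c & nearest d setT f c /\ nearest d setT f e].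
Proof.
move=> U u [[h1 h2 h3 h4 [h5 h6]] h7 h8 h9 [h10 h11]].
have sym := ultra_sym U.
have all5 z := uniq5_mem z u erefl.
have e1 := sym b a; have e2 := sym e c; have e3 := sym f c; have e4 := sym f e.
have e5 := sym c a; have e6 := sym c b; have e7 := sym e a; have e8 := sym e b.
have e9 := sym f a; have e10 := sym f b.
have N x y : (forall z, z \in [:: a; b; c; e; f] -> z != x -> d x y <= d x z) ->
    nearest d setT x y.
  by move=> h; apply/nearestP => z _; apply: h; apply: all5.
split; [..|split]; apply: N => z; rewrite !inE;
  do 4?[case/orP]; move/eqP->; rewrite ?eqxx // => _; lia.
Qed.

(** The closest pairs pq and rs of [LX] and qs and tp of [LY] form the cycle together with rt. The
    edges qs and tp cross the top split of [LX], and sr crosses that of [LY], so they are the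
    longest. *)
Lemma bad_final m m' p q r s t : form23 LX m p q r s t -> form23 LY m' q s t p r ->
  final_ok LX LY (p, q, s, r, t).
Proof.
move=> [[h1 h2 h3 h4 [h5 h6]] h7 h8 h9 [h10 h11]].
move=> [[k1 k2 k3 k4 [k5 k6]] k7 k8 k9 [k10 k11]].
have sx := ultra_sym UX; have sy := ultra_sym UY.
have a1 := sx q p; have a2 := sx s p; have a3 := sx r p; have a4 := sx t p.
have a5 := sx s q; have a6 := sx r q; have a7 := sx t q; have a8 := sx r s.
have a9 := sx t s; have a10 := sx t r.
have b1 := sy q p; have b2 := sy s p; have b3 := sy r p; have b4 := sy t p.
have b5 := sy s q; have b6 := sy r q; have b7 := sy t q; have b8 := sy r s.
have b9 := sy t s; have b10 := sy t r.
rewrite /final_ok /cycle_mx /chord /short_arc /long_arc /max_edge.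
lia.
Qed.

End Plan.

(** * Configurations without a common nearest pair *)

Section PlanExists.
Variables LX LY : matrix5.
Hypotheses (UX : ultrametric LX) (UY : ultrametric LY).

Lemma form22_12 (d : matrix5) m a b c e : ultrametric d ->
  form22 d m a b c e -> form22 d m b a c e.
Proof. by move=> U [h1 h2 h3 h4 [h5 h6]]; split=> //; rewrite (ultra_sym U). Qed.

Lemma form22_34 (d : matrix5) m a b c e : ultrametric d ->
  form22 d m a b c e -> form22 d m a b e c.
Proof. by move=> U [h1 h2 h3 h4 [h5 h6]]; split=> //; rewrite (ultra_sym U). Qed.

Lemma form22_swap (d : matrix5) m a b c e : ultrametric d ->
  form22 d m a b c e -> form22 d m c e a b.
Proof.
by move=> U [h1 h2 h3 h4 [h5 h6]]; split; rewrite // !(ultra_sym U c, ultra_sym U e).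
Qed.

Lemma form22_nearest (d : matrix5) m a b c e : ultrametric d ->
  form22 d m a b c e -> nearest d [set a; b; c; e] a b.
Proof.
move=> U [h1 h2 h3 h4 [h5 h6]]; apply/nearestP => z.
by rewrite !inE -!orbA => /or4P[] /eqP -> za; rewrite ?eqxx // in za *; lia.
Qed.

(** Two different pairings of four points make a 4-cycle p, q, s, r. The free label [t], as a copy
    of [r], turns it into a 5-cycle with a trivial edge rt. *)
Lemma square_final m m' p q s r t : uniq [:: p; q; s; r; t] ->
  form22 LX m p q r s -> form22 LY m' r p q s ->
  final_ok (merge_mx t r LX) (merge_mx t r LY) (p, q, s, r, t).
Proof.
move=> u [h1 h2 h3 h4 [h5 h6]] [k1 k2 k3 k4 [k5 k6]].
have sx := ultra_sym UX; have sy := ultra_sym UY.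
have [_ dx _] := UX; have [_ dy _] := UY.
have a1 := sx q p; have a2 := sx s p; have a3 := sx r p.
have a5 := sx s q; have a6 := sx r q; have a8 := sx r s.
have b1 := sy q p; have b2 := sy s p; have b3 := sy r p.
have b5 := sy s q; have b6 := sy r q; have b8 := sy r s.
have c1 := dx r p; have c2 := dy r p; have c3 := dx r s; have c4 := dy r s.
have c5 := dx r q; have c6 := dy r q.
move: u; rewrite /= !inE !negb_or -!andbA.
case/and5P=> _ _ _ pt /and5P[_ _ qt _ /andP[st /andP[rt _]]].
rewrite /final_ok /cycle_mx /chord /short_arc /long_arc /max_edge /merge_mx /repl.
rewrite (negbTE pt) (negbTE qt) (negbTE st) (negbTE rt) eqxx.
lia.
Qed.

Ltac prune := try (exfalso; match goal with
  | h : nearest ?d ?A ?a ?b = false, y : is_true (nearest ?d ?A ?a ?b) |- _ =>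
      by rewrite h in y
  | u : is_true (uniq _) |- _ => by move: u; rewrite /= !inE ?eqxx ?orbT ?andbF
  end).

Ltac finish F F' := solve [do 5!eexists; split;
  [|do 2!eexists; split; [exact: F|exact: F']]; do ![apply/andP; split] => //].

(** Both ultrametrics consist of a pair and a triple, and an ordered pair that is nearest in one is
    not nearest in the other. Up to exchanging the members of closest pairs this leaves one relative
    position, that of [bad_final]. *)
Lemma stuck5_final : (forall p q, ~~ removable LX LY setT p q) ->
  exists g, uniq_cyc g && final_ok LX LY g.
Proof.
move=> stuck; have T1 : 1 < #|[set: label]| by rewrite cardsT card_ord.
have [nX nY] := stuck_not_isolated T1 stuck.
have [m [p [q [r [s [t [u F]]]]]]] := set5_form UX (fun p => nX p (in_setT p)).
have [m' [p' [q' [r' [s' [t' [u' F']]]]]]] := set5_form UY (fun p => nY p (in_setT p)).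
have [x1 x2 x3 x4 [x5 x6]] := form23_nearest UX u F.
have [y1 y2 y3 y4 [y5 y6]] := form23_nearest UY u' F'.
have conflict x y : x != y -> nearest LX setT x y -> nearest LY setT x y = false.
  move=> xy hx; apply: negbTE; apply/negP => hy.
  by have := stuck x y; rewrite /removable !in_setT xy hx hy.
have all5 z := uniq5_mem z u erefl.
have : [/\ p != q, p != r, p != s & p != t] /\
    [/\ q != r, q != s & q != t] /\ [/\ r != s, r != t & s != t].
  by move: u; rewrite /= !inE !negb_or => /and5P[/and4P[? ? ? ?] /and3P[? ? ?] /andP[? ?] ? _].
case=> -[pq pr ps pt] [[qr qs qt] [rs rt st]].
have sym (x y : label) : x != y -> y != x by rewrite eq_sym.
have qp := sym _ _ pq; have rp := sym _ _ pr; have sp := sym _ _ ps.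
have tp := sym _ _ pt; have rq := sym _ _ qr; have sq := sym _ _ qs.
have tq := sym _ _ qt; have sr := sym _ _ rs; have tr := sym _ _ rt.
have ts := sym _ _ st.
have {}x1 := conflict _ _ pq x1; have {}x2 := conflict _ _ qp x2.
have {}x3 := conflict _ _ rs x3; have {}x4 := conflict _ _ sr x4.
have {}x5 := conflict _ _ tr x5; have {}x6 := conflict _ _ ts x6.
suff [a [b [c [e [f [ug [m1 [m2 [G G']]]]]]]]] : exists a b c e f,
    [&& a != b, a != c, a != e & a != f] && [&& b != c, b != e & b != f] &&
    [&& e != c, e != f & c != f] /\ exists m1 m2,
    form23 LX m1 a b c e f /\ form23 LY m2 b e f a c.
  exists (a, b, e, c, f); rewrite (bad_final UX UY G G') andbT /uniq_cyc.
  move: ug; rewrite /= !inE !negb_or => /andP[/andP[/and4P[-> -> -> ->]]].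
  by move=> /and3P[-> -> ->] /and3P[-> -> ->].
have F1 := form23_12 UX F; have F2 := form23_34 UX F; have F3 := form23_34 UX F1.
have F1' := form23_12 UY F'; have F2' := form23_34 UY F'; have F3' := form23_34 UY F1'.
move: (all5 t') (all5 r') (all5 s') (all5 p') (all5 q'); rewrite !inE.
move=> T' R' S' P' Q'.
(* The points of the second form are located among those of the first; [prune] discards the cases
   where two points coincide or a pair is nearest in both ultrametrics. *)
case/or4P: T' => [/eqP e|/eqP e|/eqP e|/orP[] /eqP e]; subst t'; prune;
case/or4P: R' => [/eqP e|/eqP e|/eqP e|/orP[] /eqP e]; subst r'; prune;
case/or4P: S' => [/eqP e|/eqP e|/eqP e|/orP[] /eqP e]; subst s'; prune;
case/or4P: P' => [/eqP e|/eqP e|/eqP e|/orP[] /eqP e]; subst p'; prune;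
case/or4P: Q' => [/eqP e|/eqP e|/eqP e|/orP[] /eqP e]; subst q'; prune.
(* What remains matches the goal after exchanging the first two or the next two points of either
   form. *)
all: first [finish F F' | finish F F1' | finish F F2' | finish F F3'
  | finish F1 F' | finish F1 F1' | finish F1 F2' | finish F1 F3'
  | finish F2 F' | finish F2 F1' | finish F2 F2' | finish F2 F3'
  | finish F3 F' | finish F3 F1' | finish F3 F2' | finish F3 F3'].
Qed.

Ltac finish4 F F' := solve [do 4!eexists; split;
  [|do 2!eexists; split; [exact: F|exact: F']]; do ![apply/andP; split] => //].

(** Each ultrametric pairs the four points. The pairings share no pair, as it would be nearest in
    both, so their union is a 4-cycle. *)
Lemma stuck4_final (A : {set label}) t : A = setT :\ t ->
  (forall p q, ~~ removable LX LY A p q) ->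
  exists g r, [&& uniq_cyc g, t != r &
    final_ok (merge_mx t r LX) (merge_mx t r LY) g].
Proof.
move=> At stuck.
have A4 : #|A| = 4.
  have := cardsD1 t [set: label]; rewrite -At in_setT cardsT card_ord.
  by rewrite add1n => -[].
have A1 : 1 < #|A| by rewrite A4.
have [nX nY] := stuck_not_isolated A1 stuck.
have [m [p [q [r [s [Apq u F]]]]]] := set4_form UX A4 nX.
have [m' [p' [q' [r' [s' [Apq' u' F']]]]]] := set4_form UY A4 nY.
have conflict x y : x \in A -> y \in A -> x != y -> nearest LX A x y ->
    nearest LY A x y = false.
  move=> xA yA xy hx; apply: negbTE; apply/negP => hy.
  by have := stuck x y; rewrite /removable xA yA xy hx hy.
have tA : t \notin A by rewrite At !inE eqxx.
have [pA qA rA sA] : [/\ p \in A, q \in A, r \in A & s \in A].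
  by rewrite Apq !inE !eqxx !orbT.
have nt x : x \in A -> x != t by apply: contraTneq => ->.
have [pt qt rt st] := And4 (nt _ pA) (nt _ qA) (nt _ rA) (nt _ sA).
have : [/\ p != q, p != r & p != s] /\ [/\ q != r, q != s & r != s].
  by move: u; rewrite /= !inE !negb_or => /and4P[/and3P[? ? ?] /andP[? ?] ? _].
case=> -[pq pr ps] [qr qs rs].
have sym (x y : label) : x != y -> y != x by rewrite eq_sym.
have qp := sym _ _ pq; have rp := sym _ _ pr; have sp := sym _ _ ps.
have rq := sym _ _ qr; have sq := sym _ _ qs; have sr := sym _ _ rs.
have near2 (d : matrix5) k a b c e : ultrametric d -> A = [set a; b; c; e] ->
    form22 d k a b c e ->
    [/\ nearest d A a b, nearest d A b a, nearest d A c e & nearest d A e c].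
  move=> U AE G; split.
  - by rewrite AE; apply: form22_nearest G.
  - by rewrite AE [[set a; b]]setUC; apply: form22_nearest (form22_12 U G).
  - rewrite AE -setUA setUC setUA.
    by apply: form22_nearest (form22_swap U G).
  - rewrite AE -setUA setUC setUA [[set c; e]]setUC.
    by apply: form22_nearest (form22_12 U (form22_swap U G)).
have [x1 x2 x3 x4] := near2 _ _ _ _ _ _ UX Apq F.
have [y1 y2 y3 y4] := near2 _ _ _ _ _ _ UY Apq' F'.
have {}x1 := conflict _ _ pA qA pq x1; have {}x2 := conflict _ _ qA pA qp x2.
have {}x3 := conflict _ _ rA sA rs x3; have {}x4 := conflict _ _ sA rA sr x4.
suff [a [b [c [e [ug [m1 [m2 [G G']]]]]]]] : exists a b c e,
    [&& a != b, a != c, a != e & a != t] && [&& b != c, b != e & b != t] &&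
    [&& e != c, e != t & c != t] /\ exists m1 m2,
    form22 LX m1 a b c e /\ form22 LY m2 c a b e.
  have uc : uniq [:: a; b; e; c; t].
    move: ug; rewrite /= !inE !negb_or => /andP[/andP[/and4P[-> -> -> ->]]].
    by move=> /and3P[-> -> ->] /and3P[-> -> ->].
  exists (a, b, e, c, t), c; rewrite /uniq_cyc uc (square_final uc G G') andbT /=.
  by move: ug => /andP[_ /and3P[_ _]]; rewrite eq_sym.
have G1 := form22_12 UX F; have G2 := form22_34 UX F; have G3 := form22_34 UX G1.
have G4 := form22_swap UX F; have G5 := form22_swap UX G1.
have G6 := form22_swap UX G2; have G7 := form22_swap UX G3.
have F'' := form22_34 UY F'.
have [pA' qA' rA' sA'] : [/\ p' \in A, q' \in A, r' \in A & s' \in A].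
  by rewrite Apq' !inE !eqxx !orbT.
move: pA' qA' rA' sA'; rewrite Apq !inE -!orbA => P' Q' R' S'.
case/or4P: P' => /eqP e; subst p'; prune;
case/or4P: Q' => /eqP e; subst q'; prune;
case/or4P: R' => /eqP e; subst r'; prune;
case/or4P: S' => /eqP e; subst s'; prune.
all: first [finish4 F F' | finish4 G1 F' | finish4 G2 F' | finish4 G3 F'
  | finish4 G4 F' | finish4 G5 F' | finish4 G6 F' | finish4 G7 F'
  | finish4 F F'' | finish4 G1 F'' | finish4 G2 F'' | finish4 G3 F''
  | finish4 G4 F'' | finish4 G5 F'' | finish4 G6 F'' | finish4 G7 F''].
Qed.

End PlanExists.

(** * Existence of a plan *)

Section PlanExists.
Variables LX LY : matrix5.
Hypotheses (UX : ultrametric LX) (UY : ultrametric LY).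

(* [M'] arises from [M] by merging all labels outside [A] into [z]. *)
Definition collapsed (A : {set label}) (z : label) (M M' : matrix5) : Prop :=
  exists f : label -> label, [/\ forall i, i \in A -> f i = i,
    forall i, i \notin A -> f i = z & forall i j, M' i j = M (f i) (f j)].

(** All copies are placed at one label [z] that survives every move; it is existentially bound
    because the last stage of the plan determines it. *)
Definition collapsible (A : {set label}) (g : cyc) : Prop :=
  exists (ms : seq move) (z : label), [/\ z \in A, size ms < #|A|, wf_moves ms &
    forall LX' LY', collapsed A z LX LX' -> collapsed A z LY LY' ->
    plan_ok ms g LX' LY'].

(** The labels outside [A] sit at [z], a point of [A] other than [p], so they offer [p] nothing
    closer than [q]. *)
Lemma nearest_collapsed (A : {set label}) z M M' p q : z \in A -> z != p -> p \in A -> q \in A ->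
  nearest M A p q -> collapsed A z M M' -> nearest M' setT p q.
Proof.
move=> zA zp pA qA /nearestP h [f [fA fz M'E]]; apply/nearestP => x _ xp.
rewrite !M'E (fA p pA) (fA q qA); have [xA|xA] := boolP (x \in A).
  by rewrite (fA x xA) h.
by rewrite fz // h.
Qed.

Lemma collapsed_merge (A : {set label}) z p M M' : z \in A -> z != p -> p \in A ->
  collapsed A z M M' -> collapsed (A :\ p) z M (merge_mx p z M').
Proof.
move=> zA zp pA [f [fA fz M'E]]; exists (fun i => f (repl p z i)).
split=> [i|i|i j]; rewrite /repl.
- by rewrite !inE => /andP[ip iA]; rewrite (negbTE ip) fA.
- rewrite !inE negb_and negbK; case: eqP => [_ _|_ /= iA]; [exact: fA|exact: fz].
- exact: M'E.
Qed.

Lemma collapsible_step (A : {set label}) g p q : removable LX LY A p q ->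
  collapsible (A :\ p) g -> collapsible A g.
Proof.
case/and5P=> pA qA pq nX nY [ms [z [zA sz wms h]]].
have [zp zA'] : z != p /\ z \in A by move: zA; rewrite !inE => /andP.
exists ((p, q, z) :: ms), z; split=> //=.
- by rewrite (cardsD1 p) pA add1n ltnS.
- by rewrite pq eq_sym zp.
move=> LX' LY' cX cY.
rewrite (nearest_collapsed zA' zp pA qA nX cX) (nearest_collapsed zA' zp pA qA nY cY).
by apply: h; apply: collapsed_merge.
Qed.

(** All labels are copies of [z], so all distances coincide and any cycle passes the test. *)
Lemma collapsible1 z g : collapsible [set z] g.
Proof.
exists [::], z; split; rewrite ?inE ?cards1 // => LX' LY' [f [f1 f2 EX]] [f' [f1' f2' EY]].
have fE i : f i = z.
  by have [/set1P->|/f2//] := boolP (i \in [set z]); rewrite f1 ?inE.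
have fE' i : f' i = z.
  by have [/set1P->|/f2'//] := boolP (i \in [set z]); rewrite f1' ?inE.
case: g => [[[[p q] s] r] t] /=.
rewrite /cycle_mx /chord /short_arc /long_arc /max_edge !EX !EY !fE !fE'.
by rewrite !leqnn.
Qed.

Lemma collapsible_small (A : {set label}) g : 0 < #|A| <= 3 -> collapsible A g.
Proof.
move: {2}#|A| (leqnn #|A|) => k; elim: k A => [|k IH] A Ak /andP[A0 A3].
  by rewrite leqNgt A0 in Ak.
have [A1|A1] := leqP #|A| 1.
  have /cards1P[z ->] : #|A| == 1 by rewrite eqn_leq A1.
  exact: collapsible1.
have [p [q h]] := removable_small LY UX A1 A3.
have pA : p \in A by case/and5P: h.
have cA := cardsD1 p A; rewrite pA add1n in cA.
apply: collapsible_step h _; apply: IH.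
  by rewrite -ltnS -cA.
by rewrite -ltnS -cA A1 /= -ltnS -cA (leq_trans A3).
Qed.

Lemma plan_exists : exists ms g, [/\ size ms <= 4, wf_moves ms, uniq_cyc g &
  plan_ok ms g LX LY].
Proof.
(* If everything merges into one point, any order of the labels will do. *)
pose g0 : cyc := (inord 0, inord 1, inord 2, inord 3, inord 4).
have ug0 : uniq_cyc g0.
  by rewrite /= !inE -!val_eqE /= !inordK.
have [/existsP[p1 /existsP[q1 h1]]|] :=
    boolP [exists p, exists q, removable LX LY setT p q]; last first.
  rewrite negb_exists => /forallP stuck.
  have [|g /andP[ug ok]] := stuck5_final UX UY.
    by move=> p q; have := stuck p; rewrite negb_exists => /forallP.
  by exists [::], g.
have [/existsP[p2 /existsP[q2 h2]]|] :=
    boolP [exists p, exists q, removable LX LY (setT :\ p1) p q]; last first.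
  rewrite negb_exists => /forallP stuck.
  have [|g [r /and3P[ug p1r ok]]] := stuck4_final UX UY (erefl (setT :\ p1)).
    by move=> p q; have := stuck p; rewrite negb_exists => /forallP.
  case/and5P: h1 => _ _ pq nX nY.
  by exists [:: (p1, q1, r)], g; split; rewrite //= ?pq ?p1r // nX nY.
have c0 := cardsD1 p1 [set: label]; rewrite in_setT cardsT card_ord add1n in c0.
have c1 := cardsD1 p2 ([set: label] :\ p1).
have p2A : p2 \in setT :\ p1 by case/and5P: h2.
rewrite p2A add1n in c1.
have small : collapsible ([set: label] :\ p1 :\ p2) g0.
  apply: collapsible_small; move: c1; rewrite -[#|_ :\ p1|]/_.
  by case: c0 => <- [<-].
have [ms [z [_ sz wms h]]] := collapsible_step h1 (collapsible_step h2 small).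
exists ms, g0; split=> //; first by move: sz; rewrite cardsT card_ord.
by apply: h; exists id; split=> // i; rewrite in_setT.
Qed.

End PlanExists.

(** * Queries *)

Section SplitCoordinate.
Variables (I J : finType) (p : I) (z0 : J).

Definition setf (f : {ffun I -> J}) (a : J) : {ffun I -> J} :=
  [ffun i => if i == p then a else f i].

(** The dummy value [z0] at [p] selects one representative of each class of functions that agree
    away from [p]. *)
Lemma sum_split_coord (F : {ffun I -> J} -> nat) :
  \sum_f F f = \sum_(f : {ffun I -> J} | f p == z0) \sum_a F (setf f a).
Proof.
rewrite pair_big_dep /=.
rewrite (reindex_onto (fun f => (setf f z0, f p)) (fun fa => setf fa.1 fa.2)) /=.
  apply: eq_big => [f|f _].
    rewrite ffunE eqxx /= eqxx; apply/esym/eqP/ffunP => i.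
    by rewrite !ffunE; case: eqP => // ->.
  by congr F; apply/ffunP => i; rewrite !ffunE; case: eqP => // ->.
case=> f a /= /andP[/eqP fp _]; rewrite ffunE eqxx; congr pair.
by apply/ffunP => i; rewrite !ffunE; case: eqP => // ->.
Qed.

End SplitCoordinate.

Section Query.
Variables (L : nat) (Y : nat -> nat).
Let N := 2 ^ L.
Hypothesis YN : forall i, i < N -> Y i < N.

(** Powers of 2 turn the order of block sizes into divisibility, that is, into nesting of blocks. *)
Definition good (M : matrix5) : Prop :=
  [/\ ultrametric M, forall i, M i i = 1 &
      forall i j, exists2 a, a <= L & M i j = 2 ^ a].

Lemma good_merge M p u : good M -> good (merge_mx p u M).
Proof.
case=> [[h1 h2 h3] h4 h5]; split; last by move=> i j; apply: h5.
  by split=> *; [apply: h1|apply: h2|apply: h3].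
by move=> i; apply: h4.
Qed.

Lemma good_dvd M i j i' j' : good M -> M i j <= M i' j' -> M i j %| M i' j'.
Proof.
case=> _ _ h; have [a _ ->] := h i j; have [b _ ->] := h i' j'.
by rewrite leq_exp2l // => ab; rewrite dvdn_exp2l.
Qed.

Lemma good_dvdN M i j : good M -> M i j %| N.
Proof. by case=> _ _ h; have [a aL ->] := h i j; rewrite dvdn_exp2l. Qed.

Definition agree (LX LY : matrix5) (i j : label) (a b : nat) : bool :=
  (a %/ LX i j == b %/ LX i j) && (Y a %/ LY i j == Y b %/ LY i j).

Definition query (LX LY : matrix5) (w : label -> nat -> nat) : nat :=
  \sum_(f : {ffun label -> 'I_N})
    [forall i, forall j, agree LX LY i j (f i) (f j)] * \prod_i w i (f i).

Definition merge_w (LX LY : matrix5) (p q : label) (w : label -> nat -> nat)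
    (i : label) (a : nat) : nat :=
  if i == p then 1 else if i == q then
    w q a * \sum_(b < N) (key L Y (LX p q) (LY p q) b == key L Y (LX p q) (LY p q) a) * w p b
  else w i a.

Lemma agree_trans LX LY i j k a b c : good LX -> good LY ->
  LX i j <= LX i k -> LX j k <= LX i k -> LY i j <= LY i k -> LY j k <= LY i k ->
  agree LX LY i j a b -> agree LX LY j k b c -> agree LX LY i k a c.
Proof.
move=> gX gY x1 x2 y1 y2 /andP[/eqP ha /eqP hb] /andP[/eqP hc /eqP hd].
apply/andP; split; apply/eqP.
  by rewrite (div_coarsen (good_dvd gX x1) ha) (div_coarsen (good_dvd gX x2) hc).
by rewrite (div_coarsen (good_dvd gY y1) hb) (div_coarsen (good_dvd gY y2) hd).
Qed.

Lemma agree_sym LX LY i j a b : good LX -> good LY ->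
  agree LX LY i j a b = agree LX LY j i b a.
Proof.
by case=> [[sx _ _] _ _] [[sy _ _] _ _]; rewrite /agree (sx i) (sy i) eq_sym
  [Y a %/ _ == _]eq_sym.
Qed.

Lemma agree_refl LX LY i a : agree LX LY i i a a.
Proof. by rewrite /agree !eqxx. Qed.

(** As [q] is nearest to [p], the ultrametric inequality bounds the block size of q, j by that of p,
    j; hence the constraint on p, j follows from those on p, q and on q, j. Afterwards [p] and [u]
    share the block size 1 of the diagonal, which makes them equal, so the copy leaves the sum
    unchanged. *)
Lemma query_merge LX LY w p q u : good LX -> good LY -> p != q -> p != u ->
  nearest LX setT p q -> nearest LY setT p q ->
  query LX LY w =
  query (merge_mx p u LX) (merge_mx p u LY) (merge_w LX LY p q w).
Proof.
move=> gX gY pq pu /nearestP nX /nearestP nY.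
have N0 : 0 < N by rewrite expn_gt0.
pose z0 : 'I_N := Ordinal N0.
rewrite /query !(sum_split_coord p z0); apply: eq_bigr => f _.
pose R := [forall i, forall j, (i != p) ==> (j != p) ==> agree LX LY i j (f i) (f j)].
have sf i a : i != p -> setf p f a i = f i by move=> ip; rewrite ffunE (negbTE ip).
have sp a : setf p f a p = a by rewrite ffunE eqxx.
have gX' := good_merge p u gX; have gY' := good_merge p u gY.
have [[symX dX uX] oneX _] := gX; have [[symY dY uY] oneY _] := gY.
pose S b := \sum_(a < N) (key L Y (LX p q) (LY p q) a == key L Y (LX p q) (LY p q) b) * w p a.
have qp : q != p by rewrite eq_sym.
have up : u != p by rewrite eq_sym.
(* [R] collects the constraints away from [p], and [S (f q)] is the total weight of the choices for
   [p]; both sides reduce to this product. *)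
transitivity (R * (\prod_(i | i != p) w i (f i)) * S (f q)).
  rewrite /S big_distrr; apply: eq_bigr => a _ /=.
  rewrite (bigD1 p) //= sp.
  have -> : \prod_(i | i != p) w i (setf p f a i) = \prod_(i | i != p) w i (f i).
    by apply: eq_bigr => i ip; rewrite sf.
  rewrite key_eq //.
  have -> : [forall i, forall j, agree LX LY i j (setf p f a i) (setf p f a j)] =
      R && agree LX LY p q a (f q).
    apply/forallP/andP => [h|[/forallP hR hq] i].
      split; last by have /forallP/(_ q) := h p; rewrite sp sf.
      apply/forallP => i; apply/forallP => j; apply/implyP => ip; apply/implyP => jp.
      by have /forallP/(_ j) := h i; rewrite !sf.
    have hp j : j != p -> agree LX LY p j a (f j).
      move=> jp; apply: (agree_trans gX gY (j := q)) hq _; rewrite ?nX ?nY ?in_setT //.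
      - by apply: leq_trans (uX q p j) _; rewrite geq_max symX nX ?in_setT // leqnn.
      - by apply: leq_trans (uY q p j) _; rewrite geq_max symY nY ?in_setT // leqnn.
      - by have /forallP/(_ j) := hR q; rewrite qp jp.
    apply/forallP => j; have [->|ip] := eqVneq i p; have [->|jp] := eqVneq j p.
    - by rewrite agree_refl.
    - by rewrite sp sf // hp.
    - by rewrite agree_sym // sp sf // hp.
    - by rewrite !sf //; have /forallP/(_ j) := hR i; rewrite ip jp.
  rewrite -mulnb -/(agree LX LY p q a (f q)).
  move: (nat_of_bool (agree _ _ _ _ _ _)) => b; rewrite -!mulnA; congr (_ * _).
  by rewrite mulnA mulnC.
have aE a : [forall i, forall j,
      agree (merge_mx p u LX) (merge_mx p u LY) i j (setf p f a i) (setf p f a j)] =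
    R && (a == f u).
  apply/forallP/andP => [h|[/forallP hR /eqP ->] i].
    split.
      apply/forallP => i; apply/forallP => j; apply/implyP => ip; apply/implyP => jp.
      have /forallP/(_ j) := h i; rewrite !sf // /agree /merge_mx /repl.
      by rewrite (negbTE ip) (negbTE jp).
    have /forallP/(_ u) := h p; rewrite sp sf // /agree /merge_mx /repl eqxx.
    by rewrite (negbTE up) oneX !divn1 => /andP[].
  have sfu j : setf p f (f u) j = f (repl p u j).
    by rewrite /repl ffunE; case: eqP.
  apply/forallP => j; rewrite !sfu.
  rewrite -[agree _ _ i j _ _]/(agree LX LY (repl p u i) (repl p u j) _ _).
  have ru k : repl p u k != p by rewrite /repl; case: (k =P p) => // /eqP.
  by have /forallP/(_ (repl p u j)) := hR (repl p u i); rewrite !ru.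
rewrite [RHS](bigD1 (f u)) //= [X in _ = _ + X]big1 ?addn0 => [|a au]; last first.
  by rewrite aE (negbTE au) andbF.
rewrite aE eqxx andbT -mulnA; congr (_ * _).
rewrite [RHS](bigD1 p) //= {1}/merge_w eqxx mul1n.
have -> : \prod_(i | i != p) merge_w LX LY p q w i (setf p f (f u) i) =
   \prod_(i | i != p) merge_w LX LY p q w i (f i).
  by apply: eq_bigr => i ip; rewrite sf.
rewrite (bigD1 q) //= [RHS](bigD1 q) //= {1}/merge_w (negbTE qp) eqxx.
rewrite -/(S (f q)) -mulnA [_ * S _]mulnC mulnA; congr (_ * _).
by apply: eq_bigr => i /andP[ip iq]; rewrite /merge_w (negbTE ip) (negbTE iq).
Qed.

Definition edge (M : matrix5) (g : cyc) (e : nat) : nat :=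
  let: (p, q, s, r, t) := g in
  match e with 1 => M p q | 2 => M q s | 3 => M s r | 4 => M r t | 5 => M t p
  | _ => 1 end.

Lemma chord_eq (M : matrix5) (v : label -> nat) a b c e f : good M ->
  chord M a b c e f -> v a %/ M a b = v b %/ M a b -> v b %/ M b c = v c %/ M b c ->
  v c %/ M c e = v e %/ M c e -> v e %/ M e f = v f %/ M e f ->
  v f %/ M f a = v a %/ M f a -> v a %/ M a c = v c %/ M a c.
Proof.
move=> gM /orP[/andP[h1 h2] ab bc _ _ _|/and3P[h1 h2 h3] _ _ ce ef fa].
  by rewrite (div_coarsen (good_dvd gM h1) ab) (div_coarsen (good_dvd gM h2) bc).
rewrite (div_coarsen (good_dvd gM h1) ce) (div_coarsen (good_dvd gM h2) ef).
by rewrite (div_coarsen (good_dvd gM h3) fa).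
Qed.

(** Any two of five labels on a cycle are equal, joined by an edge, or the ends of a chord. *)
Lemma cycle_mx_eq (M : matrix5) (v : label -> nat) p q s r t : good M ->
  uniq [:: p; q; s; r; t] -> cycle_mx M (p, q, s, r, t) ->
  v p %/ M p q = v q %/ M p q -> v q %/ M q s = v s %/ M q s ->
  v s %/ M s r = v r %/ M s r -> v r %/ M r t = v t %/ M r t ->
  v t %/ M t p = v p %/ M t p -> forall i j, v i %/ M i j = v j %/ M i j.
Proof.
move=> gM u /and5P[c1 c2 c3 c4 c5] e1 e2 e3 e4 e5 i j.
have sym : forall i j, v i %/ M i j = v j %/ M i j -> v j %/ M j i = v i %/ M j i.
  by case: gM => -[sM _ _] _ _ x y; rewrite sM.
have f1 := chord_eq gM c1 e1 e2 e3 e4 e5; have f2 := chord_eq gM c2 e2 e3 e4 e5 e1.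
have f3 := chord_eq gM c3 e3 e4 e5 e1 e2; have f4 := chord_eq gM c4 e4 e5 e1 e2 e3.
have f5 := chord_eq gM c5 e5 e1 e2 e3 e4.
have := uniq5_mem i u erefl; have := uniq5_mem j u erefl; rewrite !inE.
by do 2![case/or4P=> [||| /orP[]] /eqP ->] => //; apply: sym.
Qed.

Lemma sum_ffun5 (G : nat -> nat -> nat -> nat -> nat -> nat) p q s r t :
  uniq [:: p; q; s; r; t] ->
  \sum_(f : {ffun label -> 'I_N}) G (f p) (f q) (f s) (f r) (f t) = sum5 N G.
Proof.
move=> u; rewrite /sum5; do 4!rewrite pair_bigA /=.
pose h (f : {ffun label -> 'I_N}) := (f p, f q, f s, f r, f t).
pose k (x : 'I_N * 'I_N * 'I_N * 'I_N * 'I_N) : {ffun label -> 'I_N} :=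
  [ffun i => if i == p then x.1.1.1.1 else if i == q then x.1.1.1.2
    else if i == s then x.1.1.2 else if i == r then x.1.2 else x.2].
rewrite [RHS](reindex h) //; exists k => [f _|[[[[a b] c] d] e] _].
  apply/ffunP => i; rewrite ffunE /=; have := uniq5_mem i u erefl.
  rewrite !inE; case: eqP => [->//|_]; case: eqP => [->//|_].
  by case: eqP => [->//|_]; case: eqP => [->//|_] /= /eqP ->.
move: u; rewrite /= !inE !negb_or => /and5P[/and4P[h1 h2 h3 h4]].
move=> /and3P[h5 h6 h7] /andP[h8 h9] h10 _.
rewrite /h !ffunE /= !eqxx ![q == p]eq_sym ![s == p]eq_sym ![r == p]eq_sym.
rewrite ![t == p]eq_sym ![s == q]eq_sym ![r == q]eq_sym ![t == q]eq_sym.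
rewrite ![r == s]eq_sym ![t == s]eq_sym ![t == r]eq_sym.
by do ![rewrite (negbTE h1) || rewrite (negbTE h2) || rewrite (negbTE h3) ||
  rewrite (negbTE h4) || rewrite (negbTE h5) || rewrite (negbTE h6) ||
  rewrite (negbTE h7) || rewrite (negbTE h8) || rewrite (negbTE h9) ||
  rewrite (negbTE h10)].
Qed.

Lemma prod_label5 (F : label -> nat) p q s r t : uniq [:: p; q; s; r; t] ->
  \prod_i F i = F p * F q * F s * F r * F t.
Proof.
move=> u; rewrite (perm_big [:: p; q; s; r; t]) /=.
  by rewrite !big_cons big_nil muln1 !mulnA.
apply: uniq_perm => //; first exact: index_enum_uniq.
by move=> i; rewrite mem_index_enum uniq5_mem.
Qed.

Lemma query_final LX LY w g : good LX -> good LY -> uniq_cyc g ->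
  cycle_mx LX g -> cycle_mx LY g ->
  query LX LY w = let: (p, q, s, r, t) := g in
    cycle5 L Y (edge LX g) (edge LY g) (w p) (w q) (w s) (w r) (w t).
Proof.
case: g => [[[[p q] s] r] t] gX gY u cX cY; rewrite /cycle5 -(sum_ffun5 _ u).
apply: eq_bigr => f _; rewrite (prod_label5 _ u) /=; congr (_ * _).
rewrite !key_eq // !mulnb; congr nat_of_bool.
apply/forallP/idP => [h|].
  have e i j : agree LX LY i j (f i) (f j) by have /forallP := h i.
  have a1 := e p q; have a2 := e q s; have a3 := e s r; have a4 := e r t.
  have a5 := e t p; rewrite /agree in a1 a2 a3 a4 a5.
  by rewrite a1 a2 a3 a4 a5.
rewrite -!andbA.
case/and5P=> /eqP x1 /eqP y1 /eqP x2 /eqP y2.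
case/and5P=> /eqP x3 /eqP y3 /eqP x4 /eqP y4 /andP[/eqP x5 /eqP y5] i.
apply/forallP => j; apply/andP; split; apply/eqP.
  exact: (cycle_mx_eq (v := fun i => f i) gX u cX).
exact: (cycle_mx_eq (v := fun i => Y (f i)) gY u cY).
Qed.

End Query.

(** * Pattern counts as sums of queries *)

Section Levels.
Variable L : nat.

Definition split_at (l a b : nat) : bool :=
  [&& a %/ 2 ^ l.+1 == b %/ 2 ^ l.+1, ~~ odd (a %/ 2 ^ l) & odd (b %/ 2 ^ l)].

(** Induction on the number of bits: level 0 decides if the halves agree, and the other levels
    compare the halves. *)
Lemma sum_split_at a b : a < 2 ^ L -> b < 2 ^ L ->
  \sum_(l < L) split_at l a b = (a < b).
Proof.
elim: L a b => [|k IH] a b.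
  by rewrite expn0 !ltnS !leqn0 => /eqP-> /eqP->; rewrite big_ord0.
rewrite expnS => aL bL; rewrite big_ord_recl /=.
have h (x : nat) : x < 2 * 2 ^ k -> x %/ 2 < 2 ^ k by rewrite ltn_divLR // mulnC.
have -> : \sum_(i < k) split_at (bump 0 i) a b = (a %/ 2 < b %/ 2).
  rewrite -IH ?h //; apply: eq_bigr => i _; rewrite /split_at /bump leq0n add1n.
  by rewrite -!divnMA -!expnS.
rewrite /split_at expn0 expn1 !divn1.
have := divn_eq a 2; have := divn_eq b 2; rewrite !modn2.
move: (a %/ 2) (b %/ 2) => a' b' -> ->; rewrite !muln2 !oddD !odd_double !oddb /=.
by case: (odd a); case: (odd b); rewrite ?andbF ?andbT /=; lia.
Qed.

Fixpoint level_sum (k : nat) (F : seq nat -> nat) : nat :=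
  if k is k'.+1 then \sum_(l < L) level_sum k' (fun s => F (nat_of_ord l :: s))
  else F [::].

Lemma eq_level_sum k F G : (forall s, size s = k -> all (gtn L) s -> F s = G s) ->
  level_sum k F = level_sum k G.
Proof.
elim: k F G => [|k IH] F G h /=; first exact: h.
apply: eq_bigr => l _; apply: IH => s sk sL; apply: h; first by rewrite /= sk.
by rewrite /= ltn_ord.
Qed.

Lemma level_sum_exchange k (I : finType) (F : I -> seq nat -> nat) :
  \sum_i level_sum k (F i) = level_sum k (fun s => \sum_i F i s).
Proof.
elim: k F => [|k IH] F //=; rewrite exchange_big; apply: eq_bigr => l _.
exact: IH.
Qed.

Lemma level_sumZ k a F : a * level_sum k F = level_sum k (fun s => a * F s).
Proof.
elim: k F => [|k IH] F //=; rewrite big_distrr; apply: eq_bigr => l _.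
exact: IH.
Qed.

Lemma prod_level_sum k (e : nat -> nat -> nat) :
  \prod_(c < k) \sum_(l < L) e c l =
  level_sum k (fun s => \prod_(c < k) e c (nth 0 s c)).
Proof.
elim: k e => [|k IH] e; first by rewrite /= !big_ord0.
rewrite big_ord_recl (IH (fun c => e c.+1)) big_distrl /=; apply: eq_bigr => l _.
rewrite level_sumZ; apply: eq_level_sum => s _ _.
by rewrite big_ord_recl.
Qed.

End Levels.

Lemma prod_bool (I : finType) (b : pred I) :
  \prod_i nat_of_bool (b i) = [forall i, b i] :> nat.
Proof.
have [/forallP h|] := boolP [forall i, b i].
  by rewrite big1 // => i _; rewrite h.
rewrite negb_forall => /existsP[i bi].
by rewrite (bigD1 i) //= (negbTE bi) mul0n.
Qed.

(** * Chains of comparisons as bits and nested blocks *)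

Section Chain.
Variable s : nat -> nat.

(** If the members c and c + 1 of a chain split at level [s c], then members i and j agree on all
    bits above the largest level between them. A maximum over the interval from i to j is an
    ultrametric. *)
Definition span (i j : nat) : nat :=
  \max_(c < 4 | minn i j <= c < maxn i j) (s c).+1.

(** Member [i] is the larger side of comparison [i.-1] and the smaller side of comparison [i],
    except at the two ends of the chain. *)
Definition side (i v : nat) : bool :=
  ((i == 0) || odd (v %/ 2 ^ s i.-1)) && ((i == 4) || ~~ odd (v %/ 2 ^ s i)).

Lemma spanC i j : span i j = span j i.
Proof. by rewrite /span minnC maxnC. Qed.

Lemma spanii i : span i i = 0.
Proof.
by rewrite /span big_pred0 // => c; rewrite minnn maxnn leqNgt andNb.
Qed.

Lemma span_ultra i j k : span i k <= maxn (span i j) (span j k).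
Proof.
apply/bigmax_leqP => c ck; rewrite leq_max.
have [h|h] := boolP (minn i j <= c < maxn i j).
  by apply/orP; left; apply: (leq_bigmax_cond (F := fun c : 'I_4 => (s c).+1)).
apply/orP; right; apply: (leq_bigmax_cond (F := fun c : 'I_4 => (s c).+1)).
lia.
Qed.

Lemma span_ge i j c : c < 4 -> i <= c < j -> (s c).+1 <= span i j.
Proof.
move=> c4 icj.
apply: (@leq_bigmax_cond _ _ (fun c : 'I_4 => (s c).+1) (Ordinal c4)).
by rewrite /=; lia.
Qed.

Lemma spanS c : c < 4 -> span c c.+1 = (s c).+1.
Proof.
move=> c4; rewrite /span (big_pred1 (Ordinal c4)) // => i.
by rewrite /= -val_eqE /=; lia.
Qed.

(** A comparison at a given level means agreement above that level and one prescribed bit on each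
    side. The bits concern single points and go into the weights; agreement is a constraint on
    blocks. *)
Lemma chain_split (v : nat -> nat) :
  [forall c : 'I_4, split_at (s c) (v c) (v c.+1)] =
  [forall i : label, side i (v i)] &&
  [forall i : label, forall j : label,
     v i %/ 2 ^ span i j == v j %/ 2 ^ span i j].
Proof.
apply/forallP/andP => [h|[/forallP h1 /forallP h2] c].
  have hc c : c < 4 -> split_at (s c) (v c) (v c.+1).
    by move=> c4; have := h (Ordinal c4).
  split.
    apply/forallP => i; rewrite /side; apply/andP; split.
      case: i => [[|i] i5] //=; have := hc i i5.
      by case/and3P.
    have [//|i4] := eqVneq (i : nat) 4; have := hc i _.
    by rewrite ltn_neqAle i4 -ltnS ltn_ord => /(_ isT)/and3P[].
  (* Agreement is passed along consecutive members, each step being coarsened to the common level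
     [m]. *)
  have main e i m : i + e <= 4 -> span i (i + e) <= m ->
      v i %/ 2 ^ m = v (i + e) %/ 2 ^ m.
    elim: e => [|e IH]; first by rewrite addn0.
    rewrite addnS => ie hm; rewrite IH; [|exact: ltnW|].
      have /and3P[/eqP hh _ _] := hc _ ie.
      apply: div_coarsen hh; apply: dvdn_exp2l.
      by apply: leq_trans hm; apply: span_ge => //; lia.
    apply: leq_trans hm; apply/bigmax_leqP => c ck.
    by apply: span_ge => //; lia.
  apply/forallP => i; apply/forallP => j; apply/eqP.
  have i4 : i <= 4 by rewrite -ltnS. have j4 : j <= 4 by rewrite -ltnS.
  have [ij|/ltnW ij] := leqP i j.
    by rewrite -(subnKC ij); apply: main; rewrite ?subnKC.
  by rewrite spanC; apply/esym; rewrite -(subnKC ij); apply: main; rewrite ?subnKC.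
have c5 : c < 5 by apply: ltn_trans (ltn_ord c) _.
have c5' : c.+1 < 5 by rewrite ltnS.
have := h1 (Ordinal c5); have := h1 (Ordinal c5').
have /forallP/(_ (Ordinal c5')) := h2 (Ordinal c5).
rewrite /side /split_at /= spanS // => -> /andP[-> _] /andP[_].
by rewrite (ltn_eqF (ltn_ord c)) /= => ->.
Qed.

End Chain.

Definition level_mx (pos : label -> nat) (s : nat -> nat) : matrix5 :=
  fun i j => 2 ^ span s (pos i) (pos j).

Lemma good_level_mx L pos s : (forall c, c < 4 -> s c < L) ->
  good L (level_mx pos s).
Proof.
move=> sL; split=> [|i|i j]; first split.
- by move=> i j; rewrite /level_mx spanC.
- by move=> i j; rewrite leq_exp2l // spanii.
- move=> i j k; have := span_ultra s (pos i) (pos j) (pos k).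
  by rewrite /level_mx !leq_max !leq_exp2l.
- by rewrite /level_mx spanii.
exists (span s (pos i) (pos j)) => //.
by apply/bigmax_leqP => c _; apply: sL.
Qed.

(* The identity extends the permutation beyond its domain. *)
Definition extend (n : nat) (pi : 'S_n) (a : nat) : nat :=
  if insub a is Some i then pi i else a.

Lemma extendE n (pi : 'S_n) (i : 'I_n) : extend pi i = pi i.
Proof. by rewrite /extend valK. Qed.

Lemma extend_ge n (pi : 'S_n) a : n <= a -> extend pi a = a.
Proof. by move=> na; rewrite /extend insubN // -leqNgt. Qed.

Lemma extend_lt n (pi : 'S_n) m a : n <= m -> a < m -> extend pi a < m.
Proof.
move=> nm am; rewrite /extend; case: insubP => // i _ _.
exact: leq_trans (ltn_ord _) nm.
Qed.

Lemma extendK n (pi : 'S_n) : cancel (extend pi) (extend pi^-1).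
Proof.
move=> a; have [an|na] := ltnP a n; last by rewrite !extend_ge.
by rewrite -[a]/(nat_of_ord (Ordinal an)) !extendE permK.
Qed.

Definition point_w (n : nat) (Y : nat -> nat) (tau : 'S_5) (s : nat -> nat)
    (i : label) (a : nat) : nat :=
  [&& a < n, side s i a & side (fun c => s (4 + c)) (tau i) (Y a)].

Section Pattern.
Variables (n L : nat) (pi : 'S_n) (tau : 'S_5).
Let N := 2 ^ L.
Hypothesis nN : n < N.
Let Y := extend pi.

Let xs (f : {ffun label -> 'I_N}) (c : nat) : nat := f (inord c).
(** The chain of values visits the points by increasing value, the order that [tau^-1] lists. *)
Let ys (f : {ffun label -> 'I_N}) (c : nat) : nat := Y (f (tau^-1%g (inord c))).

Lemma occurrence_chains (g : {ffun label -> 'I_n}) (f : {ffun label -> 'I_N}) :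
  (forall i, g i = f i :> nat) ->
  is_occurrence tau pi g = [forall c : 'I_4, xs f c < xs f c.+1] &&
    [forall c : 'I_4, ys f c < ys f c.+1].
Proof.
move=> gf; rewrite /is_occurrence.
have Yg i : Y (f i) = pi (g i) by rewrite /Y -gf extendE.
have inordV (i : label) : inord i = i by apply: val_inj; rewrite /= inordK.
have incr (v : nat -> nat) : (forall c : 'I_4, v c < v c.+1) ->
    forall i j : label, i < j -> v i < v j.
  move=> h i j ij; have j4 : j <= 4 by rewrite -ltnS.
  have step c : c < 4 -> v c < v c.+1 by move=> c4; apply: (h (Ordinal c4)).
  rewrite -(subnKC ij) in j4 *; move: (j - i.+1) j4.
  elim=> [|e IH] le4; first by rewrite addn0; apply: step; rewrite addn0 in le4.
  rewrite addnS in le4 *; apply: ltn_trans (IH (ltnW le4)) _.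
  exact: step.
have xsE (i : label) : xs f i = f i by rewrite /xs inordV.
have ysE (i : label) : ys f (tau i) = Y (f i) by rewrite /ys inordV permK.
have ord_inj5 (c : 'I_4) : (inord c : label) < (inord c.+1 : label).
  by rewrite !inordK // ltnS // ltnW.
apply/andP/andP => [[/forallP h1 /forallP h2]|[/forallP h1 /forallP h2]].
  split; apply/forallP => c.
    have /forallP/(_ (inord c.+1))/implyP := h1 (inord c).
    by rewrite /xs -!gf; apply.
  have /forallP/(_ (tau^-1%g (inord c.+1)))/eqP := h2 (tau^-1%g (inord c)).
  by rewrite /ys !Yg !permKV => ->.
have mx (i j : label) : i < j -> f i < f j.
  by move=> ij; rewrite -!xsE; apply: incr.
have my (i j : label) : tau i < tau j -> Y (f i) < Y (f j).
  by move=> ij; rewrite -!ysE; apply: incr.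
split; apply/forallP => i; apply/forallP => j.
  by apply/implyP => ij; rewrite !gf mx.
rewrite -!Yg; have [ij|ji|e] := ltngtP (tau i) (tau j).
- by rewrite my.
- by rewrite ltnNge ltnW // my.
by rewrite (perm_inj (val_inj e)) ltnn.
Qed.

Lemma pattern_count_chains : pattern_count tau pi =
  \sum_(f : {ffun label -> 'I_N}) [forall i, f i < n] *
    ([forall c : 'I_4, xs f c < xs f c.+1] * [forall c : 'I_4, ys f c < ys f c.+1]).
Proof.
have inN (i : 'I_n) : i < N by apply: ltn_trans nN.
(* For [n = 0] there is no element of ['I_n] to serve as the default value in [down]. *)
have [n0|n0] := posnP n.
  rewrite big1 => [|f _]; last first.
    have /negbTE-> : ~~ [forall i, f i < n]; last by rewrite mul0n.
    by rewrite negb_forall; apply/existsP; exists ord0; rewrite n0.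
  by apply: eq_card0 => g; have := ltn_ord (g ord0); rewrite [X in _ < X]n0.
pose i0 : 'I_n := Ordinal n0.
pose up (g : {ffun label -> 'I_n}) : {ffun label -> 'I_N} :=
  [ffun i => Ordinal (inN (g i))].
pose down (f : {ffun label -> 'I_N}) : {ffun label -> 'I_n} :=
  [ffun i => insubd i0 (val (f i))].
rewrite /pattern_count -sum1_card big_mkcond /=.
rewrite [RHS](eq_bigr (fun f : {ffun label -> 'I_N} => if [forall i, f i < n] then
  [forall c : 'I_4, xs f c < xs f c.+1] * [forall c : 'I_4, ys f c < ys f c.+1]
  else 0)); last by move=> f _; case: [forall i, _]; rewrite ?mul1n ?mul0n.
rewrite -[RHS]big_mkcond [RHS](reindex_onto up down) /=; last first.
  move=> f /forallP fn; apply/ffunP => i; apply: val_inj; rewrite !ffunE /=.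
  by rewrite val_insubd fn.
apply: eq_big => [g|g _].
  apply/esym/andP; split; first by apply/forallP => i; rewrite ffunE /=.
  apply/eqP/ffunP => i; apply: val_inj; rewrite !ffunE /= val_insubd.
  by rewrite ltn_ord.
rewrite mulnb -(@occurrence_chains g (up g)); first by rewrite ?inE; case: (is_occurrence _ _ _).
by move=> i; rewrite ffunE.
Qed.

(** Each of the eight comparisons is a sum over its level. Once the product is expanded, fixed
    levels leave block constraints for the query and bits for the weights. *)
Theorem pattern_count_levels : pattern_count tau pi =
  level_sum L 8 (fun s => query L Y (level_mx (fun i => i) (nth 0 s))
    (level_mx (fun i => tau i) (fun c => nth 0 s (4 + c)))
    (point_w n Y tau (nth 0 s))).
Proof.
rewrite pattern_count_chains.
pose e f c l := if c < 4 then split_at l (xs f c) (xs f c.+1)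
  else split_at l (ys f (c - 4)) (ys f (c - 4).+1).
have inordV (i : label) : inord i = i by apply: val_inj; rewrite /= inordK.
have xN f c : xs f c < N by rewrite /xs ltn_ord.
have yN f c : ys f c < N by apply: extend_lt; [exact: ltnW|exact: ltn_ord].
transitivity (\sum_(f : {ffun label -> 'I_N}) level_sum L 8 (fun s =>
    [forall i, f i < n] * \prod_(c < 8) e f c (nth 0 s c))).
  apply: eq_bigr => f _; rewrite -level_sumZ; congr (_ * _).
  rewrite -(@prod_level_sum L 8 (fun c l => e f c l)) (@big_split_ord _ _ _ 4 4) /=.
  rewrite -!prod_bool; congr (_ * _); apply: eq_bigr => c _.
    rewrite -(@sum_split_at L) //; apply: eq_bigr => l _.
    by rewrite /e /= ltn_ord.
  rewrite -(@sum_split_at L) //; apply: eq_bigr => l _.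
  by rewrite /e ltnNge leq_addr /= addKn.
rewrite level_sum_exchange; apply: eq_level_sum => s _ _.
apply: eq_bigr => f _; rewrite (@big_split_ord _ _ _ 4 4) /=.
have -> : \prod_(i < 4) e f i (nth 0 s i) =
    [forall c : 'I_4, split_at (nth 0 s c) (xs f c) (xs f c.+1)] :> nat.
  by rewrite -prod_bool; apply: eq_bigr => c _; rewrite /e ltn_ord.
have -> : \prod_(i < 4) e f (4 + i) (nth 0 s (4 + i)) =
    [forall c : 'I_4, split_at (nth 0 s (4 + c)) (ys f c) (ys f c.+1)] :> nat.
  rewrite -prod_bool; apply: eq_bigr => c _.
  by rewrite /e ltnNge leq_addr /= addKn.
rewrite (chain_split (nth 0 s) (xs f)) (chain_split (fun c => nth 0 s (4 + c)) (ys f)).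
rewrite /point_w prod_bool !mulnb; congr nat_of_bool.
have xsE (i : label) : xs f i = f i by rewrite /xs inordV.
have ysE (i : label) : ys f (tau i) = Y (f i) by rewrite /ys inordV permK.
apply/idP/idP.
  case/and3P=> /forallP h0 /andP[/forallP h1 /forallP h2] /andP[/forallP h3 /forallP h4].
  apply/andP; split.
    apply/forallP => i; apply/forallP => j; rewrite /agree /level_mx.
    have /forallP/(_ j) := h2 i; rewrite !xsE => ->.
    by have /forallP/(_ (tau j)) := h4 (tau i); rewrite !ysE.
  apply/forallP => i; rewrite h0; have := h1 i; rewrite xsE => ->.
  by have := h3 (tau i); rewrite ysE.
case/andP=> /forallP h1 /forallP h2; apply/and3P; split.
- by apply/forallP => i; case/and3P: (h2 i).
- apply/andP; split; apply/forallP => i; first by rewrite xsE; case/and3P: (h2 i).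
  apply/forallP => j; rewrite !xsE.
  by have /forallP/(_ j)/andP[] := h1 i.
apply/andP; split; apply/forallP => i; rewrite -(permKV tau i) ysE.
  by case/and3P: (h2 (tau^-1%g i)).
apply/forallP => j; rewrite -(permKV tau j) ysE.
by have /forallP/(_ (tau^-1%g j))/andP[] := h1 (tau^-1%g i).
Qed.

End Pattern.

(** * The program for a query *)

Definition emax (a b : exp) : exp :=
  eadd (emul (EBin OLt a b) b) (emul (eeq (EBin OLt a b) (ENum 0)) a).
Definition ele (a b : exp) : exp := eeq (EBin OLt b a) (ENum 0).
Definition eor (a b : exp) : exp := EBin OLt (ENum 0) (eadd a b).
Definition eands : seq exp -> exp := foldr emul (ENum 1).

Definition emx := label -> label -> exp.

Definition nearest_exp (M : emx) (p q : label) : exp :=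
  eands [seq ele (M p q) (M p z) | z <- enum label & z != p].

Definition short_arc_exp (M : emx) (a b c : label) : exp :=
  emul (ele (M a b) (M a c)) (ele (M b c) (M a c)).

Definition long_arc_exp (M : emx) (a c e f : label) : exp :=
  eands [:: ele (M c e) (M a c); ele (M e f) (M a c); ele (M f a) (M a c)].

Definition chord_exp (M : emx) (a b c e f : label) : exp :=
  eor (short_arc_exp M a b c) (long_arc_exp M a c e f).

Definition max_edge_exp (M : emx) (m : exp) (a b c e f : label) : exp :=
  eands [:: ele (M a b) m; ele (M b c) m; ele (M c e) m; ele (M e f) m;
            ele (M f a) m].

Definition cycle_mx_exp (M : emx) (g : cyc) : exp :=
  let: (p, q, s, r, t) := g in
  eands [:: chord_exp M p q s r t; chord_exp M q s r t p; chord_exp M s r t p q;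
            chord_exp M r t p q s; chord_exp M t p q s r].

Definition final_ok_exp (LX LY : emx) (g : cyc) : exp :=
  let: (p, q, s, r, t) := g in
  eands [:: cycle_mx_exp LX g; cycle_mx_exp LY g;
            max_edge_exp LX (LX q s) p q s r t;
            max_edge_exp LX (LX t p) p q s r t;
            max_edge_exp LY (LY s r) p q s r t].

Definition merge_emx (p u : label) (M : emx) : emx :=
  fun i j => M (repl p u i) (repl p u j).

Fixpoint plan_ok_exp (ms : seq move) (g : cyc) (LX LY : emx) : exp :=
  if ms is (p, q, u) :: ms' then
    eands [:: nearest_exp LX p q; nearest_exp LY p q;
              plan_ok_exp ms' g (merge_emx p u LX) (merge_emx p u LY)]
  else final_ok_exp LX LY g.

Definition edge_exp (M : emx) (g : cyc) (e : nat) : exp :=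
  let: (p, q, s, r, t) := g in
  match e with 1 => M p q | 2 => M q s | 3 => M s r | 4 => M r t | 5 => M t p
  | _ => ENum 1 end.

Definition merge_we (LX LY : emx) (p q : label) (t : nat)
    (we : label -> exp -> exp) (i : label) : exp -> exp :=
  if i == p then fun=> ENum 1
  else if i == q then lookup (we q) t (ekey (LX p q) (LY p q)) else we i.

Section PlanProgram.
Variables (d : nat) (out g1 g2 : exp).

Fixpoint plan_prog (ms : seq move) (g : cyc) (t : nat) (LX LY : emx)
    (we : label -> exp -> exp) : prog :=
  if ms is (p, q, u) :: ms' then
    tabulate d (ekey (LX p q) (LY p q)) (we p)
      (plan_prog ms' g t.+1 (merge_emx p u LX) (merge_emx p u LY)
         (merge_we LX LY p q t we))
  else let: (a, b, c, e, f) := g in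
    cycle_prog d t out (edge_exp LX g) (edge_exp LY g)
      (we a) (we b) (we c) (we e) (we f) g1 g2.

Definition dispatch (plans : seq (seq move * cyc)) (t : nat) (LX LY : emx)
    (we : label -> exp -> exp) : prog :=
  foldr (fun pl rest => PIte (plan_ok_exp pl.1 pl.2 LX LY)
    (plan_prog pl.1 pl.2 t LX LY we) rest) PSkip plans.

End PlanProgram.

(** All plans with at most four moves. The list is fixed, so its length enters the size of the
    program but not the number of loop rounds. *)
Definition plans : seq (seq move * cyc) :=
  [seq pl <- flatten [seq [seq (val ms, g) | ms <- enum {: k.-tuple move},
                                             g <- enum (_ : finType)]
                     | k <- iota 0 5] | wf_moves pl.1 && uniq_cyc pl.2].

Lemma mem_plans ms g : size ms <= 4 -> wf_moves ms -> uniq_cyc g ->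
  (ms, g) \in plans.
Proof.
move=> ms4 wms ug; rewrite mem_filter; apply/andP; split; first exact/andP.
apply/flatten_mapP; exists (size ms); first by rewrite mem_iota.
by apply/allpairsP; exists (in_tuple ms, g); rewrite !mem_enum.
Qed.

(** * Correctness of guards and plans *)

Section PlanSemantics.
Variables (w L : nat) (Y X : nat -> nat).
Notation W := (2 ^ w).
Let N := 2 ^ L.
Let S := N ^ 8.
Hypotheses (YN : forall i, i < N -> Y i < N) (XN : forall i, i < N -> X i < N).
Hypothesis XY : forall i, i < N -> X (Y i) = i.
Hypotheses (L0 : 0 < L) (SW : S < W).
Local Notation ev := (ev w S).
Local Notation dn := (dn w S true).
Local Notation vspec := (vspec w L).
Local Notation wspec := (wspec w L).
Local Notation base := (base L Y X).

Lemma W_gt2 : 2 < W.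
Proof.
apply: leq_ltn_trans SW; rewrite (leq_trans (_ : 2 <= N)) ?(N_gt1 L0) //.
by rewrite (@expN_leS L L0 1).
Qed.

Section Guards.
Variables (env : nat -> nat) (tabs : nat -> nat -> nat).
Local Notation val e b := (ev env tabs e = nat_of_bool b).

Lemma ev_le a b : val (ele a b) (ev env tabs a <= ev env tabs b).
Proof.
by rewrite /ele (ev_eqb L0 SW) (ev_ltb L0 SW) /= mod0n eqb0 -leqNgt.
Qed.

Lemma ev_and a b (x y : bool) : val a x -> val b y -> val (emul a b) (x && y).
Proof.
move=> ax by_; rewrite ev_mul ax by_ ?mulnb //.
by apply: leq_ltn_trans (W_gt1 L0 SW); case: (x && y).
Qed.

Lemma ev_true : val (ENum 1) true.
Proof. by rewrite /= modn_small // (W_gt1 L0 SW). Qed.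

Lemma ev_and1 a (x : bool) : val a x -> val (emul a (ENum 1)) x.
Proof. by move=> h; rewrite -[x]andbT; apply: ev_and h ev_true. Qed.

Lemma ev_ands (s : seq (exp * bool)) : (forall eb, List.In eb s -> val eb.1 eb.2) ->
  val (eands (map fst s)) (all snd s).
Proof.
elim: s => [_|[e b] s IH h] /=; first exact: ev_true.
apply: ev_and; first by apply: (h (e, b)); left.
by apply: IH => eb hs; apply: h; right.
Qed.

Lemma ev_or a b (x y : bool) : val a x -> val b y -> val (eor a b) (x || y).
Proof.
move=> ax by_; rewrite /eor (ev_ltb L0 SW) ev_add ax by_ /= ?mod0n.
  by case: x {ax}; case: y {by_}.
by apply: leq_ltn_trans W_gt2; case: x {ax}; case: y {by_}.
Qed.

Lemma ev_max a b : ev env tabs a < W -> ev env tabs b < W ->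
  ev env tabs (emax a b) = maxn (ev env tabs a) (ev env tabs b).
Proof.
move=> aW bW; have h1 := ev_ltb L0 SW env tabs a b.
have h2 : val (eeq (EBin OLt a b) (ENum 0)) (~~ (ev env tabs a < ev env tabs b)).
  by rewrite (ev_eqb L0 SW) (ev_ltb L0 SW) [ev _ _ (ENum 0)]mod0n eqb0.
rewrite maxnE /emax; case: (ltnP (ev env tabs a) (ev env tabs b)) h1 h2 => ab h1 h2.
  have e1 : ev env tabs (emul (EBin OLt a b) b) = ev env tabs b.
    by rewrite ev_mul h1 ?mul1n.
  have e2 : ev env tabs (emul (eeq (EBin OLt a b) (ENum 0)) a) = 0.
    by rewrite ev_mul h2 ?mul0n ?expn_gt0.
  by rewrite ev_add e1 e2 ?addn0 // subnKC // ltnW.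
have e1 : ev env tabs (emul (EBin OLt a b) b) = 0.
  by rewrite ev_mul h1 ?mul0n ?expn_gt0.
have e2 : ev env tabs (emul (eeq (EBin OLt a b) (ENum 0)) a) = ev env tabs a.
  by rewrite ev_mul h2 ?mul1n.
by rewrite ev_add e1 e2 ?add0n // (eqnP ab) addn0.
Qed.

Definition espec (M : emx) (m : matrix5) := forall i j, ev env tabs (M i j) = m i j.

Lemma ev_nearest M m p q : espec M m -> val (nearest_exp M p q) (nearest m setT p q).
Proof.
move=> h; rewrite /nearest_exp.
rewrite (_ : [seq _ | _ <- _ & _] = map fst
  [seq (ele (M p q) (M p z), m p q <= m p z) | z <- enum label & z != p]).
  rewrite ev_ands => [|[e b]].
    congr nat_of_bool; rewrite all_map all_filter; apply/allP/nearestP => /= h' z.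
      by move=> _; have := h' z; rewrite mem_enum => /(_ isT) /implyP.
    by move=> _; apply/implyP => /(h' _ (in_setT _)).
  elim: (filter _ _) => [//|z s IH]; case; last exact: IH.
  by case=> <- <-; rewrite ev_le !h.
by rewrite -map_comp.
Qed.

Lemma ev_chord M m a b c e f : espec M m ->
  val (chord_exp M a b c e f) (chord m a b c e f).
Proof.
move=> h; apply: ev_or; first by apply: ev_and; rewrite ev_le !h.
rewrite /long_arc_exp /long_arc.
by do 2!(apply: ev_and; first by rewrite ev_le !h); apply: ev_and1; rewrite ev_le !h.
Qed.

Lemma ev_max_edge M m (mm : exp) a b c e f : espec M m ->
  val (max_edge_exp M mm a b c e f) (max_edge m (ev env tabs mm) a b c e f).
Proof.
move=> h; rewrite /max_edge_exp /max_edge.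
by do 4!(apply: ev_and; first by rewrite ev_le !h); apply: ev_and1; rewrite ev_le !h.
Qed.

Lemma ev_cycle_mx M m g : espec M m -> val (cycle_mx_exp M g) (cycle_mx m g).
Proof.
case: g => [[[[p q] s] r] t] h.
rewrite /cycle_mx_exp /cycle_mx.
by do 4!(apply: ev_and; first exact: ev_chord); apply/ev_and1/ev_chord.
Qed.

Lemma ev_final_ok LX LY mx my g : espec LX mx -> espec LY my ->
  val (final_ok_exp LX LY g) (final_ok mx my g).
Proof.
move=> hx hy; case: g => [[[[p q] s] r] t]; rewrite /final_ok_exp /final_ok.
do 2!(apply: ev_and; first exact: ev_cycle_mx).
apply: ev_and; first by rewrite -(hx q s); apply: ev_max_edge.
apply: ev_and; first by rewrite -(hx t p); apply: ev_max_edge.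
by apply: ev_and1; rewrite -(hy s r); apply: ev_max_edge.
Qed.

Lemma ev_plan_ok ms g LX LY mx my : espec LX mx -> espec LY my ->
  val (plan_ok_exp ms g LX LY) (plan_ok ms g mx my).
Proof.
elim: ms LX LY mx my => [|[[p q] u] ms IH] LX LY mx my hx hy.
  exact: ev_final_ok.
do 2!(apply: ev_and; first exact: ev_nearest).
by apply: ev_and1; apply: IH => i j; rewrite /merge_mx -?hx -?hy.
Qed.

End Guards.

Section Plan.
Variables (out : exp) (oc : nat) (g1 g2 : exp) (d o : nat) (env : nat -> nat).
Hypothesis ocS : oc < S.

Lemma dn_plan ms g t tabs LX LY we mx my f :
  base d t env tabs -> vspec d t env tabs out oc ->
  (forall i j, vspec d t env tabs (LX i j) (mx i j)) ->
  (forall i j, vspec d t env tabs (LY i j) (my i j)) ->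
  (forall i, wspec d t env tabs (we i) (f i)) ->
  good L mx -> good L my -> wf_moves ms -> uniq_cyc g -> plan_ok ms g mx my ->
  dn (plan_prog d out g1 g2 ms g t LX LY we) d t env tabs o =
  (oc == o) * query L Y mx my f %[mod W].
Proof.
elim: ms t tabs LX LY we mx my f => [|[[p q] u] ms IH] t tabs LX LY we mx my f
  B Hout Hx Hy Hf gx gy.
  case: g => [[[[a b] c] e] h] _ ug /and5P[cx cy m1 m2 m3].
  have Q := query_final YN f gx gy ug cx cy.
  rewrite Q.
  have five (P : nat -> Prop) : P 1 -> P 2 -> P 3 -> P 4 -> P 5 ->
      forall e, 0 < e <= 5 -> P e.
    by move=> h1 h2 h3 h4 h5 [//|[|[|[|[|[|//]]]]]].
  case/and5P: m1 => *; case/and5P: m2 => *; case/and5P: m3 => *.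
  pose g := (a, b, c, e, h).
  rewrite -[plan_prog _ _ _ _ _ _ _ _ _ _]/(cycle_prog d t out (edge_exp LX g)
    (edge_exp LY g) (we a) (we b) (we c) (we e) (we h) g1 g2).
  rewrite [X in _ * X](_ : _ = cycle5 L Y (edge mx g) (edge my g)
    (f a) (f b) (f c) (f e) (f h)) //.
  have dx i j i' j' := @good_dvd L mx i j i' j' gx.
  have dy i j i' j' := @good_dvd L my i j i' j' gy.
  have dxN i j := good_dvdN i j gx; have dyN i j := good_dvdN i j gy.
  by apply: (dn_cycle YN XN XY L0 SW B Hout ocS) => //; apply: five;
    rewrite /= ?dx ?dy.
case/andP=> /= /andP[pq pu] wms ug /and3P[nx ny ok].
rewrite (query_merge YN f gx gy pq pu nx ny).
apply: (dn_tabulate_then L0 SW B (kspec_key YN L0 SW B (Hx p q) (Hy p q)) _ (Hf p)).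
  by move=> i iN; apply: leq_trans (key_lt YN _ _ iN) (expN_leS L0 (isT : 2 <= 8)).
move=> tabs' E hl; have t1 := leqnSn t; have d0 := leqnn d.
apply: IH => //; try exact: good_merge.
- exact: (base_ext d0 t1 E B).
- exact: (vspec_ext d0 t1 E Hout).
- by move=> i j; apply: (vspec_ext d0 t1 E (Hx _ _)).
- by move=> i j; apply: (vspec_ext d0 t1 E (Hy _ _)).
move=> i; rewrite /merge_we /merge_w; case: eqP => _; first by move=> *; apply: modn_mod.
case: eqP => _; first exact: hl.
exact: (wspec_ext d0 t1 E (Hf i)).
Qed.

(** Any plan whose guard holds gives the right value, so it does not matter which one comes first;
    [plan_exists] and [mem_plans] exclude that the list is exhausted. *)
Lemma dn_dispatch t tabs LX LY we mx my f :
  base d t env tabs -> vspec d t env tabs out oc ->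
  (forall i j, vspec d t env tabs (LX i j) (mx i j)) ->
  (forall i j, vspec d t env tabs (LY i j) (my i j)) ->
  (forall i, wspec d t env tabs (we i) (f i)) -> good L mx -> good L my ->
  dn (dispatch d out g1 g2 plans t LX LY we) d t env tabs o =
  (oc == o) * query L Y mx my f %[mod W].
Proof.
move=> B Hout Hx Hy Hf gx gy.
have [ux _ _] := gx; have [uy _ _] := gy.
have [ms0 [g0 [ms4 wms ug ok0]]] := plan_exists ux uy.
have := mem_plans ms4 wms ug.
have : all (fun pl => wf_moves pl.1 && uniq_cyc pl.2) plans by apply: filter_all.
elim: plans => //= -[ms g] s IH /andP[/andP[wm uc] hs]; rewrite inE => hm.
have hg := @ev_plan_ok env tabs ms g LX LY mx my
  (fun i j => Hx i j _ _ (ext_refl _ _ _ _)) (fun i j => Hy i j _ _ (ext_refl _ _ _ _)).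
rewrite hg; case ok: plan_ok => /=; first exact: dn_plan.
by apply: IH => //; case/orP: hm ok => // /eqP[<- <-]; rewrite ok0.
Qed.

End Plan.
End PlanSemantics.

(** * The program for the profile *)

(* The prologue of the machine leaves [2 ^ a] in cell [n + 1 + a]. *)
Definition epow (a : exp) : exp := ETab 0 (eadd (eadd (EVar 1) (ENum 1)) a).

(** Each loop takes two registers, so the counters of the eight level loops are registers 4, 6, ...,
    18. *)
Definition level_pow (c : nat) : exp := epow (EVar (4 + c.*2)).

Definition level_emx (off : nat) (pos : label -> nat) : emx := fun i j =>
  foldr emax (ENum 1) [seq emul (ENum 2) (level_pow (off + c))
    | c <- iota 0 4 & minn (pos i) (pos j) <= c < maxn (pos i) (pos j)].

Definition bit_exp (c : nat) (v : exp) : exp := EBin OMod (ediv v (level_pow c)) (ENum 2).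

Definition side_exp (off i : nat) (v : exp) : exp :=
  emul (if i == 0 then ENum 1 else bit_exp (off + i.-1) v)
       (if i == 4 then ENum 1 else eeq (bit_exp (off + i) v) (ENum 0)).

Definition point_we (tau : 'S_5) (i : label) (e : exp) : exp :=
  emul (EBin OLt e (EVar 1))
    (emul (side_exp 0 i e) (side_exp 4 (tau i) (ETab 2 e))).

Fixpoint level_loops (k : nat) (c : prog) : prog :=
  if k is k'.+1 then PFor (EVar 3) (level_loops k' c) else c.

(** The threshold [2 ^ (L %/ 4)], read from the stored powers because the machine has no
    exponentiation. *)
Definition short_block : exp := epow (ediv (EVar 3) (ENum 4)).

(** Register 20 is the first one free behind the eight loops, and table 4 the first one behind
    input, output, [Y] and [X]. *)
Definition query_prog (tau : 'S_5) : prog :=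
  dispatch 20 (ENum (enum_rank tau)) short_block (emul short_block short_block)
    plans 4 (level_emx 0 (fun i => i)) (level_emx 4 (fun i => tau i)) (point_we tau).

Definition count_prog (tau : 'S_5) : prog := level_loops 8 (query_prog tau).

(** Input values start at 1 and lie behind the cell that holds [n], hence the two shifts by 1. *)
Definition extend_prog : prog :=
  PFor (EVar 2) (PIte (EBin OLt (EVar 4) (EVar 1))
    (PAdd (EVar 4) (EBin OSub (ETab 0 (eadd (EVar 4) (ENum 1))) (ENum 1)))
    (PAdd (EVar 4) (EVar 4))).

Definition inverse_prog : prog := PFor (EVar 2) (PAdd (ETab 2 (EVar 4)) (EVar 4)).

Definition profile_prog : prog :=
  PTab extend_prog (PTab inverse_prog
    (foldr PSeq PSkip [seq count_prog tau | tau <- enum 'S_5])).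

Lemma expn_max a b : 2 ^ maxn a b = maxn (2 ^ a) (2 ^ b).
Proof.
case: (leqP a b) => ab.
  by rewrite (maxn_idPr _) // leq_exp2l.
by rewrite (maxn_idPl _) // leq_exp2l // ltnW.
Qed.

(** * Correctness of the profile program *)

Section Main.
Variables (w n : nat) (pi : 'S_n).
Notation W := (2 ^ w).
Let L := bitlen n.
Let N := 2 ^ L.
Let S := N ^ 8.
Hypothesis SW : S < W.
Let Y := extend pi.
Let X := extend pi^-1.
Local Notation ev := (ev w S).
Local Notation dn := (dn w S true).
Local Notation base := (base L Y X).

Let L0 : 0 < L. Proof. by []. Qed.
Let nN : n < N. Proof. exact: ltn_bitlen. Qed.
Let YN i : i < N -> Y i < N. Proof. exact/extend_lt/ltnW. Qed.
Let XN i : i < N -> X i < N. Proof. exact/extend_lt/ltnW. Qed.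
Let YK : cancel Y X. Proof. exact: extendK. Qed.
Let XK : cancel X Y.
Proof. by move=> i; have := extendK pi^-1 i; rewrite invgK. Qed.

Let LN : L < N. Proof. exact: ltn_expl. Qed.
Let LW : L < W. Proof. exact: ltn_trans LN (N_ltW L0 SW). Qed.

Definition main_env (env : nat -> nat) (tabs : nat -> nat -> nat)
    (s : nat -> nat) : Prop :=
  [/\ base 4 4 env tabs, env 1 = n, env 3 = L,
    (forall o, tabs 0 o = raw L pi o) & forall c, c < 8 -> env (4 + c.*2) = s c].

Lemma rank_lt (tau : 'S_5) : enum_rank tau < S.
Proof.
apply: (leq_trans (ltn_ord _)); rewrite card_Sn (@leq_trans (2 ^ 8)) //.
by rewrite leq_exp2r //; exact: (N_gt1 L0).
Qed.

Section Level.
Variables (env : nat -> nat) (tabs : nat -> nat -> nat) (s : nat -> nat).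
Hypotheses (M : main_env env tabs s) (sL : forall c, c < 8 -> s c < L).

Let B : base 20 4 env tabs. Proof. by case: M => -[_ _ h2 h3 h4] _ _ _ _; split. Qed.

Section Eval.
Variables (env' : nat -> nat) (tabs' : nat -> nat -> nat).
Hypothesis E : ext 20 4 env tabs env' tabs'.
Local Notation val e b := (ev env' tabs' e = nat_of_bool b).

Let env_var i j : i < 20 -> env i = j -> j < W -> ev env' tabs' (EVar i) = j.
Proof. by move=> i20 ij jW; apply: ev_outer_var E. Qed.

Let ev_num a : a < W -> ev env' tabs' (ENum a) = a. Proof. exact: modn_small. Qed.

Lemma ev_epow e a : ev env' tabs' e = a -> a < L -> ev env' tabs' (epow e) = 2 ^ a.
Proof.
case: M => _ e1 _ hraw _ ea aL; have nls : n + L < S := input_lt n.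
have sw := SW; have W1 := W_gt1 L0 SW.
have h1 : ev env' tabs' (eadd (EVar 1) (ENum 1)) = n + 1.
  by rewrite ev_add (env_var _ e1) ?ev_num //; lia.
have h2 : ev env' tabs' (eadd (eadd (EVar 1) (ENum 1)) e) = n + 1 + a.
  by rewrite ev_add h1 ea //; lia.
rewrite -[ev _ _ _]/(tabs' 0 (ev env' tabs' (eadd (eadd (EVar 1) (ENum 1)) e) %% S)).
rewrite h2 modn_small; last lia.
case: E => _ -> //; rewrite hraw /raw -addnA add1n addnS ltnS leq_addr /=.
rewrite (_ : n + a < n + L); last by rewrite ltn_add2l.
by rewrite subSS addKn.
Qed.

Lemma ev_level_pow c : c < 8 -> ev env' tabs' (level_pow c) = 2 ^ s c.
Proof.
move=> c8; have := sL c8; case: M => _ _ _ _ h; apply: ev_epow.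
apply: env_var; [lia|exact: h|by apply: ltn_trans LW; apply: sL].
Qed.

Lemma ev_level_emx off pos i j : off <= 4 ->
  ev env' tabs' (level_emx off pos i j) = level_mx pos (fun c => s (off + c)) i j.
Proof.
move=> off4; rewrite /level_emx /level_mx /span.
rewrite -(big_mkord (fun c => minn (pos i) (pos j) <= c < maxn (pos i) (pos j))
  (fun c => (s (off + c)).+1)) -big_filter /index_iota subn0.
set cs := [seq c <- _ | _]; have : all (gtn 4) cs.
  by apply/allP => c; rewrite mem_filter mem_iota => /andP[].
suff h : all (gtn 4) cs -> \max_(c <- cs) (s (off + c)).+1 <= L /\
    ev env' tabs' (foldr emax (ENum 1) [seq emul (ENum 2) (level_pow (off + c)) | c <- cs]) =
    2 ^ (\max_(c <- cs) (s (off + c)).+1) by case/h.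
elim: cs => [|c cs IH]; first by rewrite big_nil; split=> //; apply/ev_num/(W_gt1 L0 SW).
case/andP=> c4 /IH[ml {}IH]; rewrite big_cons geq_max ml expn_max -IH andbT.
have lc : s (off + c) < L by apply: sL; rewrite /= in c4; lia.
have pW a : a <= L -> 2 ^ a < W.
  by move=> aL; apply: leq_ltn_trans (N_ltW L0 SW); rewrite leq_exp2l.
have pc : ev env' tabs' (emul (ENum 2) (level_pow (off + c))) = 2 ^ (s (off + c)).+1.
  by rewrite ev_mul ev_num ?(W_gt2 L0 SW) // ev_level_pow -?expnS ?pW //; rewrite /= in c4; lia.
split=> //; rewrite -pc; apply: (ev_max L0 SW); first by rewrite pc pW.
by rewrite IH pW.
Qed.

Lemma ev_bit c v : c < 8 -> ev env' tabs' v < N ->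
  val (bit_exp c v) (odd (ev env' tabs' v %/ 2 ^ s c)).
Proof.
move=> c8 vN; have vW := ltn_trans vN (N_ltW L0 SW).
have h : ev env' tabs' (ediv v (level_pow c)) = ev env' tabs' v %/ 2 ^ s c.
  by rewrite ev_div //; congr (_ %/ _); apply: ev_level_pow.
rewrite -[LHS]/((ev env' tabs' (ediv v (level_pow c)) %% (2 %% W)) %% W) h.
rewrite (modn_small (W_gt2 L0 SW)) modn2 modn_small //.
by apply: leq_ltn_trans (W_gt1 L0 SW); case: odd.
Qed.

Lemma ev_side off i v : off <= 4 -> i < 5 -> ev env' tabs' v < N ->
  val (side_exp off i v) (side (fun c => s (off + c)) i (ev env' tabs' v)).
Proof.
move=> off4 i5 vN; apply: ev_and => //.
  case: eqP => [_|i0]; first exact: ev_true.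
  by apply: ev_bit => //; lia.
case: eqP => [_|i4]; first exact: ev_true.
rewrite (ev_eqb L0 SW) ev_bit //; last lia.
by rewrite [ev _ _ (ENum 0)]mod0n eqb0.
Qed.

Lemma ev_point_we tau i e : ev env' tabs' e < N ->
  ev env' tabs' (point_we tau i e) = point_w n Y tau s i (ev env' tabs' e).
Proof.
move=> eN; have Ye := base_Y L0 B E eN; have [_ e1 _ _ _] := M.
apply: ev_and => //.
  by rewrite (ev_ltb L0 SW) (env_var _ e1) //; apply: ltn_trans nN (N_ltW L0 SW).
apply: ev_and => //; first exact: ev_side.
by rewrite -Ye; apply: ev_side => //; rewrite Ye; apply: YN.
Qed.

End Eval.

Lemma dn_query tau o :
  dn (query_prog tau) 20 4 env tabs o =
  (enum_rank tau == o :> nat) * query L Y (level_mx (fun i => i) s)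
    (level_mx (fun i => tau i) (fun c => s (4 + c))) (point_w n Y tau s) %[mod W].
Proof.
have cS := rank_lt tau.
apply: (dn_dispatch YN XN (fun i _ => YK i) L0 SW) => //.
- by move=> env' tabs' E; apply: modn_small; apply: ltn_trans SW.
- by move=> i j env' tabs' E; apply: ev_level_emx.
- by move=> i j env' tabs' E; apply: ev_level_emx.
- by move=> i env' tabs' e E eN; rewrite (ev_point_we E).
- by apply: good_level_mx => c c4; apply: sL; lia.
- by apply: good_level_mx => c c4; apply: sL; lia.
Qed.

End Level.

Lemma dn_level_loops k d t env tabs c A F o : env 3 = L -> 3 < d ->
  (forall env' s, size s = k -> all (gtn L) s -> (forall i, i < d -> env' i = env i) ->
    (forall a, a < k -> env' (d + a.*2) = nth 0 s a) ->
    dn c (d + k.*2) t env' tabs o = A * F s %[mod W]) ->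
  dn (level_loops k c) d t env tabs o = A * level_sum L k F %[mod W].
Proof.
elim: k d env F => [|k IH] d env F e3 d3 h.
  by rewrite -[d]addn0; apply: h.
apply: (dn_for_out (F := fun l => level_sum L k (fun s => F (l :: s)))) => //.
  by rewrite /= e3 modn_small // LW.
move=> l lL; set env1 := upd _ _ _.
have E1 i : i < d -> env1 i = env i by move=> id; rewrite /env1 /upd !ltn_eqF // ltnW.
apply: IH; [by rewrite E1|by rewrite ltnW // ltnW|].
move=> env' s sk sL h1 h2; rewrite -[d.+2]addn2 -addnA -[2 + _]/(k.+1.*2).
apply: h; rewrite /= ?sk ?lL //.
  by move=> i id; rewrite h1 ?E1 // ltnW // ltnW.
case=> [_|a ak]; first by rewrite addn0 h1 // /env1 /upd eqxx.
by rewrite [RHS]/= -h2 // doubleS !addnS !addSn.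
Qed.

Lemma dn_count tau env tabs o : base 4 4 env tabs -> env 1 = n -> env 3 = L ->
  (forall a, tabs 0 a = raw L pi a) ->
  dn (count_prog tau) 4 4 env tabs o =
  (enum_rank tau == o :> nat) * pattern_count tau pi %[mod W].
Proof.
move=> [B1 B2 B3 B4 B5] e1 e3 hraw; rewrite (pattern_count_levels pi tau nN).
apply: dn_level_loops => // env' s s8 sL h1 h2.
apply: (@dn_query env' tabs (nth 0 s)).
  by split=> //; [split=> //; rewrite h1|rewrite h1|rewrite h1].
by move=> c c8; apply: (all_nthP 0 sL); rewrite s8.
Qed.

Lemma dn_extend env tabs a : env 1 = n -> env 2 = N ->
  (forall o, tabs 0 o = raw L pi o) -> a < N ->
  dn extend_prog 4 3 env tabs a = Y a %[mod W].
Proof.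
move=> e1 e2 hraw aN; have NW := N_ltW L0 SW; have W1 := W_gt1 L0 SW.
pose f j := (j == a) * Y j.
rewrite (dn_for (m := N) (F := f)) //.
- by rewrite -(big_mkord xpredT f) (bigD1_seq a) ?mem_index_iota ?iota_uniq //=
    /f eqxx mul1n big1 ?addn0 // => j /negbTE ->.
- by rewrite /= e2 modn_small.
move=> j jN; have jW := ltn_trans jN NW.
set env1 := upd _ _ _; have v : ev env1 tabs (EVar 4) = j by exact: ev_loop_var.
have v1 : ev env1 tabs (EVar 1) = n.
  by rewrite /env1 /= /upd /= e1 modn_small // (ltn_trans nN).
have jS : j < S by apply: leq_trans jN (N_leS L0).
have g : ev env1 tabs (EBin OLt (EVar 4) (EVar 1)) = (j < n).
  by rewrite (ev_ltb L0 SW) v v1.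
rewrite -[dn _ _ _ _ _ _]/(if ev env1 tabs (EBin OLt (EVar 4) (EVar 1)) != 0 then _ else _).
rewrite g eqb0 negbK /f; case: ifP => jn; apply: dn_add; rewrite ?v //.
  have v2 : ev env1 tabs (ETab 0 (eadd (EVar 4) (ENum 1))) = (Y j).+1.
    have -> : ev env1 tabs (ETab 0 (eadd (EVar 4) (ENum 1))) =
      tabs 0 (ev env1 tabs (eadd (EVar 4) (ENum 1)) %% S) by [].
    rewrite ev_add v [ev _ _ (ENum 1)]modn_small //; last first.
      by rewrite addn1; apply: leq_ltn_trans NW.
    rewrite addn1 modn_small; last first.
      apply: leq_ltn_trans jN _; apply: (@leq_trans (N ^ 2)); last exact: (expN_leS L0 (k := 2)).
      by rewrite -{1}[N]expn1 ltn_exp2l // (N_gt1 L0).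
    rewrite hraw /raw ltnNge jn /= /Y /extend.
    by case: insubP => //; rewrite jn.
  rewrite -[ev _ _ _]/((ev env1 tabs (ETab 0 (eadd (EVar 4) (ENum 1))) + (W - 1 %% W)) %% W).
  (* [W - 1] stands for -1 and cancels the successor modulo [W]. *)
  by rewrite v2 modn_mod (modn_small W1) addSn -addnS -subSn 1?ltnW // subn1 modnDr.
by rewrite /Y extend_ge // leqNgt jn.
Qed.

Lemma dn_inverse env tabs a : env 2 = N -> (forall i, i < N -> tabs 2 i = Y i) -> a < N ->
  dn inverse_prog 4 4 env tabs a = X a %[mod W].
Proof.
move=> e2 hY aN; have NW := N_ltW L0 SW; have W1 := W_gt1 L0 SW.
pose f j := (Y j == a) * j.
rewrite (dn_for (m := N) (F := f)) //.
- rewrite -(big_mkord xpredT f) (bigD1_seq (X a)) ?mem_index_iota ?iota_uniq ?XN //=.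
  rewrite /f XK eqxx mul1n big1 ?addn0 // => j jX.
  by case: (Y j =P a) jX => // <-; rewrite YK eqxx.
- by rewrite /= e2 modn_small.
move=> j jN; have jW := ltn_trans jN NW.
set env1 := upd _ _ _; have v : ev env1 tabs (EVar 4) = j by exact: ev_loop_var.
have jS : j < S by apply: leq_trans jN (N_leS L0).
have Yj : ev env1 tabs (ETab 2 (EVar 4)) = Y j.
  rewrite -[ev _ _ _]/(tabs 2 (ev env1 tabs (EVar 4) %% S)) v modn_small // hY //.
by apply: dn_add; rewrite ?Yj ?v //; apply: leq_trans (YN jN) (N_leS L0).
Qed.

Definition extend_tabs : nat -> nat -> nat :=
  upd (tabs0 pi) 2 (fun x => dn extend_prog 4 3 (env0 n) (tabs0 pi) x %% W).
Definition main_tabs : nat -> nat -> nat :=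
  upd extend_tabs 3 (fun x => dn inverse_prog 4 4 (env0 n) extend_tabs x %% W).

Lemma base_main : base 4 4 (env0 n) main_tabs.
Proof.
have NW := N_ltW L0 SW.
have h2 i : i < N -> extend_tabs 2 i = Y i.
  move=> iN; rewrite -[LHS]/(dn extend_prog 4 3 (env0 n) (tabs0 pi) i %% W) dn_extend //.
  rewrite modn_small //.
  exact: ltn_trans (YN iN) NW.
split=> // i iN.
rewrite -[LHS]/(dn inverse_prog 4 4 (env0 n) extend_tabs i %% W) dn_inverse //.
by rewrite modn_small // (ltn_trans (XN iN)).
Qed.

Lemma dn_profile (tau : 'S_5) :
  dn profile_prog 4 2 (env0 n) (tabs0 pi) (enum_rank tau) =
  pattern_count tau pi %[mod W].
Proof.
rewrite 2!dn_tab -/extend_tabs -/main_tabs; have B := base_main.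
have hc tau' := dn_count tau' (enum_rank tau) B erefl erefl (fun _ => erefl).
(* Different patterns write to different cells, so only the program for [tau] contributes. *)
transitivity ((\sum_(t <- enum 'S_5) (t == tau) * pattern_count t pi) %% W).
  elim: (enum _) => [|t s IH]; first by rewrite big_nil.
  rewrite big_cons -[dn _ _ _ _ _ _]/(
    dn (count_prog t) 4 4 (env0 n) main_tabs (enum_rank tau) +
    dn (foldr PSeq PSkip [seq count_prog tau | tau <- s]) 4 4 (env0 n) main_tabs
      (enum_rank tau)).
  by rewrite -modnDm IH hc modnDm val_eqE (inj_eq enum_rank_inj).
rewrite big_enum /= (bigD1 tau) ?inE //= eqxx mul1n big1 ?addn0 // => t.
by case: eqP; rewrite ?andbF.
Qed.

End Main.

(** * Well-formedness *)

(** The counterpart of [ext] for well-formedness: a scope with more registers and more readable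
    tables. *)
Definition later (d : nat) (rd : pred nat) (d' : nat) (rd' : pred nat) : Prop :=
  d <= d' /\ forall k, rd k -> rd' k.

Definition fwf d rd (we : exp -> exp) : Prop := forall d' rd' e,
  later d rd d' rd' -> ewf d' rd' e -> ewf d' rd' (we e).

Lemma later_ewf d rd d' rd' e : later d rd d' rd' -> ewf d rd e -> ewf d' rd' e.
Proof. by case=> dd rr; apply: ewf_mono. Qed.

Lemma later_trans d rd d' rd' d'' rd'' :
  later d rd d' rd' -> later d' rd' d'' rd'' -> later d rd d'' rd''.
Proof. by move=> [h1 h2] [h3 h4]; split=> [|k /h2 /h4//]; apply: leq_trans h3. Qed.

Lemma later_refl d rd : later d rd d rd. Proof. by []. Qed.

Lemma later_tab d rd d' rd' t : later d rd d' rd' ->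
  later d rd d' (fun k => (k == t) || rd' k).
Proof. by case=> h1 h2; split=> // k /h2 ->; rewrite orbT. Qed.

Lemma later_for d rd d' rd' : later d rd d' rd' -> later d rd d'.+2 rd'.
Proof. by case=> h1 h2; split=> //; lia. Qed.

Section Cycle.
Variables (K d t : nat) (rd : pred nat) (out : exp) (dx dy : nat -> exp).
Variables (wp wq ws wr wt : exp -> exp) (g g2 : exp).
Hypotheses (d2 : 2 < d) (r2 : rd 2) (r3 : rd 3) (tK : t + 4 <= K).
Hypotheses (Ho : ewf d rd out) (Hg : ewf d rd g) (Hg2 : ewf d rd g2).
Hypotheses (Hx : forall e, ewf d rd (dx e)) (Hy : forall e, ewf d rd (dy e)).
Hypotheses (Hp : fwf d rd wp) (Hq : fwf d rd wq) (Hs : fwf d rd ws)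
  (Hr : fwf d rd wr) (Ht : fwf d rd wt).

Let later0 := later_refl d rd.

Lemma wf_cycle : wf K d t rd (cycle_prog d t out dx dy wp wq ws wr wt g g2).
Proof.
have Lo d' rd' : later d rd d' rd' -> ewf d' rd' out by move/later_ewf->.
have Lx e d' rd' : later d rd d' rd' -> ewf d' rd' (dx e) by move/later_ewf->.
have Ly e d' rd' : later d rd d' rd' -> ewf d' rd' (dy e) by move/later_ewf->.
rewrite /cycle_prog /triples_prog /pairs_loop_prog /yloop_prog /xloop_prog.
rewrite /path_prog /tabulate /lookup /restrict /same /shift_x /shift_y.
rewrite /pair_key /block_x /block_y /ekey /=.
repeat first [ by rewrite ?r2 ?r3 ?eqxx ?orbT | apply/andP; split
  | apply: Lo | apply: Lx | apply: Ly | apply: Hg | apply: Hg2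
  | apply: Hp | apply: Hq | apply: Hs | apply: Hr | apply: Ht
  | exact: later0 | apply: later_tab | apply: later_for | by rewrite /=; lia ].
Qed.

End Cycle.

Section Guards.
Variables (d : nat) (rd : pred nat).
Local Notation ok e := (ewf d rd e).

Lemma ewf_mul a b : ok a -> ok b -> ok (emul a b).
Proof. by rewrite /= => -> ->. Qed.

Variables LX LY : emx.

Lemma ewf_nearest M p q : (forall i j, ok (M i j)) -> ok (nearest_exp M p q).
Proof.
move=> h; rewrite /nearest_exp; elim: [seq z <- _ | _] => //= z s IH.
by rewrite !h IH.
Qed.

Lemma ewf_cycle_mx M g : (forall i j, ok (M i j)) -> ok (cycle_mx_exp M g).
Proof. by case: g => [[[[p q] s] r] t] h; rewrite /= !h. Qed.

Lemma ewf_final g : (forall i j, ok (LX i j)) -> (forall i j, ok (LY i j)) ->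
  ok (final_ok_exp LX LY g).
Proof.
case: g => [[[[p q] s] r] t] hx hy; rewrite /final_ok_exp /eands.
do 2!(apply: ewf_mul; first exact: ewf_cycle_mx).
by rewrite /= !(hx, hy).
Qed.

End Guards.

Lemma ewf_plan_ok d rd ms g LX LY : (forall i j, ewf d rd (LX i j)) ->
  (forall i j, ewf d rd (LY i j)) -> ewf d rd (plan_ok_exp ms g LX LY).
Proof.
elim: ms LX LY => [|[[p q] u] ms IH] LX LY hx hy; first exact: ewf_final.
do 2!(apply: ewf_mul; first exact: ewf_nearest).
by apply: ewf_mul => //; apply: IH => i j; [apply: hx|apply: hy].
Qed.

Section Plan.
Variables (K d : nat) (out g1 g2 : exp).
Hypothesis d2 : 2 < d.

Lemma wf_plan ms g t (rd : pred nat) LX LY we : rd 2 -> rd 3 -> t + size ms + 4 <= K ->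
  ewf d rd out -> ewf d rd g1 -> ewf d rd g2 ->
  (forall i j, ewf d rd (LX i j)) -> (forall i j, ewf d rd (LY i j)) ->
  (forall i, fwf d rd (we i)) ->
  wf K d t rd (plan_prog d out g1 g2 ms g t LX LY we).
Proof.
elim: ms t rd LX LY we => [|[[p q] u] ms IH] t rd LX LY we r2 r3 tK ho h1 h2 hx hy hw.
  case: g => [[[[a b] c] e] f]; rewrite addn0 in tK.
  by apply: wf_cycle => //; move=> [|[|[|[|[|[|]]]]]] //=.
have l : later d rd d (fun k => (k == t) || rd k) by exact/later_tab/later_refl.
have tab : wf K d t rd (tabulate d (ekey (LX p q) (LY p q)) (we p)
    (plan_prog d out g1 g2 ms g t.+1 (merge_emx p u LX) (merge_emx p u LY)
      (merge_we LX LY p q t we))); last by [].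
rewrite /tabulate; apply/and3P; split; first by rewrite /= in tK; lia.
  have l2 : later d rd d.+2 rd by exact/later_for/later_refl.
  have dd : d < d.+2 by rewrite ltnS leqnSn.
  rewrite /= d2 r2 dd (ltn_trans d2 dd) (hw p _ _ (EVar d) l2) //.
  by rewrite (later_ewf l2 (hx p q)) (later_ewf l2 (hy p q)).
apply: IH; rewrite ?r2 ?r3 ?orbT ?(later_ewf l) //.
- by rewrite /= in tK; lia.
- by move=> i j; apply: later_ewf l _; apply: hx.
- by move=> i j; apply: later_ewf l _; apply: hy.
move=> i d' rd' e l'; have l3 := later_trans l l'; rewrite /merge_we.
case: eqP => // _; case: eqP => _; last exact: hw.
have [dd rr] := l'; have [_ rr3] := l3.
rewrite /= => we'; rewrite (hw q _ _ e l3 we') we' (rr t) ?eqxx // (rr3 2) //.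
by rewrite (later_ewf l3 (hx p q)) (later_ewf l3 (hy p q)) (leq_trans d2).
Qed.

Lemma wf_dispatch pls t (rd : pred nat) LX LY we : rd 2 -> rd 3 -> t + 8 <= K ->
  all (fun pl => size pl.1 <= 4) pls ->
  ewf d rd out -> ewf d rd g1 -> ewf d rd g2 ->
  (forall i j, ewf d rd (LX i j)) -> (forall i j, ewf d rd (LY i j)) ->
  (forall i, fwf d rd (we i)) ->
  wf K d t rd (dispatch d out g1 g2 pls t LX LY we).
Proof.
move=> r2 r3 tK + ho h1 h2 hx hy hw; elim: pls => //= pl pls IH /andP[s4 /IH ->].
by rewrite ewf_plan_ok // wf_plan //; lia.
Qed.

End Plan.

Lemma size_plans : all (fun pl => size pl.1 <= 4) plans.
Proof.
apply/allP => -[ms g]; rewrite mem_filter => /andP[_ /flatten_mapP[k]].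
by rewrite mem_iota => k5 /allpairsP[[ms' g'] [_ _ [-> _]]]; rewrite /= size_tuple.
Qed.

Definition tables03 : pred nat := fun k => [|| k == 3, k == 2 | pred1 0 k].

Lemma wf_query tau : wf 16 20 4 tables03 (query_prog tau).
Proof.
apply: wf_dispatch => //; [exact: size_plans|..].
- move=> i j; rewrite /level_emx; set cs := [seq c <- _ | _].
  have : all (gtn 4) cs by apply/allP => c; rewrite mem_filter mem_iota => /andP[].
  elim: cs => //= c cs IH /andP[c4 /IH ->]; rewrite andbT; lia.
- move=> i j; rewrite /level_emx; set cs := [seq c <- _ | _].
  have : all (gtn 4) cs by apply/allP => c; rewrite mem_filter mem_iota => /andP[].
  elim: cs => //= c cs IH /andP[c4 /IH ->]; rewrite andbT; lia.
move=> i d' rd' e [d20 rr] we; have r0 : rd' 0 by apply: rr.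
have r2 : rd' 2 by apply: rr.
have side off (j : label) v : off <= 4 -> ewf d' rd' v -> ewf d' rd' (side_exp off j v).
  move=> off4 wv; have j5 := ltn_ord j; rewrite /side_exp.
  have bit c : c < 8 -> ewf d' rd' (bit_exp c v).
    by move=> c8; rewrite /= wv r0; lia.
  apply: ewf_mul; case: eqP => // h; first by apply: bit; lia.
  by rewrite -[ewf _ _ _]/(ewf d' rd' (bit_exp (off + j) v) && true) bit //; lia.
apply: ewf_mul; first by rewrite /= we; lia.
by apply: ewf_mul; apply: side => //=; rewrite r2.
Qed.

Lemma wf_level_loops K k d t rd c : 3 < d -> wf K (d + k.*2) t rd c ->
  wf K d t rd (level_loops k c).
Proof.
elim: k d => [|k IH] d d3 h; first by rewrite addn0 in h.
by rewrite /= d3 IH //; [lia|move: h; rewrite doubleS !addnS].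
Qed.

Lemma wf_profile : wf 16 4 2 (pred1 0) profile_prog.
Proof.
rewrite /profile_prog; apply/and3P; split=> //; apply/and3P; split=> //.
elim: (enum _) => // tau s IH; apply/andP; split; last exact: IH.
exact: (@wf_level_loops 16 8 4 4 tables03 (query_prog tau) isT (wf_query tau)).
Qed.

(** * Running time *)

(* The cost is bounded by the size of the program, with weights [csz], times the
   number [trip] of iterations of its loops. *)
Fixpoint csz (c : prog) : nat :=
  match c with
  | PSkip => 1
  | PAdd a v => esize a + esize v + 8
  | PSeq c1 c2 => csz c1 + csz c2
  | PFor b c => esize b + 5 + (csz c + 6)
  | PIte e c1 c2 => esize e + 3 + (csz c1 + csz c2)
  | PTab c1 c2 => 2 * csz c1 + csz c2
  end.

Section Trip.
Variables w S : nat.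
Notation W := (2 ^ w).

(** Sequences and tables take a maximum, since the addition over parts of the program is left to
    [csz]. The lower bound 1 pays for a loop that makes no round. *)
Fixpoint trip (c : prog) (d t : nat) (env : nat -> nat)
    (tabs : nat -> nat -> nat) : nat :=
  match c with
  | PSkip | PAdd _ _ => 1
  | PSeq c1 c2 => maxn (trip c1 d t env tabs) (trip c2 d t env tabs)
  | PFor b c => let m := ev w S env tabs b %% W in
      maxn 1 (\sum_(j < m) trip c d.+2 t (upd (upd env d.+1 m) d j) tabs)
  | PIte e c1 c2 => if ev w S env tabs e != 0 then trip c1 d t env tabs
      else trip c2 d t env tabs
  | PTab c1 c2 => maxn (trip c1 d t.+1 env tabs) (trip c2 d t.+1 env
      (upd tabs t (fun o => dn w S true c1 d t.+1 env tabs o %% W)))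
  end.

Lemma trip_gt0 c d t env tabs : 0 < trip c d t env tabs.
Proof.
elim: c d t env tabs => //= [c1 IH1 c2 IH2|b c IH|e c1 IH1 c2 IH2|c1 IH1 c2 IH2] d t env tabs.
- by rewrite leq_max IH1.
- by rewrite leq_max.
- by case: ifP.
- by rewrite leq_max IH1.
Qed.

Lemma cost_trip c d t env tabs :
  cost w S c d t env tabs <= csz c * trip c d t env tabs.
Proof.
elim: c d t env tabs => //= [a v|c1 IH1 c2 IH2|b c IH|e c1 IH1 c2 IH2|c1 IH1 c2 IH2]
  d t env tabs.
- by rewrite muln1.
- rewrite mulnDl; apply: leq_add.
    by apply: leq_trans (IH1 _ _ _ _) _; rewrite leq_mul2l leq_maxl orbT.
  by apply: leq_trans (IH2 _ _ _ _) _; rewrite leq_mul2l leq_maxr orbT.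
- set m := _ %% _; set s := \sum_(j < m) trip _ _ _ _ _.
  rewrite mulnDl; apply: leq_add.
    by rewrite -[leqLHS]muln1 leq_mul2l leq_maxl orbT.
  apply: (@leq_trans ((csz c + 6) * s)); last by rewrite leq_mul2l leq_maxr orbT.
  rewrite big_distrr /=; apply: leq_sum => j _; rewrite mulnDl leq_add //.
  by rewrite leq_pmulr // trip_gt0.
- rewrite mulnDl; apply: leq_add; first by rewrite leq_pmulr //; case: ifP => _; apply: trip_gt0.
  rewrite mulnDl; case: ifP => _.
    exact: leq_trans (IH1 _ _ _ _) (leq_addr _ _).
  exact: leq_trans (IH2 _ _ _ _) (leq_addl _ _).
- rewrite mulnDl -mulnA; apply: leq_add.
    rewrite leq_mul2l; apply: leq_trans (IH1 _ _ _ _) _.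
    by rewrite leq_mul2l leq_maxl orbT.
  by apply: leq_trans (IH2 _ _ _ _) _; rewrite leq_mul2l leq_maxr orbT.
Qed.

End Trip.

(** * Numbers of loop rounds *)

Section TripBounds.
Variables (w L : nat) (Y X : nat -> nat).
Notation W := (2 ^ w).
Let N := 2 ^ L.
Let S := N ^ 8.
Hypotheses (L0 : 0 < L) (SW : S < W).
Local Notation vspec := (vspec w L).
Local Notation base := (base L Y X).
Local Notation trip := (trip w S).

Section Rules.
Variables (d t : nat) (env : nat -> nat) (tabs : nat -> nat -> nat).

Definition trip_le c d' t' B : Prop := forall env' tabs',
  ext d t env tabs env' tabs' -> trip c d' t' env' tabs' <= B.

Lemma trip_add a v d' t' B : 0 < B -> trip_le (PAdd a v) d' t' B.
Proof. by move=> B0 env1 tabs1 _. Qed.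

Lemma trip_for b m c d' t' B C : vspec d t env tabs b m -> m < W -> d <= d' ->
  trip_le c d'.+2 t' B -> 0 < C -> m * B <= C -> trip_le (PFor b c) d' t' C.
Proof.
move=> hb mW dd hc C0 mBC env' tabs' E; rewrite /= (hb _ _ E) modn_small // geq_max C0.
apply: leq_trans mBC; rewrite -[X in _ <= X * _]card_ord -sum_nat_const.
apply: leq_sum => j _; apply: hc.
by apply: (ext_trans dd (leqnn t) E); apply: ext_for.
Qed.

Lemma trip_tab c1 c2 d' t' B : t <= t' -> trip_le c1 d' t'.+1 B ->
  trip_le c2 d' t'.+1 B -> trip_le (PTab c1 c2) d' t' B.
Proof.
move=> tt h1 h2 env' tabs' E; rewrite /= geq_max h1 // h2 //.
by apply: (ext_trans (leqnn d) tt E); apply: ext_tab.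
Qed.

Lemma trip_ite e c1 c2 d' t' B : trip_le c1 d' t' B -> trip_le c2 d' t' B ->
  trip_le (PIte e c1 c2) d' t' B.
Proof. by move=> h1 h2 env' tabs' E /=; case: ifP => _; [apply: h1|apply: h2]. Qed.

Lemma trip_lt_ite a b x y c1 c2 d' t' B :
  vspec d t env tabs a x -> vspec d t env tabs b y ->
  (x < y -> trip_le c1 d' t' B) -> (y <= x -> trip_le c2 d' t' B) ->
  trip_le (PIte (EBin OLt a b) c1 c2) d' t' B.
Proof.
move=> ha hb h1 h2 env' tabs' E.
rewrite -[trip _ _ _ _ _]/(if ev w S env' tabs' (EBin OLt a b) != 0 then _ else _).
rewrite (ev_ltb L0 SW) (ha _ _ E) (hb _ _ E) eqb0 negbK.
by case: ltnP => xy; [apply: h1|apply: h2].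
Qed.

Lemma trip_leW c d' t' B C : trip_le c d' t' B -> B <= C -> trip_le c d' t' C.
Proof. by move=> h BC env' tabs' E; apply: leq_trans (h _ _ E) BC. Qed.

End Rules.

Section Cycle.
Variables (d t : nat) (env : nat -> nat) (tabs : nat -> nat -> nat).
Hypothesis B : base d t env tabs.
Local Notation trip_le := (trip_le d t env tabs).

Let vN : vspec d t env tabs (EVar 2) N.
Proof. by move=> env' tabs' E; apply: (base_N L0 SW B E). Qed.

Let NW : N < W. Proof. exact: N_ltW. Qed.
Let N0 : 0 < N. Proof. exact: N_gt0. Qed.

Lemma trip_tabulate ke we c d' t' C : d <= d' -> t <= t' -> N <= C ->
  trip_le c d' t'.+1 C -> trip_le (tabulate d' ke we c) d' t' C.
Proof.
move=> dd tt NC h; have C0 := leq_trans N0 NC; apply: trip_tab => //.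
by apply: (trip_for vN NW dd (@trip_add _ _ _ _ _ _ d'.+2 t'.+1 1 _)); rewrite ?muln1.
Qed.

Lemma trip_path out m M fe k1 k2 k3 k4 w1 w2 w3 w4 w5 C :
  vspec d t env tabs m M -> M < W -> 0 < C -> M * N <= C ->
  trip_le (path_prog d t out m fe k1 k2 k3 k4 w1 w2 w3 w4 w5) d t C.
Proof.
move=> hm MW C0 MC; apply: (trip_for hm MW (leqnn d) _ C0 MC).
do 4!(apply: trip_tabulate; [by lia|by lia|by []|]).
by apply: (trip_for vN NW _ (@trip_add _ _ _ _ _ _ _ _ 1 _)); rewrite ?muln1 //; lia.
Qed.

Variables (out : exp) (dx dy : nat -> exp) (u v : nat -> nat).
Variables (wp wq ws wr wt : exp -> exp) (g g2 : exp) (G C : nat).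
Hypotheses (Hx : forall e, vspec d t env tabs (dx e) (u e))
  (Hy : forall e, vspec d t env tabs (dy e) (v e)).
Hypotheses (Hg : vspec d t env tabs g G) (Hg2 : vspec d t env tabs g2 (G ^ 2)).
Hypotheses (G0 : 0 < G) (GN : G ^ 4 <= N) (GC : G * C = N ^ 2).

Let GN1 : G <= N.
Proof. by apply: leq_trans GN; rewrite -{1}(expn1 G) leq_pexp2l. Qed.

Lemma path_leC : N <= C.
Proof.
by rewrite -(leq_pmul2l G0) GC expnS expn1 leq_mul2r GN1 orbT.
Qed.

Let C0 : 0 < C. Proof. exact: leq_trans path_leC. Qed.

Let leC a : G * a <= N ^ 2 -> a <= C.
Proof. by rewrite -GC leq_pmul2l. Qed.

Let vspec_quot e m : vspec d t env tabs e m ->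
  vspec d t env tabs (ediv (EVar 2) e) (N %/ m).
Proof.
by move=> he env' tabs' E; rewrite ev_div (vN E) ?(he _ _ E) // NW.
Qed.

Let quot_ltW m : N %/ m < W.
Proof. exact: leq_ltn_trans (leq_div _ _) NW. Qed.

(** [C] is [N ^ 2 / G]; the form [G * C = N ^ 2] turns each bound [a <= C] into an inequality
    between products. *)
Lemma trip_cycle : trip_le (cycle_prog d t out dx dy wp wq ws wr wt g g2) d t C.
Proof.
have long m : G <= m -> N %/ m * N <= C.
  move=> Gm; apply: leC; rewrite mulnA expnS expn1 leq_mul2r; apply/orP; right.
  by apply: leq_trans (leq_divM N m); rewrite mulnC leq_mul2l Gm orbT.
apply: (trip_lt_ite (Hx 3) Hg) => u3; last first.
  by apply: trip_path (vspec_quot (Hx 3)) (quot_ltW _) C0 (long _ u3).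
apply: (trip_lt_ite (Hy 5) Hg) => v5; last first.
  by apply: trip_path (vspec_quot (Hy 5)) (quot_ltW _) C0 (long _ v5).
have uW : u 3 < W by apply: ltn_trans u3 (leq_ltn_trans GN1 NW).
have vW : v 5 < W by apply: ltn_trans v5 (leq_ltn_trans GN1 NW).
have one a b d' t' : trip_le (PAdd a b) d' t' 1 by apply: trip_add.
have pairs b m d' t' a e : vspec d t env tabs b m -> m < G -> d <= d' ->
    trip_le (PFor (EVar 2) (PFor b (PAdd a e))) d' t' (N * G).
  move=> hb mG dd; have NG0 : 0 < N * G by rewrite muln_gt0 N0.
  apply: (trip_for vN NW dd _ NG0 (leqnn _)).
  have mW : m < W by apply: ltn_trans mG (leq_ltn_trans GN1 NW).
  have d2 : d <= d'.+2 by lia.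
  by apply: (trip_for hb mW d2 (one a e _ _) G0); rewrite muln1 ltnW.
apply: (trip_lt_ite (Hy 2) Hg2) => v2.
  have v2W : v 2 < W.
    by apply: ltn_trans v2 (leq_ltn_trans _ NW); apply: leq_trans GN; rewrite leq_pexp2l.
  apply: trip_tab => //.
    apply: (trip_leW (pairs _ _ _ _ _ _ (Hy 5) v5 (leqnn _))).
    apply: leC; apply: leq_trans (_ : N * G ^ 4 <= _); last first.
      by rewrite [N ^ 2]expnS expn1 leq_mul2l GN orbT.
    by rewrite mulnCA leq_mul2l mulnn leq_pexp2l ?orbT.
  have G2 : 0 < G ^ 2 by rewrite expn_gt0 G0.
  have G3 : 0 < G * G ^ 2 by rewrite muln_gt0 G0.
  (* The triples take [N * G ^ 3] rounds. Here [G ^ 4 <= N] is used in full, which fixes the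
     exponent 1/4. *)
  apply: (@trip_for _ _ _ _ _ _ _ d t.+1 (G * G ^ 2) _ vN) => //; last first.
    apply: leC; rewrite mulnCA [N ^ 2]expnS expn1 leq_mul2l; apply/orP; right.
    by rewrite -!expnS.
  have d2 : d <= d.+2 by lia. have d4 : d <= d.+4 by lia.
  apply: (@trip_for _ _ _ _ _ _ _ d.+2 t.+1 (G ^ 2) _ (Hx 3)) => //.
    apply: (@trip_for _ _ _ _ _ _ _ d.+4 t.+1 1 _ (Hy 2)) => //.
    by rewrite muln1 ltnW.
  by rewrite leq_mul2r ltnW ?orbT.
(* Since [G ^ 2 <= v 2], the number of value blocks makes up for the factor [G] of the pairs and
   saves another one. *)
have NGC : N %/ v 2 * (N * G) <= C.
  have -> : N %/ v 2 * (N * G) = N * (N %/ v 2 * G) by rewrite mulnCA.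
  apply: leC; rewrite mulnCA [N ^ 2]expnS expn1 leq_mul2l; apply/orP; right.
  rewrite mulnCA mulnn.
  by apply: leq_trans (leq_divM N (v 2)); rewrite leq_mul2l v2 orbT.
have d2 : d <= d.+2 by lia.
apply: (trip_for (vspec_quot (Hy 2)) (quot_ltW _) (leqnn d) _ C0 NGC).
apply: trip_tabulate => //; first by rewrite leq_pmulr.
apply: trip_tab => //; first exact: (pairs _ _ _ _ _ _ (Hx 3) u3 d2).
exact: (pairs _ _ _ _ _ _ (Hy 5) v5 d2).
Qed.

End Cycle.
Section Plan.
Variables (d : nat) (out g1 g2 : exp) (G C : nat).
Hypotheses (G0 : 0 < G) (GN : G ^ 4 <= N) (GC : G * C = N ^ 2).

Lemma trip_plan ms g t env tabs LX LY we (mx my : matrix5) :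
  base d t env tabs ->
  (forall i j, vspec d t env tabs (LX i j) (mx i j)) ->
  (forall i j, vspec d t env tabs (LY i j) (my i j)) ->
  vspec d t env tabs g1 G -> vspec d t env tabs g2 (G ^ 2) ->
  trip_le d t env tabs (plan_prog d out g1 g2 ms g t LX LY we) d t C.
Proof.
elim: ms t env tabs LX LY we mx my => [|[[p q] u] ms IH] t env tabs LX LY we mx my B hx hy h1 h2.
  case: g => [[[[a b] c] e] f].
  have one : vspec d t env tabs (ENum 1) 1.
    by move=> env' tabs' _; apply/modn_small/(W_gt1 L0 SW).
  pose u := edge mx (a, b, c, e, f); pose v := edge my (a, b, c, e, f).
  apply: (@trip_cycle _ _ _ _ B out _ _ u v _ _ _ _ _ _ _ _ _ _ _ h1 h2 G0 GN GC).
    by move=> [|[|[|[|[|[|n]]]]]] //=.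
  by move=> [|[|[|[|[|[|n]]]]]] //=.
apply: (trip_tabulate B) => //; first exact: (path_leC G0 GN GC).
move=> env' tabs' E; have t1 := leqnSn t; have d0 := leqnn d.
apply: (IH t.+1 env' tabs' _ _ _ (merge_mx p u mx) (merge_mx p u my)); last exact: ext_refl.
- exact: (base_ext d0 t1 E B).
- by move=> i j; apply: (vspec_ext d0 t1 E); apply: hx.
- by move=> i j; apply: (vspec_ext d0 t1 E); apply: hy.
- exact: (vspec_ext d0 t1 E h1).
- exact: (vspec_ext d0 t1 E h2).
Qed.

Lemma trip_dispatch pls t env tabs LX LY we (mx my : matrix5) :
  base d t env tabs ->
  (forall i j, vspec d t env tabs (LX i j) (mx i j)) ->
  (forall i j, vspec d t env tabs (LY i j) (my i j)) ->
  vspec d t env tabs g1 G -> vspec d t env tabs g2 (G ^ 2) ->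
  trip_le d t env tabs (dispatch d out g1 g2 pls t LX LY we) d t C.
Proof.
move=> B hx hy h1 h2; elim: pls => [|pl pls IH].
  by move=> env' tabs' _; apply: leq_trans (path_leC G0 GN GC); apply: N_gt0.
by apply: trip_ite => //; apply: trip_plan B hx hy h1 h2.
Qed.

End Plan.

End TripBounds.

Section Total.
Variables (w n : nat) (pi : 'S_n).
Notation W := (2 ^ w).
Let L := bitlen n.
Let N := 2 ^ L.
Let S := N ^ 8.
Hypothesis SW : S < W.
Local Notation base := (base L (extend pi) (extend pi^-1)).
Local Notation trip := (trip w S).
Let L0 : 0 < L. Proof. by []. Qed.
Let C := 2 ^ (2 * L - L %/ 4).

Let LW : L < W.
Proof. by apply: ltn_trans (ltn_expl L _) (N_ltW L0 SW). Qed.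

Lemma trip_query tau env tabs s : main_env pi env tabs s ->
  (forall c, c < 8 -> s c < L) -> trip (query_prog tau) 20 4 env tabs <= C.
Proof.
move=> M sL; have B : base 20 4 env tabs by case: M => -[_ _ h2 h3 h4] _ _ _ _; split.
have L4 : L %/ 4 * 4 <= L by apply: leq_divM.
have g1 : vspec w L 20 4 env tabs short_block (2 ^ (L %/ 4)).
  move=> env' tabs' E; apply: (ev_epow SW M E); last by rewrite ltn_Pdiv.
  have [_ _ e3 _ _] := M.
  have v3 : ev w S env' tabs' (EVar 3) = L by apply: ev_outer_var e3 LW E.
  rewrite ev_div v3 // [ev _ _ _ _ (ENum 4)]modn_small //.
  apply: leq_ltn_trans (expN_ltW L0 SW (isT : 2 <= 8)).
  by rewrite -[4]/(2 ^ 2) leq_exp2r // (N_gt1 L0).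
have g2 : vspec w L 20 4 env tabs (emul short_block short_block) ((2 ^ (L %/ 4)) ^ 2).
  move=> env' tabs' E; have v1 := g1 _ _ E.
  rewrite ev_mul v1 mulnn -expnM //; apply: leq_ltn_trans (N_ltW L0 SW).
  by rewrite leq_exp2l //; lia.
have G0 : 0 < 2 ^ (L %/ 4) by rewrite expn_gt0.
have GN : (2 ^ (L %/ 4)) ^ 4 <= 2 ^ L by rewrite -expnM leq_exp2l.
have GC : 2 ^ (L %/ 4) * C = (2 ^ L) ^ 2 by rewrite -expnD -expnM; congr (_ ^ _); lia.
have h := @trip_dispatch w L (extend pi) (extend pi^-1) L0 SW 20 (ENum (enum_rank tau))
  short_block (emul short_block short_block) _ _ G0 GN GC plans 4 env tabs.
apply: (h _ _ _ _ _ B _ _ g1 g2 _ _ (ext_refl _ _ _ _)).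
- by move=> i j env' tabs' E; apply: (ev_level_emx SW M sL E).
- by move=> i j env' tabs' E; apply: (ev_level_emx SW M sL E).
Qed.

Lemma trip_level_loops k d t env tabs c B : env 3 = L -> 3 < d -> 0 < B ->
  (forall env' s, size s = k -> all (gtn L) s -> (forall i, i < d -> env' i = env i) ->
    (forall a, a < k -> env' (d + a.*2) = nth 0 s a) ->
    trip c (d + k.*2) t env' tabs <= B) ->
  trip (level_loops k c) d t env tabs <= L ^ k * B.
Proof.
elim: k d env => [|k IH] d env e3 d3 B0 h.
  by rewrite mul1n -[d]addn0; apply: (h _ [::]).
rewrite -[trip _ _ _ _ _]/(let m := env 3 %% W %% W in
  maxn 1 (\sum_(j < m) trip (level_loops k c) d.+2 t (upd (upd env d.+1 m) d j) tabs)).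
rewrite e3 !(modn_small LW) geq_max muln_gt0 expn_gt0 L0 B0 /=.
rewrite expnS -mulnA -[X in _ <= X * _]card_ord -sum_nat_const.
apply: leq_sum => l _; set env1 := upd _ _ _.
have E1 i : i < d -> env1 i = env i by move=> id; rewrite /env1 /upd !ltn_eqF // ltnW.
apply: IH => //; [by rewrite E1|by rewrite ltnW // ltnW|].
move=> env' s sk sL h1 h2; rewrite -[d.+2]addn2 -addnA -[2 + _]/(k.+1.*2).
apply: (h _ (nat_of_ord l :: s)); rewrite /= ?sk ?ltn_ord //.
  by move=> i id; rewrite h1 ?E1 // ltnW // ltnW.
case=> [_|a ak]; first by rewrite addn0 h1 // /env1 /upd eqxx.
by rewrite [RHS]/= -h2 // doubleS !addnS !addSn.
Qed.

(** The eight loops over levels contribute [L ^ 8], the polylogarithmic factor of the result. *)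
Lemma trip_profile : trip profile_prog 4 2 (env0 n) (tabs0 pi) <= L ^ 8 * C.
Proof.
have NC : N <= L ^ 8 * C.
  rewrite -[N]mul1n leq_mul ?expn_gt0 ?L0 // leq_exp2l //.
  by have := leq_divM L 4; lia.
have C0 : 0 < L ^ 8 * C by apply: leq_trans NC; rewrite expn_gt0.
have loop b c t tabs : ev w S (env0 n) tabs b = N ->
    (forall env, trip c 6 t env tabs <= 1) -> trip (PFor b c) 4 t (env0 n) tabs <= L ^ 8 * C.
  move=> hb hc; rewrite -[trip _ _ _ _ _]/(let m := ev w S (env0 n) tabs b %% W in
    maxn 1 (\sum_(j < m) trip c 6 t (upd (upd (env0 n) 5 m) 4 j) tabs)).
  rewrite hb modn_small ?(N_ltW L0 SW) // geq_max C0; apply: leq_trans NC.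
  rewrite -[X in _ <= X]card_ord -sum1_card; exact: leq_sum.
have v2 tabs : ev w S (env0 n) tabs (EVar 2) = N by apply/modn_small/(N_ltW L0 SW).
rewrite -[trip _ _ _ _ _]/(maxn (trip extend_prog 4 3 (env0 n) (tabs0 pi))
  (maxn (trip inverse_prog 4 4 (env0 n) (extend_tabs w pi))
    (trip (foldr PSeq PSkip [seq count_prog tau | tau <- enum 'S_5]) 4 4 (env0 n)
      (main_tabs w pi)))).
rewrite geq_max; apply/andP; split.
  by apply: loop => // env; simpl; case: ifP.
rewrite geq_max; apply/andP; split; first exact: loop.
elim: (enum _) => [|tau s IH] //.
rewrite -[trip _ _ _ _ _]/(maxn (trip (count_prog tau) 4 4 (env0 n) (main_tabs w pi)) _).
rewrite geq_max IH andbT; apply: trip_level_loops => //; first by rewrite expn_gt0.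
move=> env' l l8 lL h1 h2; apply: (@trip_query tau env' (main_tabs w pi) (nth 0 l)).
  have [_ _ b1 b2 b3] := base_main pi SW.
  by split=> //; [split=> //; rewrite h1|rewrite h1|rewrite h1].
by move=> c c8; apply: (all_nthP 0 lL); rewrite l8.
Qed.

Lemma cost_profile : cost w S profile_prog 4 2 (env0 n) (tabs0 pi) <=
  csz profile_prog * (L ^ 8 * C).
Proof. by apply: leq_trans (cost_trip _ _ _ _ _ _ _) _; rewrite leq_mul2l trip_profile orbT. Qed.

End Total.

Definition time (n : nat) : nat :=
  7 + 6 * bitlen n + 4 * #|'S_5| +
  csz profile_prog * (bitlen n ^ 8 * 2 ^ (2 * bitlen n - bitlen n %/ 4)).

Lemma time_le n : time n <= (13 + 4 * #|'S_5| + csz profile_prog) *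
  (bitlen n ^ 8 * 2 ^ (2 * bitlen n - bitlen n %/ 4)).
Proof.
set B := (_ ^ 8 * _); have B0 : 0 < B by rewrite muln_gt0 !expn_gt0.
have LB : bitlen n <= B.
  rewrite -[leqLHS]muln1 leq_mul ?expn_gt0 //.
  by rewrite -[leqLHS]expn1 leq_pexp2l.
rewrite /time -/B mulnDl leq_add2r; move: #|_| => q; nia.
Qed.

Lemma halted_iter w P k s : halted P s -> iter k (step w P) s = s.
Proof.
move=> h; elim: k => //= k ->; rewrite /step.
by rewrite onth_default.
Qed.

Lemma pattern_count_le k n (tau : 'S_k) (pi : 'S_n) : pattern_count tau pi <= n ^ k.
Proof. by apply: leq_trans (max_card _) _; rewrite card_ffun !card_ord. Qed.

(** Sixteen tables of [N ^ 8] cells take addresses of [8 * L + 4] bits, at most [12 * L] as [0 < L].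
    Twelve tables can be in use at once: four fixed ones, up to four for the moves and four for a
    path. *)
Theorem computes_profile_time : computes_profile 5 (wrap #|'S_5| profile_prog) 12 time.
Proof.
move=> n pi w hw s; have L0 : 0 < bitlen n by [].
set N := 2 ^ bitlen n; have nN : n < N by apply: ltn_bitlen.
have KS : 16 * N ^ 8 <= 2 ^ w.
  rewrite -[16]/(2 ^ 4) -expnM -expnD leq_exp2l //.
  by apply: leq_trans hw; rewrite -/(bitlen n); lia.
(* The exponent 8 makes room for the 120 outputs even if [N = 2]. *)
have qS : #|'S_5| <= N ^ 8.
  by rewrite card_Sn (@leq_trans (2 ^ 8)) // leq_exp2r // -[2]expn1 leq_exp2l.
have [k [s' [kT run hs mem]]] := wrap_correct pi KS isT qS wf_profile.
have SW : N ^ 8 < 2 ^ w by apply: (table_lt KS).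
have Tk : k <= time n.
  by apply: leq_trans kT _; rewrite leq_add2l; apply: cost_profile.
have -> : s = s' by rewrite /s -(subnK Tk) iterD -[iter k _ _]/(iter k _ _) run halted_iter.
split=> // tau; rewrite mem ?ltn_ord // dn_profile // modn_small ?ffunE //.
apply: leq_ltn_trans SW; apply: leq_trans (pattern_count_le _ _) _.
apply: (@leq_trans (N ^ 5)); first by rewrite leq_exp2r // ltnW.
by rewrite leq_exp2l // -(expn0 2) ltn_exp2l.
Qed.

(** * The soft O bound *)

Section Asymptotics.

(** Fourth powers avoid the fractional exponent. With [l = L - 1], rounding costs at most 3: [4 * (2
    * L - L %/ 4) <= 7 * L + 3 = 7 * l + 10], and [8 ^ 4] grants [7 * l + 12]. *)
Lemma block_pow_le n : 0 < n ->
  (2 ^ (2 * bitlen n - bitlen n %/ 4)) ^ 4 <= 8 ^ 4 * n ^ 7.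
Proof.
move=> n0; have h := trunc_logP (ltnSn 1) n0.
apply: leq_trans (_ : 8 ^ 4 * (2 ^ trunc_log 2 n) ^ 7 <= _); last first.
  by rewrite leq_mul2l leq_exp2r.
rewrite -[8]/(2 ^ 3) -!expnM -expnD leq_exp2l // /bitlen.
by have := divn_eq (trunc_log 2 n).+1 4; have := ltn_mod (trunc_log 2 n).+1 4; lia.
Qed.

Lemma bitlen_le n : 1 < n -> bitlen n <= 2 * trunc_log 2 n.
Proof.
move=> n1; rewrite /bitlen mul2n -addnn -[(trunc_log 2 n).+1]addn1 leq_add2l.
by have := trunc_log_max (ltnSn 1) (n1 : 2 ^ 1 <= n).
Qed.

Local Open Scope ring_scope.

Lemma block_pow_powR (R : realType) n : (0 < n)%N ->
  (2 ^ (2 * bitlen n - bitlen n %/ 4))%:R <= 8 * (n%:R : R) `^ (7 / 4).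
Proof.
move=> n0; rewrite -(@ler_pXn2r _ 4) ?nnegrE ?mulr_ge0 ?powR_ge0 //.
rewrite exprMn -[(_ `^ _) ^+ 4]powR_mulrn ?powR_ge0 // -powRrM mulfVK //.
by rewrite powR_mulrn // -!natrX -natrM ler_nat block_pow_le.
Qed.

Lemma bitlen_ln (R : realType) n : (1 < n)%N ->
  (bitlen n)%:R <= 2 / ln 2 * ln (n%:R : R).
Proof.
move=> n1; have l2 : 0 < ln (2 : R) by rewrite ln_gt0 // ltr1n.
have n0 : (0 < n)%N by apply: ltnW.
rewrite mulrAC ler_pdivlMr // (@le_trans _ _ ((2 * trunc_log 2 n)%:R * ln 2)) //.
  by rewrite ler_pM2r // ler_nat bitlen_le.
rewrite natrM -mulrA ler_pM2l // mulr_natl -lnXn // -natrX.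
by rewrite ler_ln ?posrE ?ltr0n ?expn_gt0 // ler_nat; apply: trunc_logP.
Qed.

Lemma softO_time (R : realType) (T : nat -> nat) c :
  (forall n, T n <= c * (bitlen n ^ 8 * 2 ^ (2 * bitlen n - bitlen n %/ 4)))%N ->
  softO (fun n => (T n)%:R : R) (fun n => n%:R `^ (7 / 4)).
Proof.
move=> hT; exists 8%N; apply/eqO_exP.
have l2 : 0 < ln (2 : R) by rewrite ln_gt0 // ltr1n.
(* The successor of [c] keeps the constant positive; [2 / ln 2] comes from [bitlen_ln], once for
   each level, and 8 from [block_pow_powR]. *)
exists (c.+1%:R * ((2 / ln 2) ^+ 8 * 8)).
  by rewrite !mulr_gt0 ?exprn_gt0 ?mulr_gt0 ?invr_gt0.
apply: filterS (nbhs_infty_gt 1) => n n1; have n0 : (0 < n)%N by apply: ltnW.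
have ln0 : 0 <= ln (n%:R : R) by rewrite ln_ge0 // ler1n.
rewrite !ger0_norm ?mulr_ge0 ?powR_ge0 ?exprn_ge0 //.
apply: le_trans (_ : (c.+1 * (bitlen n ^ 8 * 2 ^ (2 * bitlen n - bitlen n %/ 4)))%:R <= _).
  by rewrite ler_nat; apply: leq_trans (hT n) _; rewrite leq_mul2r leqnSn orbT.
rewrite 2!natrM natrX -[leRHS]mulrA ler_pM2l ?ltr0n //.
rewrite [leRHS](_ : _ = (2 / ln 2 * ln n%:R) ^+ 8 * (8 * n%:R `^ (7 / 4))); last first.
  by rewrite [(_ * ln n%:R) ^+ 8]exprMn [RHS]mulrACA [ln _ ^+ 8 * _]mulrC.
apply: ler_pM; rewrite ?exprn_ge0 ?ler0n //; last exact: block_pow_powR.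
by rewrite ler_pXn2r ?nnegrE ?ler0n ?bitlen_ln // mulr_ge0 // divr_ge0 // ltW.
Qed.
End Asymptotics.

Local Open Scope ring_scope.

Theorem theorem4p1 (R : realType) :
  exists (P : program) (d : nat) (T : nat -> nat),
    computes_profile 5 P d T /\
    softO (fun n => (T n)%:R : R) (fun n => n%:R `^ (7 / 4)).
Proof.
exists (wrap #|'S_5| profile_prog), 12%N, time; split; first exact: computes_profile_time.
exact: softO_time time_le.
Qed.
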